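(* There exists $n_0\in\mathbb{N}$ such that for all integers $n,\Delta$ with $n\ge n_0$ and $\Delta\ge 2$, every $(n,d)$-expander with \[ d\ge \Delta^{5\sqrt{\log n}} \] is $\mathcal{T}(n,\Delta)$-universal.
   Context: All graphs are finite and simple. For a graph $G$ and $X\subseteq V(G)$, $N_G(X)=\bigl(\bigcup_{v\in X}N_G(v)\bigr)\setminus X$, and $e_G(X,Y)$ is the number of edges between disjoint sets $X,Y$. Given $n\in\mathbb{N}$ and real $d>0$, an $n$-vertex graph $G$ is an $(n,d)$-expander if (i) $|N_G(X)|\ge d|X|$ for all $X\subseteq V(G)$ with $1\le |X|<\frac{n}{2d}$; and (ii) $e_G(X,Y)>0$ for all disjoint $X,Y\subseteq V(G)$ with $|X|=|Y|\ge\frac{n}{2d}$. $\mathcal{T}(n,\Delta)$ is the family of all $n$-vertex trees with maximum degree at most $\Delta$. A graph $G$ is $\mathcal{T}(n,\Delta)$-universal if it contains every $T\in\mathcal{T}(n,\Delta)$ as a (not necessarily induced) subgraph. $\log$ denotes the natural logarithm. *)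

(* Defs.v *)
From mathcomp Require Import all_boot all_order all_algebra.
From mathcomp Require Import all_classical all_reals all_analysis.

Set Implicit Arguments.
Unset Strict Implicit.
Unset Printing Implicit Defensive.

Import Order.TTheory GRing.Theory Num.Theory.
Local Open Scope ring_scope.

Record sgraph := SGraph {
  vertex :> finType;
  edge : rel vertex;
  edge_sym : symmetric edge;
  edge_irrefl : irreflexive edge
}.

Definition nbr (G : sgraph) (v : G) : {set G} := [set w | edge v w].

Definition nbrs (G : sgraph) (X : {set G}) : {set G} :=
  (\bigcup_(v in X) nbr v) :\: X.

(* For disjoint X and Y each edge between them is counted exactly once, as the
   ordered pair whose first component is its endpoint in X. *)
Definition edges_between (G : sgraph) (X Y : {set G}) : nat :=
  #|[set p : G * G | [&& p.1 \in X, p.2 \in Y & edge p.1 p.2]]|.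

Definition expander (R : realType) (n : nat) (d : R) (G : sgraph) : Prop :=
  [/\ 0 < d,
      #|G| = n,
      forall X : {set G}, (1 <= #|X|)%N -> #|X|%:R < n%:R / (2 * d) ->
        d * #|X|%:R <= #|nbrs X|%:R
    & forall X Y : {set G}, [disjoint X & Y] -> #|X| = #|Y| ->
        n%:R / (2 * d) <= #|X|%:R -> (0 < edges_between X Y)%N].

Definition connected_graph (G : sgraph) : Prop :=
  (0 < #|G|)%N /\ forall x y : G, connect (@edge G) x y.

(* [ucycle edge c] holds for an edge traversed back and forth, so genuine
   cycles need the length condition. *)
Definition acyclic_graph (G : sgraph) : Prop :=
  forall c : seq G, ucycle (@edge G) c -> (size c < 3)%N.

Definition is_tree (G : sgraph) : Prop := connected_graph G /\ acyclic_graph G.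

Definition max_degree (G : sgraph) : nat := \max_(v : G) #|nbr v|.

Definition tree_family (n Delta : nat) (T : sgraph) : Prop :=
  [/\ is_tree T, #|T| = n & (max_degree T <= Delta)%N].

Definition contains_subgraph (G H : sgraph) : Prop :=
  exists f : H -> G,
    injective f /\ forall x y : H, edge x y -> edge (f x) (f y).

Definition universal (F : sgraph -> Prop) (G : sgraph) : Prop :=
  forall H : sgraph, F H -> contains_subgraph G H.

(* Main.v *)
Require Import Defs.
From mathcomp Require Import all_boot all_order all_algebra zify lra.

Set Implicit Arguments.
Unset Strict Implicit.
Unset Printing Implicit Defensive.

(** Put [s = floor (sqrt (ln n))].  A partial embedding all of whose small vertex
    sets keep many free neighbours ("extendable", after Friedman-Pippenger and
    Haxell) can be continued by a leaf, or by a path of length about [2 s]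
    between two prescribed vertices: grow two trees of arity [Delta ^ (2 s)]
    until they are joined by an edge, and undo everything but the path.

    A random colouring gives small disjoint sets [W1], [W2], [W3] into which all
    small sets expand.  If every vertex of [W1] is used in a suitable role and
    [W3] is left over, Hall's theorem matches [W1] perfectly with the leftover
    vertices.  If the tree has many leaves, [W1] is made the image of parents of
    leaves, which are chosen far apart so that each can be linked to its
    prescribed image, and the leaves are embedded by the matching.  Otherwise
    the tree has many long bare paths.  Their upper parts end in [W1], the
    leftover vertices are matched both with [W1] and with [W2], and the
    resulting uncontrolled permutation is corrected by a Benes network of
    switches, built beforehand from [W2], in which every routing uses all the
    vertices and only paths of one fixed length. *)

(** * Extendability *)

(** The exponent [5] comes from a balance. Since [n <= 2 ^ (2 * s ^ 2)], two trees of arity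
    [K = Delta ^ (2 * s)] meet at depth about [s], so a link has about [2 * s] inner vertices.
    Prescribed images are reached along disjoint tree segments of that length, and a segment rules
    out about [Delta ^ (2 * s)] others, up to factors polynomial in [s]. So [W1], [W2], [W3] must be
    smaller than [n] by a factor [R] beyond [Delta ^ (2 * s)] and still receive expansion of order
    [K]. This needs [d] of order [R * K], which stays below [Delta ^ (5 * s)] for
    [R = Delta ^ (3 * s - 6)]. The obstacle is that leaves and links can be added only while free
    room remains, whereas the tree has as many vertices as the graph. The last vertices must come
    from matchings, which do not control who is matched with whom. Leaves tolerate this. The inside
    of a bare path does not, since both its ends are already placed: hence a network that realises
    every permutation and always uses all its vertices. *)

Section Extendability.
Variables (V : finType) (e : rel V).
Hypothesis e_sym : symmetric e.

Definition nb (U : {set V}) : {set V} := [set w | [exists v in U, e v w]].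

Lemma nbP (U : {set V}) w : reflect (exists2 v, v \in U & e v w) (w \in nb U).
Proof.
rewrite inE; apply: (iffP existsP) => [[v /andP[]]|[v vU evw]]; first by exists v.
by exists v; rewrite vU.
Qed.

Lemma nbS (U W : {set V}) : U \subset W -> nb U \subset nb W.
Proof.
move=> /subsetP UW; apply/subsetP=> w /nbP[v vU evw].
by apply/nbP; exists v => //; apply: UW.
Qed.

Lemma nbU (U W : {set V}) : nb (U :|: W) = nb U :|: nb W.
Proof.
apply/setP=> w; rewrite in_setU; apply/nbP/orP => [[v]|].
  by rewrite inE => /orP[vU|vW] evw; [left|right]; apply/nbP; exists v.
by case=> /nbP[v vU evw]; exists v; rewrite // inE vU ?orbT.
Qed.

Variables M D : nat.
Hypothesis M_gt0 : 0 < M.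
Hypothesis joined : forall X Y : {set V}, M <= #|X| -> M <= #|Y| ->
  exists x y, [/\ x \in X, y \in Y & e x y].

(** Only the used set [A] and the residual capacities [r] are kept, not the embedded graph. Lowering
    [r] preserves the condition. The bound [2 * M] covers the union of two sets of size below
    [M]. *)
Definition extendable (A : {set V}) (r : V -> nat) : Prop :=
  (forall v, r v <= D) /\
  forall U : {set V}, #|U| <= 2 * M -> \sum_(v in U) r v <= #|nb U :\: A|.

Lemma nb_outside (A U : {set V}) : M <= #|U| -> #|V| < #|nb U :\: A| + #|A| + M.
Proof.
move=> cU; have cY : #|~: (nb U :|: A)| < M.
  rewrite ltnNge; apply/negP=> /(joined cU)[x [y [xU]]].
  rewrite in_setC in_setU negb_or => /andP[/negP yU _] exy; case: yU.
  by apply/nbP; exists x.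
have := cardsC (nb U :|: A); rewrite cardsU.
have := cardsID A (nb U); lia.
Qed.

(** A set with between [M] and [2 * M] vertices reaches all but fewer than [M] of the vertices
    outside [A]; by the room hypothesis this is more than its capacities can sum to. *)
Lemma tight_small (A : {set V}) r (U : {set V}) : extendable A r -> #|A| + M + 2 * M * D <= #|V| ->
  #|U| <= 2 * M -> #|nb U :\: A| <= \sum_(v in U) r v -> #|U| < M.
Proof.
move=> [rD _] cA cU tU; rewrite ltnNge; apply/negP=> /(nb_outside A).
have : \sum_(v in U) r v <= 2 * M * D.
  apply: leq_trans (_ : \sum_(v in U) D <= _); first exact: leq_sum.
  by rewrite sum_nat_const leq_mul2r cU orbT.
lia.
Qed.

(** The number of free neighbours is submodular and the sum of capacities is modular. Since
    [U :&: W] obeys the extendability inequality, tightness passes to the union, and [tight_small]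
    brings its size back below [M]. *)
Lemma sumU_tight (A : {set V}) r (U W : {set V}) : extendable A r -> #|A| + M + 2 * M * D <= #|V| ->
  #|U| < M -> #|W| < M ->
  #|nb U :\: A| <= \sum_(v in U) r v -> #|nb W :\: A| <= \sum_(v in W) r v ->
  #|U :|: W| < M /\ #|nb (U :|: W) :\: A| <= \sum_(v in U :|: W) r v.
Proof.
move=> Er cA cU cW tU tW.
have cUW : #|U :|: W| <= 2 * M by rewrite cardsU; lia.
suff tUW : #|nb (U :|: W) :\: A| <= \sum_(v in U :|: W) r v.
  by split=> //; apply: tight_small tUW.
have [_ /(_ (U :&: W))] := Er.
have -> : #|U :&: W| <= 2 * M.
  by apply: leq_trans (subset_leq_card (subsetIl _ _)) _; lia.
move=> /(_ isT) tI.
have sI : #|nb (U :&: W) :\: A| <= #|(nb U :\: A) :&: (nb W :\: A)|.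
  apply: subset_leq_card; rewrite subsetI !setSD //; apply: nbS; [exact: subsetIr|exact: subsetIl].
have sU : \sum_(v in U :|: W) r v + \sum_(v in U :&: W) r v =
    \sum_(v in U) r v + \sum_(v in W) r v.
  rewrite (big_setID W) /= (big_setID (A := U) W) /= setIC setKU ?(setUC U) setDUl setDv set0U.
  lia.
have := cardsUI (nb U :\: A) (nb W :\: A); rewrite -setDUl -nbU; lia.
Qed.

(* The tight sets obstructing the neighbours of [s] have a tight union [U];
   then [s |: U] would have too few neighbours outside [A]. *)
Lemma add_leaf (A : {set V}) r s : extendable A r -> #|A| + M + 2 * M * D <= #|V| -> 0 < r s ->
  exists y, [/\ y \notin A, e s y & extendable (y |: A) (fun x => r x - (x == s))].
Proof.
move=> Er cA rs; have [rD rU] := Er.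
pose bad y (U : {set V}) := (#|U| <= 2 * M) &&
  (#|nb U :\: (y |: A)| < \sum_(v in U) (r v - (v == s))).
case: (boolP [exists y in nb [set s] :\: A, [forall U, ~~ bad y U]]).
  case/existsP=> y /andP[]; rewrite in_setD => /andP[yA /nbP[s' /set1P-> esy]] /forallP yU.
  exists y; split=> //; split=> [v|U cU]; first by apply: leq_trans (leq_subr _ _) _.
  by have := yU U; rewrite negb_and cU -leqNgt.
move/existsPn=> noy.
pose U_ y := odflt set0 [pick U | bad y U].
have badU y : y \in nb [set s] :\: A -> bad y (U_ y).
  move=> yN; have := noy y; rewrite yN /= => /forallPn[U]; rewrite negbK => bU.
  by rewrite /U_; case: pickP => [//|/(_ U)]; rewrite bU.
(* Using up [y] costs [U_ y] at most one free neighbour, and its demand drops by one if it contains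
   [s]. So the inequality can fail only for a set that was tight, avoids [s] and has [y] as a
   neighbour. *)
have tU y : y \in nb [set s] :\: A ->
    [/\ #|U_ y| < M, #|nb (U_ y) :\: A| <= \sum_(v in U_ y) r v,
        s \notin U_ y & y \in nb (U_ y)].
  move=> yN; have /andP[cU lU] := badU y yN.
  have := rU _ cU => eU.
  have leS : \sum_(v in U_ y) (r v - (v == s)) + (s \in U_ y) <= \sum_(v in U_ y) r v.
    case: (boolP (s \in U_ y)) => sU.
      rewrite (bigD1 s) // [X in _ <= X](bigD1 s) //= eqxx.
      have : \sum_(i in U_ y | i != s) (r i - (i == s)) <= \sum_(i in U_ y | i != s) r i.
        by apply: leq_sum=> i _; rewrite leq_subr.
      lia.
    by rewrite addn0; apply: leq_sum=> i _; rewrite leq_subr.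
  have dU : #|nb (U_ y) :\: A| <= #|nb (U_ y) :\: (y |: A)| + (y \in nb (U_ y)).
    rewrite setUC -setDDl (cardsD1 y (nb (U_ y) :\: A)) in_setD addnC leq_add2l.
    by case: (y \in nb _); rewrite ?andbF ?leq_b1.
  have [sU yU] : s \notin U_ y /\ y \in nb (U_ y).
    by move: leS dU lU eU; case: (s \in _); case: (y \in nb _); lia.
  move: leS dU; rewrite (negbTE sU) yU => leS dU.
  suff tu : #|nb (U_ y) :\: A| <= \sum_(v in U_ y) r v.
    by split=> //; apply: tight_small tu.
  lia.
pose U := \bigcup_(y in nb [set s] :\: A) U_ y.
have [cU tUU] : #|U| < M /\ #|nb U :\: A| <= \sum_(v in U) r v.
  rewrite /U; elim/big_ind: _ => [|X Y [? ?] [? ?]|y /tU[]//].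
    rewrite cards0 big_set0; split=> //.
    rewrite leqn0 cards_eq0; apply/eqP/setP=> w; rewrite in_setD in_set0.
    by apply/negP=> /andP[_ /nbP[v]]; rewrite inE.
  exact: (@sumU_tight A r).
have sU : s \notin U.
  by apply/bigcupP=> -[y /tU[_ _ /negP]].
have cs : #|s |: U| <= 2 * M by rewrite cardsU1; lia.
have := rU _ cs; rewrite big_setU1 //=.
suff -> : nb (s |: U) :\: A = nb U :\: A by lia.
rewrite nbU setDUl; apply/setUidPr/subsetP=> y yN.
have [_ _ _ /nbP[v vU evy]] := tU y yN.
rewrite in_setD; move: (yN); rewrite in_setD => /andP[-> _] /=.
by apply/nbP; exists v => //; apply/bigcupP; exists y.
Qed.

(* Each discarded vertex [y] is a neighbour of [pi y] that becomes free again. *)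
Lemma undo (A A2 Q : {set V}) (r r1 r2 : V -> nat) (pi : V -> V) :
  extendable A2 r2 -> A \subset A2 -> Q \subset A2 :\: A ->
  (forall y, y \in A2 :\: A -> e (pi y) y) ->
  (forall x, r x = r2 x + #|[set y in A2 :\: A | pi y == x]|) ->
  (forall x, r1 x + #|[set y in Q | pi y == x]| <= r x) ->
  (forall x, r1 x <= D) ->
  extendable (A :|: Q) r1.
Proof.
move=> [r2D r2U] AA2 QA2 epi rE r1E r1D; split=> // U cU.
pose B := (A2 :\: A) :\: Q.
have r1B x : r1 x <= r2 x + #|[set y in B | pi y == x]|.
  have := r1E x; rewrite rE -(cardsID Q [set y in A2 :\: A | pi y == x]).
  have -> : [set y in A2 :\: A | pi y == x] :&: Q = [set y in Q | pi y == x].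
    apply/setP=> y; rewrite in_setI !inE; case: (boolP (y \in Q)); last by rewrite andbF.
    by move=> /(subsetP QA2); rewrite !inE => ->; rewrite andbT.
  have -> : [set y in A2 :\: A | pi y == x] :\: Q = [set y in B | pi y == x].
    by apply/setP=> y; rewrite /B !inE; case: (y \in Q).
  by rewrite addnCA [X in X <= _]addnC leq_add2l.
have -> : nb U :\: (A :|: Q) = (nb U :\: A2) :|: (nb U :&: B).
  apply/setP=> y; rewrite /B !(in_setD, in_setU, in_setI).
  have := subsetP AA2 y; have := subsetP QA2 y; rewrite in_setD.
  by case: (y \in A2); case: (y \in A); case: (y \in Q); case: (y \in nb U) => //= H1 H2; first [by have := H1 isT | by have := H2 isT].
have dis : (nb U :\: A2) :&: (nb U :&: B) = set0.
  apply/setP=> y; rewrite /B !inE; case: (y \in A2); rewrite ?andbF //=.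
rewrite cardsU dis cards0 subn0.
apply: leq_trans (_ : \sum_(v in U) (r2 v + #|[set y in B | pi y == v]|) <= _); first exact: leq_sum.
rewrite big_split /= leq_add ?r2U //.
have -> : \sum_(v in U) #|[set y in B | pi y == v]| = #|[set y in B | pi y \in U]|.
  apply/esym; rewrite -sum1_card (partition_big pi (mem U)) /=; last first.
    by move=> y; rewrite inE => /andP[].
  apply: eq_bigr=> v vU; rewrite -sum1_card; apply: eq_bigl=> y; rewrite !inE.
  by case: eqP => [->|]; rewrite ?vU ?andbT ?andbF.
apply: subset_leq_card; apply/subsetP=> y; rewrite !inE => /andP[yB piU].
rewrite yB andbT; apply/existsP; exists (pi y); rewrite piU epi // inE.
by case/and3P: yB => _ -> ->.
Qed.

End Extendability.

(** * Linking two vertices *)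

Section Connecting.
Variables (V : finType) (e : rel V).
Hypothesis e_sym : symmetric e.
Variables M K h : nat.
Hypothesis M_gt0 : 0 < M.
Hypothesis K_gt0 : 0 < K.
Hypothesis Kh : M <= K ^ h.
Hypothesis joined : forall X Y : {set V}, M <= #|X| -> M <= #|Y| ->
  exists x y, [/\ x \in X, y \in Y & e x y].

(* [r] records the number of edges that may still be added at each vertex: a
   vertex outside [A] gets degree at most [K.+2], one edge of which attaches it. *)
Definition state (A : {set V}) (r : V -> nat) : Prop :=
  extendable e M K.+2 A r /\ forall v, v \notin A -> r v = K.+1.

Definition step_room := M + 2 * M * K.+2.

Lemma state_leaf A r s : state A r -> s \in A -> 0 < r s -> #|A| + step_room <= #|V| ->
  exists y, [/\ y \notin A, e s y & state (y |: A) (fun x => r x - (x == s))].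
Proof.
move=> [Er out] sA rs; rewrite /step_room addnA => cA.
have [y [yA esy Ey]] := add_leaf M_gt0 joined Er cA rs.
exists y; split=> //; split=> // v; rewrite in_setU1 negb_or => /andP[_ vA].
rewrite out //; have -> : (v == s) = false by apply: contraNF vA => /eqP->.
by rewrite subn0.
Qed.

(** The bookkeeping consumed by [undo]: [pi] tells where each new vertex was attached, and the
    capacity spent at [x] is the number of vertices attached to it. *)
Definition grown (A : {set V}) r (A2 : {set V}) r2 (pi : V -> V) : Prop :=
  [/\ A \subset A2, state A2 r2, forall y, y \in A2 :\: A -> e (pi y) y
    & forall x, r x = r2 x + #|[set y in A2 :\: A | pi y == x]|].

Lemma grow_level A r A2 r2 pi (C : {set V}) c :
  grown A r A2 r2 pi -> C \subset A2 -> c <= \sum_(x in C) r2 x ->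
  #|A2| + c + step_room <= #|V| ->
  exists A3 r3 pi', [/\ grown A r A3 r3 pi', [/\ A2 \subset A3 & #|A3| = #|A2| + c],
    (forall y, y \in A2 -> pi' y = pi y),
    (forall y, y \in A3 :\: A2 -> pi' y \in C /\ r3 y = K.+1)
    & (forall x, x \notin C -> r3 x = r2 x) /\
      \sum_(x in C) r2 x = \sum_(x in C) r3 x + c].
Proof.
move=> G CA; elim: c => [|c IH] cC cV.
  exists A2, r2, pi; split=> //; [by rewrite addn0 | | by rewrite addn0].
  by move=> y; rewrite setDv inE.
have [||A3 [r3 [pi3 [G3 [A23 cA3] pi3E new3 [r3E sum3]]]]] := IH; try lia.
have [AA3 S3 e3 d3] := G3.
have /existsP[s /andP[sC rs]] : [exists s in C, 0 < r3 s].
  apply: contraLR isT => /existsPn no; suff: \sum_(x in C) r3 x = 0 by lia.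
  by rewrite big1 // => x xC; have := no x; rewrite xC /= -leqNgt; lia.
have sA3 : s \in A3 by apply: (subsetP A23); apply: (subsetP CA).
have cA3' : #|A3| + step_room <= #|V|.
  by apply: leq_trans cV; rewrite cA3 leq_add2r leq_add2l.
have [y [yA3 esy Sy]] := state_leaf S3 sA3 rs cA3'.
have ys : y != s by apply: contraNneq yA3 => ->.
pose pi' x := if x == y then s else pi3 x.
have yA : y \notin A by apply: contra yA3; apply: (subsetP AA3).
exists (y |: A3), (fun x => r3 x - (x == s)), pi'; split.
- split.
  + by apply: subset_trans AA3 (subsetUr _ _).
  + exact: Sy.
  + move=> x; rewrite /pi' !inE; case: eqP => [-> //|_ /andP[xA /= xA3]].
    by apply: e3; rewrite inE xA.
  + move=> x; rewrite d3.
    have -> : [set z in (y |: A3) :\: A | pi' z == x] =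
      (if s == x then y |: [set z in A3 :\: A | pi3 z == x] else [set z in A3 :\: A | pi3 z == x]).
      apply/setP=> z; rewrite /pi'; case: (eqVneq s x) => [<-|sx]; rewrite !inE.
        by case: (eqVneq z y) => [->|zy] //=; rewrite eqxx yA.
      case: (eqVneq z y) => [->|zy] //=; by rewrite (negbTE sx) (negbTE yA3) !andbF.
    case: (eqVneq s x) => [<-|sx].
      by rewrite cardsU1 !inE (negbTE yA3) andbF /= addnA subnK.
    by rewrite subn0.
- split; first by apply: subset_trans A23 (subsetUr _ _).
  by rewrite cardsU1 yA3 cA3 add1n addnS.
- move=> z zA2; rewrite /pi' pi3E //; case: eqP => // zy.
  by case/negP: yA3; rewrite -zy; apply: (subsetP A23).
- move=> z; rewrite /pi' !inE; case: eqP => [-> _|_ /andP[zA2 /= zA3]].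
    by rewrite sC (negbTE ys) subn0 S3.2.
  have zN : z \in A3 :\: A2 by rewrite inE zA2.
  have [pz ->] := new3 z zN; split=> //; have -> : (z == s) = false by apply: contraNF zA2 => /eqP->; apply: (subsetP CA).
  by rewrite subn0.
- split=> [x xC|].
    by rewrite r3E //; have -> : (x == s) = false by [apply: contraNF xC => /eqP->]; rewrite subn0.
  rewrite sum3 (bigD1 s) // [X in _ = X + _](bigD1 s) //= eqxx.
  have -> : \sum_(i in C | i != s) (r3 i - (i == s)) = \sum_(i in C | i != s) r3 i.
    by apply: eq_bigr=> i /andP[_ /negbTE->]; rewrite subn0.
  by case: (r3 s) rs => // k _; rewrite subn1 /= addnS !addSn.
Qed.

Definition branch (pi : V -> V) (B : {set V}) s l z : Prop :=
  exists q : seq V, [/\ size q = l, path (fun a b => pi b == a) s q, last s q = z, uniq q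
    & {subset q <= B}].

(** Levels are cut off at [M] vertices, so the whole tree costs at most [l.+1 * M]. The first level
    is a single vertex: [s] spends only one unit of capacity, and the growth by [K] starts one level
    lower. *)
Lemma grow_tree A r A2 r2 pi s l :
  grown A r A2 r2 pi -> s \in A2 -> 0 < r2 s ->
  #|A2| + l.+1 * M + step_room <= #|V| ->
  exists A3 r3 pi' (Z : {set V}), [/\ grown A r A3 r3 pi',
    [/\ A2 \subset A3, #|A3| <= #|A2| + l.+1 * M & forall y, y \in A2 -> pi' y = pi y],
    [/\ Z \subset A3 :\: A2, #|Z| = minn (K ^ l) M & forall z, z \in Z -> r3 z = K.+1],
    forall z, z \in Z -> branch pi' (A3 :\: A2) s l.+1 z
    & forall x, x \in A2 -> x != s -> r3 x = r2 x].
Proof.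
move=> G sA2 rs; elim: l => [|l IH] cV.
  have [|||A3 [r3 [pi3 [G3 [A23 cA3] piE new [r3E _]]]]] := @grow_level A r A2 r2 pi [set s] 1 G.
  - by rewrite sub1set.
  - by rewrite big_set1.
  - by clear -cV M_gt0; lia.
  exists A3, r3, pi3, (A3 :\: A2); split=> //.
  + by split=> //; rewrite cA3 leq_add2l mul1n.
  + split=> //; first by rewrite cardsD (setIidPr A23) cA3 addKn expn0; apply/esym/minn_idPl.
    by move=> z /new[].
  + move=> z zN; exists [:: z]; split=> //=; last by move=> x; rewrite inE => /eqP->.
    by have [/set1P-> _] := new z zN; rewrite eqxx.
  + by move=> x xA2 xs; apply: r3E; rewrite inE.
have [|A3 [r3 [pi3 [Z [G3 [A23 cA3 pi3E] [ZA cZ rZ] brZ r3E]]]]] := IH; first by clear -cV; nia.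
have ZA3 : Z \subset A3 by apply: subset_trans ZA (subsetDl _ _).
have [||A4 [r4 [pi4 [G4 [A34 cA4] pi4E new [r4E _]]]]] :=
    @grow_level A r A3 r3 pi3 Z (minn (K ^ l.+1) M) G3 ZA3.
- rewrite (eq_bigr (fun _ => K.+1)) // sum_nat_const cZ expnS.
  by clear; have := geq_minl (K * K ^ l) M; have := geq_minr (K * K ^ l) M; case: (leqP (K ^ l) M); nia.
- by have := geq_minr (K ^ l.+1) M; clear -cV cA3; nia.
have A24 := subset_trans A23 A34.
exists A4, r4, pi4, (A4 :\: A3); split=> //.
- split=> // [|y yA2]; first by have := geq_minr (K ^ l.+1) M; rewrite cA4; clear -cA3; nia.
  by rewrite pi4E ?pi3E // (subsetP A23).
- split=> [||z /new[]//]; first by apply: setDS.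
  by rewrite cardsD (setIidPr A34) cA4 addKn.
- move=> z zN; have [pizZ _] := new z zN; have [q [sq pq lq uq qB]] := brZ _ pizZ.
  have qA3 x : x \in q -> x \in A3 by move/qB; rewrite inE => /andP[].
  move: (zN); rewrite inE => /andP[zA3 zA4].
  exists (rcons q z); split.
  + by rewrite size_rcons sq.
  + rewrite rcons_path lq eqxx andbT.
    elim: q s {sq lq uq qB rs sA2 brZ r3E IH} pq qA3 => //= b q IHq s /andP[/eqP pb pq] qA3.
    rewrite pi4E ?qA3 ?mem_head // pb eqxx; apply: IHq => // x xq.
    by apply: qA3; rewrite inE xq orbT.
  + by rewrite last_rcons.
  + by rewrite rcons_uniq uq andbT; apply: contra zA3; apply: qA3.
  + move=> x; rewrite mem_rcons inE => /orP[/eqP->|xq].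
      by rewrite inE zA4 andbT; apply: contra zA3; apply: (subsetP A23).
    by rewrite inE (subsetP A34) ?qA3 // andbT; move: (qB _ xq); rewrite inE => /andP[].
- move=> x xA2 xs; rewrite r4E ?r3E //.
  by apply/negP=> /(subsetP ZA); rewrite inE xA2.
Qed.

Lemma connect_room A r s t : state A r -> s \in A -> t \in A -> s != t ->
  0 < r s -> 0 < r t -> #|A| + 2 * h.+1 * M + step_room <= #|V| ->
  exists q : seq V, [/\ size q = 2 * h.+1, path e s (rcons q t), uniq q,
    (forall x, x \in q -> x \notin A)
    & state (A :|: [set x in q])
        (fun x => if x \in q then K else r x - (x == s) - (x == t))].
Proof.
move=> Sr sA tA st rs rt cV.
have G0 : grown A r A r id.
  split=> // [y|x]; first by rewrite setDv inE.
  suff -> : [set y in A :\: A | id y == x] = set0 by rewrite cards0 addn0.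
  by apply/setP=> y; rewrite !inE; case: (y \in A).
have cA : #|A| + h.+1 * M + step_room <= #|V| by clear -cV; nia.
have [A2 [r2 [pi2 [Z [G2 [AA2 cA2 _] [ZA cZ rZ] brZ r2E]]]]] := grow_tree G0 sA rs cA.
have rt2 : 0 < r2 t by rewrite r2E // eq_sym.
have cA2' : #|A2| + h.+1 * M + step_room <= #|V| by clear -cV cA2; nia.
have [A3 [r3 [pi3 [Y [G3 [A23 cA3 pi3E] [YA cY rY] brY r3E]]]]] :=
  grow_tree G2 (subsetP AA2 _ tA) rt2 cA2'.
have [||z [y [zZ yY ezy]]] := joined (X := Z) (Y := Y).
- by rewrite cZ; clear -Kh; lia.
- by rewrite cY; clear -Kh; lia.
have [p [sp pp lp up pB]] := brZ z zZ.
have [q [sq pq lq uq qB]] := brY y yY.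
have {}pp : path (fun a b => pi3 b == a) s p.
  have pA x : x \in p -> x \in A2 by move/pB; rewrite inE => /andP[].
  elim: p s {sA rs st sp lp up pB rt2 rt cV brZ r2E} pp pA => //= b p IHp s /andP[/eqP pb pp] pA.
  rewrite pi3E ?pA ?mem_head // pb eqxx; apply: IHp => // x xp.
  by apply: pA; rewrite inE xp orbT.
have [AA3 [E3 out3] e3 d3] := G3.
pose Q := p ++ q.
have QB x : x \in Q -> x \in A3 :\: A.
  rewrite mem_cat => /orP[/pB|/qB]; rewrite !inE => /andP[xA xA3]; rewrite ?xA ?xA3 ?(subsetP A23) //.
  by rewrite andbT; apply: contra xA; apply: (subsetP AA2).
have uQ : uniq Q.
  rewrite cat_uniq up uq andbT /=; apply/hasPn=> x /qB; rewrite inE => /andP[xA2 _].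
  by apply: contra xA2 => /pB; rewrite inE => /andP[].
have mapbelast w (u : seq V) : path (fun a b => pi3 b == a) w u -> [seq pi3 x | x <- u] = belast w u.
  by elim: u w => //= b u IHu w /andP[/eqP-> /IHu->].
have belast_mem w (u : seq V) x : x \in belast w u -> x = w \/ x \in u.
  by move/mem_belast; rewrite inE => /orP[/eqP|]; [left|right].
have nA w x : w \in A -> x \in Q -> x != w.
  by move=> wA /QB; rewrite inE => /andP[xA _]; apply: contraNneq xA => ->.
have ubl w u : w \notin u -> uniq u -> uniq (belast w u).
  move=> wu uu; have : uniq (w :: u) by rewrite /= wu.
  by rewrite lastI rcons_uniq => /andP[].
(* Along each branch [pi3] is the shift to the previous vertex, and the two branches are disjoint.
   So every vertex keeps at most one child in [Q]. *)
have umap : uniq [seq pi3 x | x <- Q].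
  have sp' : s \notin p by apply/negP=> sp'; have := nA s s sA; rewrite mem_cat sp' eqxx => /(_ isT).
  have tq' : t \notin q by apply/negP=> tq'; have := nA t t tA; rewrite mem_cat tq' orbT eqxx => /(_ isT).
  rewrite map_cat (mapbelast _ _ pp) (mapbelast _ _ pq) cat_uniq !ubl // andbT /=.
  apply/hasPn=> x /belast_mem xtq; apply/negP=> /belast_mem xsp.
  case: xtq xsp => [->|xq] [xs|xp].
  - by rewrite xs eqxx in st.
  - by have := nA t t tA; rewrite mem_cat xp eqxx => /(_ isT).
  - by have := nA s s sA; rewrite -{1}xs mem_cat xq orbT eqxx => /(_ isT).
  - by move: uQ; rewrite cat_uniq => /and3P[_ /hasPn/(_ _ xq)/negP].
have cnt x : #|[set v in [set v in Q] | pi3 v == x]| = (x \in [seq pi3 v | v <- Q]).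
  rewrite -(count_uniq_mem _ umap) count_map -size_filter cardE.
  apply/perm_size/uniq_perm; rewrite ?enum_uniq ?filter_uniq // => v.
  by rewrite mem_enum mem_filter !inE andbC.
have piQ x : x \in [seq pi3 v | v <- Q] -> [|| x == s, x == t | x \in Q].
  rewrite map_cat mem_cat (mapbelast _ _ pp) (mapbelast _ _ pq) mem_cat.
  by case/orP=> /belast_mem[->|->]; rewrite ?eqxx ?orbT.
exists (p ++ rev q); have memQ x : (x \in p ++ rev q) = (x \in Q) by rewrite !mem_cat mem_rev.
have epi x : x \in Q -> e (pi3 x) x by move/QB; apply: e3.
have epath w u : {subset u <= Q} -> path (fun a b => pi3 b == a) w u -> path e w u.
  elim: u w => //= b u IHu w uS /andP[/eqP <- pu]; rewrite epi ?uS ?mem_head // IHu // => x xu.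
  by apply: uS; rewrite inE xu orbT.
split.
- by rewrite size_cat size_rev sp sq mul2n addnn.
- rewrite rcons_cat cat_path lp epath //=; last by move=> x xp; rewrite mem_cat xp.
  have eq : path e t q by apply: epath => // x xq; rewrite mem_cat xq orbT.
  rewrite -rev_cons; have : path e y (rev (belast t q)).
    by rewrite -lq rev_path (eq_path (e' := e)) // => a b; rewrite e_sym.
  case: (lastP q) sq lq => [//|q' y' _]; rewrite last_rcons => ->.
  by rewrite belast_rcons -rcons_cons rev_rcons /= ezy.
- rewrite cat_uniq rev_uniq; move: uQ; rewrite cat_uniq => /and3P[-> H ->]; rewrite andbT /=.
  by apply: contra H => /hasP[x]; rewrite mem_rev => xq xp; apply/hasP; exists x.
- by move=> x; rewrite memQ => /QB; rewrite inE => /andP[].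
have -> : [set x in p ++ rev q] = [set x in Q] by apply/setP=> x; rewrite !inE memQ.
split; last first.
  move=> v; rewrite in_setU inE negb_or memQ => /andP[vA /negbTE->].
  case: (eqVneq v s) => [vs|_]; first by rewrite vs sA in vA.
  case: (eqVneq v t) => [vt|_]; first by rewrite vt tA in vA.
  by rewrite !subn0; apply: Sr.2.
apply: (undo E3 AA3 (r := r) (pi := pi3)) => //.
- by apply/subsetP=> x; rewrite inE; apply: QB.
(* Inner vertices drop uniformly from [K.+1] to [K], although the two branch ends [z] and [y] have
   no child in [Q]: [undo] only asks for an inequality. *)
- move=> x; rewrite memQ cnt; case: ifP => xQ.
    rewrite Sr.2 ?addn1; last by move: (QB x xQ); rewrite inE => /andP[].
    by rewrite -[K.+1]addn1 leq_add2l leq_b1.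
  case: (boolP (x \in map _ _)) => [/piQ|_]; rewrite ?xQ ?orbF /=; last by rewrite addn0 -subnDA leq_subr.
  case: (eqVneq x s) => [->|_ /= /eqP->].
    by rewrite (negbTE st) subn0 subnK.
  by rewrite eqxx subn0 subnK.
- move=> x; have [[rD _] _] := Sr; case: ifP => _; first exact/leqW/leqnSn.
  by apply: leq_trans (rD x); rewrite -subnDA leq_subr.
Qed.

End Connecting.

(** * Hall's theorem and Benes networks *)

(** The induction of Halmos and Vaughan: a nonempty proper subset that is tight is matched on its
    own and the rest outside its neighbourhood; if there is none, any [a] may take any [b] in [N a].
    The value [b0] serves when [S] is empty. *)
Lemma hall (A B : finType) (b0 : B) (N : A -> {set B}) (S : {set A}) :
  (forall X : {set A}, X \subset S -> #|X| <= #|\bigcup_(a in X) N a|) ->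
  exists f : A -> B, {in S &, injective f} /\ {in S, forall a, f a \in N a}.
Proof.
have [n] := ubnP #|S|; elim: n N S => // n IH N S; rewrite ltnS => Sn hS.
have [->|[a aS]] := set_0Vmem S.
  by exists (fun=> b0); split=> [x y|x]; rewrite inE.
case: (boolP [exists X : {set A}, [&& X \proper S, X != set0 &
    #|\bigcup_(a in X) N a| <= #|X|]]) => [|/existsPn noX].
  case/existsP=> X /and3P[XS X0 tX].
  have sXS := proper_sub XS.
  have [|Y YX|f1 [f1i f1N]] := IH N X.
  - by apply: leq_trans (proper_card XS) _; lia.
  - by apply: hS; apply: subset_trans sXS.
  have cD : #|S :\: X| < n.
    have := cardsID X S; rewrite (setIidPr sXS); move: X0; rewrite -card_gt0; lia.
  pose N' x := N x :\: \bigcup_(a in X) N a.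
  have [Y YD|f2 [f2i f2N]] := IH N' (S :\: X) cD.
    have XY0 : X :&: Y = set0.
      by apply/setP=> y; rewrite !inE; apply/negP=> /andP[yX /(subsetP YD)]; rewrite inE yX.
    have := hS (X :|: Y); rewrite subUset sXS (subset_trans YD (subsetDl _ _)) => /(_ isT).
    rewrite bigcup_setU cardsU XY0 cards0.
    have : \bigcup_(a in X) N a :|: \bigcup_(a in Y) N a \subset
        \bigcup_(a in X) N a :|: \bigcup_(a in Y) N' a.
      apply/subsetP=> b; rewrite !in_setU; case: (boolP (b \in \bigcup_(a in X) N a)) => //= bX.
      by case/bigcupP=> y yY bN; apply/bigcupP; exists y; rewrite // inE bX.
    move/subset_leq_card; have := leq_card_setU (\bigcup_(a in X) N a) (\bigcup_(a in Y) N' a).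
    case=> + _; lia.
  exists (fun x => if x \in X then f1 x else f2 x); split=> [x y xS yS|x xS].
    have D z : z \in S -> z \notin X -> z \in S :\: X by rewrite inE => -> ->.
    have f1X z : z \in X -> f1 z \in \bigcup_(a in X) N a.
      by move=> zX; apply/bigcupP; exists z; rewrite ?f1N.
    case: ifPn => xX; case: ifPn => yX.
    - exact: f1i.
    - by move=> E; have := f2N y (D y yS yX); rewrite inE -E f1X.
    - by move=> E; have := f2N x (D x xS xX); rewrite inE E f1X.
    - by apply: f2i; apply: D.
  case: ifPn => xX; first exact: f1N.
  by have := f2N x; rewrite !inE xX xS => /(_ isT)/andP[].
have /card_gt0P[b bN] : 0 < #|N a|.
  by have := hS [set a]; rewrite sub1set aS cards1 big_set1 => ->.
have cD : #|S :\ a| < n by have := cardsD1 a S; rewrite aS; lia.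
have [Y YD|f [fi fN]] := IH (fun x => N x :\ b) (S :\ a) cD.
  have [->|Y0] := eqVneq Y set0; first by rewrite cards0.
  have YS : Y \proper S.
    apply/properP; split; first by apply: subset_trans YD (subsetDl _ _).
    by exists a => //; apply/negP=> /(subsetP YD); rewrite !inE eqxx.
  have := noX Y; rewrite YS Y0 /= -ltnNge.
  have -> : \bigcup_(a in Y) (N a :\ b) = (\bigcup_(a in Y) N a) :\ b.
    apply/setP=> z; rewrite in_setD1; apply/bigcupP/andP => [[y yY]|[zb /bigcupP[y yY zN]]].
      by rewrite in_setD1 => /andP[-> zN]; split=> //; apply/bigcupP; exists y.
    by exists y; rewrite // in_setD1 zb.
  have := cardsD1 b (\bigcup_(a in Y) N a); case: (b \in _); lia.
have fx x : x \in S -> x != a -> f x \in N x :\ b by move=> xS xa; apply: fN; rewrite !inE xa.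
exists (fun x => if x == a then b else f x); split=> [x y xS yS|x xS].
  case: eqP => [->|/eqP xa]; case: eqP => [->|/eqP ya] //.
  - by move=> E; have := fx y yS ya; rewrite !inE -E eqxx.
  - by move=> E; have := fx x xS xa; rewrite !inE E eqxx.
  - by apply: fi; rewrite !inE ?xa ?ya.
by case: eqP => [->//|/eqP xa]; have := fx x xS xa; rewrite !inE => /andP[].
Qed.

(** * Permutations routed through layers of switches *)

Section Routing.
Variable I : finType.
Implicit Types (a t s : I -> I) (ls : seq (I -> I)).

(** For a fixed-point-free involution [a], injectivity forces [t] to swap or to fix each pair as a
    whole: one bit per switch. *)
Definition switched a t := injective t /\ forall i, t i = i \/ t i = a i.

Fixpoint routes ls s : Prop :=
  if ls is a :: ls' then exists t s', [/\ switched a t, routes ls' s' & forall i, s i = s' (t i)]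
  else forall i, s i = i.

Fixpoint pairings ls : Prop :=
  if ls is a :: ls' then [/\ involutive a, forall i, a i != i & pairings ls'] else True.

Lemma eq_routes ls s s' : s =1 s' -> routes ls s -> routes ls s'.
Proof.
case: ls => [|a ls] /= E; first by move=> H i; rewrite -E.
by case=> t [u [H1 H2 H3]]; exists t, u; split=> // i; rewrite -E.
Qed.

Lemma routes_cat ls ls' s s' : routes ls s -> routes ls' s' -> routes (ls ++ ls') (s' \o s).
Proof.
elim: ls s => /= [|a ls IH] s.
  by move=> E; apply: eq_routes => i /=; rewrite E.
case=> t [u [ta ru E]] /(IH _ ru) rs; exists t, (s' \o u); split=> // i.
by rewrite /= E.
Qed.

Lemma pairings_cat ls ls' : pairings ls -> pairings ls' -> pairings (ls ++ ls').
Proof. by elim: ls => //= a ls IH [? ? /IH{}IH] /IH. Qed.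

End Routing.

Section Benes.
Variable I : finType.

Definition flip (p : bool * I) := (~~ p.1, p.2).
Definition double (a : I -> I) (p : bool * I) := (p.1, a p.2).

Lemma routes_double ls s0 s1 : routes ls s0 -> routes ls s1 ->
  routes (map double ls) (fun p => (p.1, (if p.1 then s1 else s0) p.2)).
Proof.
elim: ls s0 s1 => /= [|a ls IH] s0 s1.
  by move=> E0 E1 [[] i] /=; rewrite ?E0 ?E1.
case=> t0 [u0 [[t0i t0a] r0 E0]] [t1 [u1 [[t1i t1a] r1 E1]]].
exists (fun p => (p.1, (if p.1 then t1 else t0) p.2)), (fun p => (p.1, (if p.1 then u1 else u0) p.2)).
split; [split | exact: IH |].
- by move=> [[] i] [[] j] //= [/= E]; congr pair; [apply: t1i|apply: t0i].
- by move=> [[] i] /=; rewrite /double /=; [case: (t1a i)|case: (t0a i)] => ->; auto.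
- by move=> [[] i] /=; rewrite ?E0 ?E1.
Qed.

(* Hall's theorem picks from each input pair one wire so that the chosen wires
   end in distinct output pairs; they are routed through the upper half. *)
Lemma split_perm (s : bool * I -> bool * I) : injective s ->
  exists t1 t2 s0 s1, [/\ switched flip t1, switched flip t2, injective s0, injective s1 &
    forall p, s p = t2 ((t1 p).1, (if (t1 p).1 then s1 else s0) (t1 p).2)].
Proof.
move=> si; case: (pickP I) => [i0 _|I0]; last first.
  exists id, id, id, id; split=> // [||[b i]]; try by split=> // p; left.
  by have := I0 i.
pose N x := [set (s (false, x)).2; (s (true, x)).2].
have [X _|f [fi' fN]] := @hall I I i0 N setT.
  (* The [2 * #|X|] wires of the pairs in [X] end on distinct wires of the output pairs they reach,
     and each output pair has two wires. *)
  suff : 2 * #|X| <= 2 * #|\bigcup_(a in X) N a| by rewrite leq_mul2l.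
  have := cardsX [set: bool] X; have := cardsX [set: bool] (\bigcup_(a in X) N a).
  rewrite cardsT card_bool => <- <-; rewrite -(card_imset _ si).
  apply/subset_leq_card/subsetP=> q /imsetP[[b x]]; rewrite !inE /= => xX ->.
  by apply/bigcupP; exists x => //; rewrite !inE; case: b; rewrite eqxx ?orbT.
have fi : injective f by move=> x y; apply: fi'; rewrite inE.
pose c x := (s (true, x)).2 == f x.
have sc x : (s (c x, x)).2 = f x.
  rewrite /c; case: eqP => // E; have := fN x (in_setT _).
  by rewrite !inE => /orP[/eqP->//|/eqP/esym].
pose g x := (s (~~ c x, x)).2.
have pE (p q : bool * I) : p.1 = q.1 -> p.2 = q.2 -> p = q by case: p; case: q => ? ? ? ? /= -> ->.
(* Otherwise three input wires would end in the output pair [g x]: the unchosen wires of [x] and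
   [y], and the chosen wire of the [z] with [f z = g x]. *)
have gi : injective g.
  move=> x y gxy; apply/eqP; apply: contraT => xy.
  have [z fz] : exists z, f z = g x by exists (invF fi (g x)); rewrite f_invF.
  have E1 : (s (c z, z)).1 != (s (~~ c x, x)).1.
    apply/eqP=> /pE; rewrite sc => /(_ fz)/si [E1 E2].
    by move: E1; rewrite E2; case: (c x).
  have E2 : (s (c z, z)).1 != (s (~~ c y, y)).1.
    apply/eqP=> /pE; rewrite sc => /(_ (etrans fz gxy))/si [E2 E3].
    by move: E2; rewrite E3; case: (c y).
  have E3 : (s (~~ c x, x)).1 != (s (~~ c y, y)).1.
    by apply/eqP=> /pE => /(_ gxy)/si [_ E]; rewrite E eqxx in xy.
  by move: E1 E2 E3; case: (s _).1; case: (s _).1; case: (s _).1.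
(* The last layer is read off from [s]: copy [true] carries the chosen wires, permuted by [f], and
   copy [false] the others, permuted by [g]. *)
pose u p := s (if p.1 then (c (invF fi p.2), invF fi p.2) else (~~ c (invF gi p.2), invF gi p.2)).
have u2 p : (u p).2 = p.2.
  by rewrite /u; case: p => [[] y] /=; rewrite ?sc ?f_invF //; have := f_invF gi y.
exists (fun p => (p.1 == c p.2, p.2)), u, g, f; split=> //.
- split=> [[b x] [b' y] /= [+ E]|[b x]].
    by rewrite -E => Eb; congr pair; move: Eb; case: b; case: b'; case: (c x).
  by rewrite /flip /=; case: b; case: (c x); auto.
- split=> [p q E|p].
    have E2 : p.2 = q.2 by rewrite -(u2 p) -(u2 q) E.
    apply: pE => //; move/si: E; rewrite E2.
    by case: p.1; case: q.1 => // -[+ E]; rewrite E; case: (c _).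
  case: p => [b' y']; have := u2 (b', y'); rewrite /flip; case: (u (b', y')) => [b y] /= ->.
  by case: b; case: b'; auto.
- move=> [b x] /=; rewrite /u /=; case: (eqVneq b (c x)) => [->|bc] /=; first by rewrite invF_f.
  by rewrite invF_f; congr (s (_, _)); move: bc; case: b; case: (c x).
Qed.

End Benes.

(** One flip layer is put before and one after two parallel copies of the network for [k]; by
    [split_perm] the outer layers leave each copy a permutation of its own. The recursion starts
    from a single wire without switches, hence [2 * k] layers instead of the usual [2 * k - 1]. *)
Lemma benes k : exists (I : finType) (ls : seq (I -> I)),
  [/\ #|I| = 2 ^ k, size ls = 2 * k, pairings ls
    & forall s : I -> I, injective s -> routes ls s].
Proof.
elim: k => [|k [I [ls [cI sls pls rls]]]].
  exists unit, [::]; split=> //; first by rewrite card_unit.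
  by move=> s _ [] /=; case: (s tt).
exists (bool * I)%type, (flip (I := I) :: map (@double I) ls ++ [:: flip (I := I)]); split.
- by rewrite card_prod card_bool cI expnS.
- by rewrite /= size_cat size_map sls /=; lia.
- have flipP : involutive (@flip I) /\ forall p, flip p != p :> bool * I.
    by split=> [[[] i]|[[] i]].
  split; [exact: flipP.1 | exact: flipP.2 |].
  apply: pairings_cat; last by split; [exact: flipP.1 | exact: flipP.2 |].
  elim: ls pls {sls rls} => //= a ls IH [ai an /IH{}IH]; split=> //.
    by move=> [b i]; rewrite /double /= ai.
  by move=> [b i]; rewrite /double xpair_eqE eqxx an.
move=> s /split_perm[t1 [t2 [s0 [s1 [t1P t2P s0i s1i E]]]]] /=.
exists t1, (t2 \o (fun p => (p.1, (if p.1 then s1 else s0) p.2))); split=> //.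
apply: routes_cat; first by apply: routes_double; apply: rls.
by exists t2, id.
Qed.

(** * Networks of switches in an expander *)

Section Zigzag.
Variables (V : finType) (e : rel V).
Hypothesis e_sym : symmetric e.

(* A rung [(a, p, b)] joins [a] to [b] by a path with interior [p]. *)
Definition rung (t : V * seq V * V) := path e t.1.1 (rcons t.1.2 t.2).

(** A snake through a ladder: it crosses a rung, moves one step along the rail where it lands, and
    crosses back. [b] tells whether the first rung is entered from the left. *)
Fixpoint zigzag (b : bool) (L : seq (V * seq V * V)) : seq V :=
  if L is t :: L' then
    if b then t.1.1 :: t.1.2 ++ t.2 :: zigzag (~~ b) L'
    else t.2 :: rev t.1.2 ++ t.1.1 :: zigzag (~~ b) L'
  else [::].

Lemma path_rcons_rev a p b : path e a (rcons p b) = path e b (rcons (rev p) a).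
Proof.
rewrite -rev_cons -(eq_path (e := fun x y => e y x)) // -rev_path last_rcons.
by rewrite belast_rcons.
Qed.

(** The side changes with each rung, so the exit is decided by the entrance and the parity of
    [size L]. With an odd number of rungs the snake leaves on the side opposite to its entrance. *)
Lemma path_zigzag b L xl xr u v :
  path e xl (rcons (map (fun t => t.1.1) L) u) ->
  path e xr (rcons (map snd L) v) -> all rung L ->
  path e (if b then xl else xr)
    (rcons (zigzag b L) (if b (+) odd (size L) then u else v)).
Proof.
elim: L b xl xr => [|[[a p] c] L IH] b xl xr /=; first by rewrite addbF; case: b.
move=> /andP[ea pa] /andP[ec pc] /andP[rg rL]; rewrite /rung /= in rg.
have := IH (~~ b) a c pa pc rL; rewrite addNb addbN; case: b => /= Hp.
  rewrite ea /= rcons_cat rcons_cons cat_path /=.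
  by move: rg; rewrite rcons_path => /andP[-> ->].
rewrite ec /= rcons_cat rcons_cons cat_path /=.
by move: rg; rewrite path_rcons_rev rcons_path => /andP[-> ->].
Qed.

Lemma size_zigzag b L l : {in L, forall t, size t.1.2 = l} ->
  size (zigzag b L) = size L * l.+2.
Proof.
elim: L b => //= t L IH b sL.
have IH' : size (zigzag (~~ b) L) = size L * l.+2.
  by apply: IH => u uL; apply: sL; rewrite inE uL orbT.
have st := sL t (mem_head _ _).
by case: b IH' => /= IH'; rewrite size_cat ?size_rev st /= IH' mulSn addSnnS.
Qed.

Lemma mem_zigzag b L x : (x \in zigzag b L) =
  [|| x \in map (fun t => t.1.1) L, x \in map snd L | x \in flatten (map (fun t => t.1.2) L)].
Proof.
elim: L b => //= t L IH b.
have C (b1 b2 b3 b4 b5 b6 : bool) : [|| b1, b2, b3, b4, b5 | b6] = [|| b1 || b4, b3 || b5, b2 | b6].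
  by case: b1; case: b2; case: b3; case: b4; case: b5; case: b6.
have D (b1 b2 b3 b4 b5 b6 : bool) : [|| b3, b2, b1, b4, b5 | b6] = [|| b1 || b4, b3 || b5, b2 | b6].
  by case: b1; case: b2; case: b3; case: b4; case: b5; case: b6.
rewrite [RHS]/= mem_cat !in_cons; case: b; rewrite in_cons mem_cat in_cons ?mem_rev IH; [exact: C|exact: D].
Qed.

End Zigzag.

Section Network.
Variables (V : finType) (e : rel V).
Hypothesis e_sym : symmetric e.
Variables M K h : nat.
Hypothesis M_gt0 : 0 < M.
Hypothesis K_gt1 : 1 < K.
Hypothesis Kh : M <= K ^ h.
Hypothesis joined : forall X Y : {set V}, M <= #|X| -> M <= #|Y| ->
  exists x y, [/\ x \in X, y \in Y & e x y].

Let K_gt0 : 0 < K := ltnW K_gt1.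
Notation state := (state e M K).

Definition link_len := 2 * h.+1.
Definition room := link_len * M + step_room M K.

Lemma add_path A r y l : state A r -> y \in A -> 0 < r y ->
  #|A| + l.+1 + step_room M K <= #|V| ->
  exists (q : seq V) r', [/\ size q = l.+1, path e y q, uniq q,
    (forall x, x \in q -> x \notin A) &
    [/\ state (A :|: [set x in q]) r', r' (last y q) = K.+1 & forall x, x \in A -> x != y -> r' x = r x]].
Proof.
elim: l A r y => [|l IH] A r y Sr yA ry cV.
  have [|z [zA eyz Sz]] := state_leaf M_gt0 joined Sr yA ry.
    by move: cV; clear; lia.
  exists [:: z], (fun x => r x - (x == y)); split=> //=.
  - by rewrite eyz.
  - by move=> x; rewrite inE => /eqP->.
  split=> [||x _ /negbTE->]; last by rewrite subn0.
    by have -> : A :|: [set x in [:: z]] = z |: A by apply/setP=> x; rewrite !inE orbC.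
  have -> : (z == y) = false by apply: contraNF zA => /eqP->.
  by rewrite subn0 Sr.2.
have [|z [zA eyz Sz]] := state_leaf M_gt0 joined Sr yA ry.
  by move: cV; clear; lia.
have zy : z != y by apply: contraNneq zA => ->.
have [|||q [r' [sq pq uq qA [Sq lq rq]]]] := IH _ _ z Sz.
- by rewrite setU11.
- by rewrite (negbTE zy) subn0 Sr.2.
- by rewrite cardsU1 zA; move: cV; clear; lia.
have qA' x : x \in q -> (x != z) && (x \notin A) by move/qA; rewrite in_setU1 negb_or.
exists (z :: q), r'; split=> //=.
- by rewrite sq.
- by rewrite eyz.
- by rewrite uq andbT; apply/negP=> /qA'; rewrite eqxx.
- by move=> x; rewrite inE => /orP[/eqP->//|/qA'/andP[]].
split=> //.
  have -> : A :|: [set x in z :: q] = z |: A :|: [set x in q] by apply/setP=> x; rewrite !inE orbCA orbA.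
  exact: Sq.
move=> x xA xy; rewrite rq ?(negbTE xy) ?subn0 ?in_setU1 ?xA ?orbT //.
by apply: contraNneq zA => <-.
Qed.

Lemma connect_many A r (ps : seq (V * V)) : state A r ->
  uniq (map fst ps ++ map snd ps) ->
  {in map fst ps ++ map snd ps, forall x, (x \in A) && (0 < r x)} ->
  #|A| + size ps * link_len + room <= #|V| ->
  exists L r', let F := flatten (map (fun t => t.1.2) L) in
    [/\ map (fun t => t.1.1) L = map fst ps, map snd L = map snd ps,
    all (rung e) L, {in L, forall t, size t.1.2 = link_len} &
    [/\ uniq F, forall x, x \in F -> x \notin A, state (A :|: [set x in F]) r'
      & forall x, x \in A -> x \notin map fst ps ++ map snd ps -> r' x = r x]].
Proof.
elim: ps A r => [|[s t] ps IH] A r Sr ups Aps cV.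
  exists [::], r; split=> //=; split=> //.
  by have -> : A :|: [set x in [::]] = A by apply/setP=> x; rewrite !inE orbF.
have /andP[sA rs] := Aps s (mem_head _ _).
have tin : t \in map fst ((s, t) :: ps) ++ map snd ((s, t) :: ps).
  by rewrite mem_cat /= !inE eqxx !orbT.
have /andP[tA rt] := Aps t tin.
move: ups; rewrite /= mem_cat inE cat_uniq /= !negb_or => /and5P[/and3P[sfst st ssnd] ufst /andP[tfst hasn] tsnd usnd].
have ups : uniq (map fst ps ++ map snd ps) by rewrite cat_uniq ufst usnd hasn.
have cA : #|A| + 2 * h.+1 * M + step_room M K <= #|V| by apply: leq_trans cV; rewrite /room /link_len addnA leq_add2r leq_add2r leq_addr.
have [q [sq pq uq qA Sq]] := connect_room e_sym M_gt0 K_gt0 Kh joined Sr sA tA st rs rt cA.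
have [||L [r' [L1 L2 rL sL [uF FA SF rF]]]] := IH _ _ Sq ups.
- move=> x xps; have /andP[xA rx] : (x \in A) && (0 < r x).
    by apply: Aps; move: xps; rewrite !mem_cat /= !inE => /orP[->|->]; rewrite ?orbT.
  rewrite in_setU xA /=; have -> : (x \in q) = false by apply/negP=> /qA; rewrite xA.
  have -> : (x == s) = false.
    by apply: contraTF xps => /eqP->; rewrite mem_cat negb_or sfst.
  have -> : (x == t) = false.
    by apply: contraTF xps => /eqP->; rewrite mem_cat negb_or tfst.
  by rewrite !subn0.
- have : #|A :|: [set x in q]| <= #|A| + link_len.
    apply: leq_trans (leq_card_setU _ _).1 _; rewrite leq_add2l cardsE.
    by rewrite (card_uniqP uq) sq.
  by move: cV; clear; rewrite /= mulSn; lia.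
exists ((s, q, t) :: L), r'; split=> /=.
- by rewrite L1.
- by rewrite L2.
- by rewrite rL /rung /= pq.
- by move=> u; rewrite inE => /orP[/eqP->//|/sL].
have FA' x : x \in flatten (map (fun t => t.1.2) L) -> (x \notin A) && (x \notin q).
  by move/FA; rewrite in_setU inE negb_or.
split.
- rewrite cat_uniq uq uF andbT /=; apply/hasPn=> x /FA' /andP[_]; exact.
- by move=> x; rewrite mem_cat => /orP[/qA|/FA' /andP[]].
- have -> : A :|: [set x in q ++ flatten [seq t0.1.2 | t0 <- L]] =
      A :|: [set x in q] :|: [set x in flatten [seq t0.1.2 | t0 <- L]].
    by apply/setP=> x; rewrite !inE mem_cat orbA.
  exact: SF.
- move=> x xA; rewrite inE mem_cat inE !negb_or => /and4P[xs xf xt xsn].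
  rewrite rF ?in_setU ?xA //; last by rewrite mem_cat negb_or xf.
  have -> : (x \in q) = false by apply/negP=> /qA; rewrite xA.
  by rewrite (negbTE xs) (negbTE xt) !subn0.
Qed.

(* Every wire is lengthened by [Lw] edges in each layer of switches. *)
Definition Lw := ((2 * h).+1 * link_len.+2).+1.

Lemma card_setU_seq (A : {set V}) (q : seq V) : uniq q -> (forall x, x \in q -> x \notin A) ->
  #|A :|: [set x in q]| = #|A| + size q.
Proof.
move=> uq qA; rewrite cardsU cardsE (card_uniqP uq).
suff -> : A :&: [set x in q] = set0 by rewrite cards0 subn0.
by apply/setP=> x; rewrite !inE; apply/negP=> /andP[xA /qA]; rewrite xA.
Qed.

(* The switch: [x] and the end [y1] of a path starting at [y] are joined by two
   parallel paths [rcons p c] and [rcons q d], which are connected by rungs.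
   From [x] one may zigzag through all the rungs and end in [c] or in [d],
   leaving the other one to [y]. *)
Lemma switch_gadget A r x y : state A r -> x \in A -> y \in A -> x != y ->
  1 < r x -> 0 < r y -> #|A| + 2 * Lw + room <= #|V| ->
  exists (B : {set V}) c d r', [/\ state (A :|: B) r', 
    (forall z, z \in B -> z \notin A) /\ #|B| = 2 * Lw,
    [/\ c \in B, d \in B & c != d], r' c = K /\ r' d = K &
    (forall z, z \in A -> z != x -> z != y -> r' z = r z) /\
    forall b : bool, exists qx qy, [/\ path e x qx /\ last x qx = (if b then c else d),
      path e y qy /\ last y qy = (if b then d else c), size qx = Lw /\ size qy = Lw
      & forall z, z \in B -> (z \in qx) || (z \in qy)]].
Proof.
move=> S0 xA yA xy rx ry cV.
(* The summands count the path from [y] to [y1], the two parallel paths, and the interiors of the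
   rungs. *)
have Lw_gt : 2 * Lw = Lw.-1 + link_len + link_len + (2 * h).+1 * link_len.
  by rewrite /Lw succnK /link_len; clear; nia.
have cV1 : #|A| + ((2 * h).+1 * link_len.+2).-1.+1 + step_room M K <= #|V|.
  by apply: leq_trans cV; rewrite prednK // Lw_gt /Lw /room succnK; clear; lia.
have [qy0 [r1 [sqy pqy uqy qyA [S1 ry1 r1E]]]] := add_path S0 yA ry cV1.
set y1 := last y qy0 in ry1.
have {}sqy : size qy0 = Lw.-1 by rewrite sqy.
set A1 := A :|: _ in S1.
have cA1 : #|A1| = #|A| + Lw.-1 by rewrite card_setU_seq // sqy.
have xA1 : x \in A1 by rewrite !inE xA.
have y1q : y1 \in qy0.
  by rewrite /y1; case: (qy0) sqy => //= a l _; rewrite mem_last.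
have y1A1 : y1 \in A1 by rewrite !inE y1q orbT.
have xy1 : x != y1 by apply: contraTneq y1q => <-; apply/negP=> /qyA; rewrite xA.
have [|||p [sp pp up pA1 S2]] := connect_room e_sym M_gt0 K_gt0 Kh joined S1 xA1 y1A1 xy1.
- by rewrite r1E // ltnW.
- by rewrite ry1.
- by apply: leq_trans cV; rewrite cA1 Lw_gt /room /link_len; clear; lia.
set A2 := A1 :|: _ in S2.
have cA2 : #|A2| = #|A1| + link_len by rewrite card_setU_seq // sp.
have xA2 : x \in A2 by rewrite inE xA1.
have y1A2 : y1 \in A2 by rewrite inE y1A1.
have xp : (x \in p) = false by apply/negP=> /pA1; rewrite xA1.
have y1p : (y1 \in p) = false by apply/negP=> /pA1; rewrite y1A1.
have [|||q [sq pq uq qA2 S3]] := connect_room e_sym M_gt0 K_gt0 Kh joined S2 xA2 y1A2 xy1.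
- by rewrite xp r1E // eqxx (negbTE xy1) subn0 subn_gt0.
- by rewrite y1p ry1 eqxx eq_sym (negbTE xy1) subn0 subn1.
- by apply: leq_trans cV; rewrite cA2 cA1 Lw_gt /room /link_len; clear; lia.
set A3 := A2 :|: _ in S3; set r3 := (fun z => _) in S3.
have cA3 : #|A3| = #|A2| + link_len by rewrite card_setU_seq // sq.
have qp z : z \in q -> z \notin p.
  by move/qA2; rewrite !inE !negb_or => /andP[].
have r3p z : z \in p -> r3 z = K.
  move=> zp; rewrite /r3; case: ifP => // _.
  have -> : (z == x) = false by apply: contraTF zp => /eqP->; rewrite xp.
  have -> : (z == y1) = false by apply: contraTF zp => /eqP->; rewrite y1p.
  by rewrite !subn0 zp.
have r3q z : z \in q -> r3 z = K by rewrite /r3 => ->.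
have pA3 z : z \in p -> z \in A3 by move=> zp; rewrite !inE zp !orbT.
have qA3 z : z \in q -> z \in A3 by move=> zq; rewrite !inE zq !orbT.
have [p' [c Ep]] : exists p' c, p = rcons p' c.
  by case: (lastP p) sp => // p' c; exists p', c.
have [q' [d Eq]] : exists q' d, q = rcons q' d.
  by case: (lastP q) sq => // q' d; exists q', d.
(* Without its last vertex a link keeps [(2 * h).+1] inner vertices. This odd number of rungs lets
   the choice of the first rail decide between the exits [c] and [d]. *)
have sp' : size p' = (2 * h).+1 by move: sp; rewrite Ep size_rcons; clear; lia.
have sq' : size q' = (2 * h).+1 by move: sq; rewrite Eq size_rcons; clear; lia.
have E1 : map fst (zip p' q') = p' by apply: unzip1_zip; rewrite sp' sq'.
have E2 : map snd (zip p' q') = q' by apply: unzip2_zip; rewrite sp' sq'.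
have p'p z : z \in p' -> z \in p by rewrite Ep mem_rcons inE => ->; rewrite orbT.
have q'q z : z \in q' -> z \in q by rewrite Eq mem_rcons inE => ->; rewrite orbT.
have cp : c \in p by rewrite Ep mem_rcons mem_head.
have dq : d \in q by rewrite Eq mem_rcons mem_head.
have [cp' up'] : c \notin p' /\ uniq p' by move: up; rewrite Ep rcons_uniq => /andP[].
have [dq' uq'] : d \notin q' /\ uniq q' by move: uq; rewrite Eq rcons_uniq => /andP[].
have [|||L [r4 [L1 L2 rL sL [uF FA S4 r4E]]]] := connect_many (ps := zip p' q') S3.
- rewrite E1 E2 cat_uniq up' uq' andbT /=; apply/hasPn=> z /q'q/qp.
  by apply: contra; apply: p'p.
- move=> z; rewrite E1 E2 mem_cat => /orP[/p'p zp|/q'q zq].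
    by rewrite pA3 // r3p.
  by rewrite qA3 // r3q.
- apply: leq_trans cV; rewrite size_zip sp' sq' minnn cA3 cA2 cA1 Lw_gt.
  by clear; lia.
rewrite E1 in L1; rewrite E2 in L2; rewrite E1 E2 in r4E.
set F := flatten _ in uF FA S4.
have sizeL : size L = (2 * h).+1 by rewrite -sp' -L1 size_map.
have sF : size F = (2 * h).+1 * link_len.
  rewrite -sizeL /F; elim: (L) sL => //= t L' IH sL.
  rewrite size_cat sL ?mem_head // IH ?mulSn // => u uL.
  by apply: sL; rewrite inE uL orbT.
pose B := [set z in qy0 ++ p ++ q ++ F].
have BE z : z \in B -> [\/ z \in qy0, z \in p, z \in q | z \in F].
  by rewrite inE !mem_cat => /or4P[]; [constructor 1|constructor 2|constructor 3|constructor 4].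
have AB : A :|: B = A3 :|: [set z in F].
  by apply/setP=> z; rewrite !inE !mem_cat !orbA.
have BA z : z \in B -> z \notin A.
  case/BE; [exact: qyA | | |].
  - by move/pA1; rewrite inE negb_or => /andP[].
  - by move/qA2; rewrite !inE !negb_or => /andP[/andP[]].
  - by move/FA; rewrite !inE !negb_or => /andP[/andP[/andP[]]].
have cB : #|B| = 2 * Lw.
  have : #|A :|: B| = #|A| + #|B|.
    rewrite cardsU (_ : A :&: B = set0) ?cards0 ?subn0 //.
    by apply/setP=> z; rewrite inE in_set0; apply/negP=> /andP[zA /BA]; rewrite zA.
  rewrite AB card_setU_seq // cA3 cA2 cA1 sF Lw_gt; clear; lia.
have cq : c \notin q by apply/negP=> /qp; rewrite cp.
have dp : d \notin p by apply: qp.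
exists B, c, d, r4; split=> //.
- by rewrite AB.
- split; [by rewrite inE !mem_cat cp orbT | by rewrite inE !mem_cat dq !orbT |].
  by apply: contraNneq cq => ->.
- split.
    by rewrite r4E ?r3p ?pA3 // mem_cat negb_or cp' /=; apply: contra cq; apply: q'q.
  by rewrite r4E ?r3q ?qA3 // mem_cat negb_or dq' andbT; apply: contra dp; apply: p'p.
have pc : path e x (rcons p' c) /\ e c y1.
  by move: pp; rewrite Ep rcons_path last_rcons => /andP[].
have qd : path e x (rcons q' d) /\ e d y1.
  by move: pq; rewrite Eq rcons_path last_rcons => /andP[].
split.
  move=> z zA zx zy.
  have zp : z \notin p by apply/negP=> /pA1; rewrite inE zA.
  have zq : z \notin q by apply/negP=> /qA2; rewrite !inE zA.
  have zy1 : z != y1 by apply: contraTneq zA => ->; apply: qyA.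
  rewrite r4E; last first.
  - by rewrite mem_cat negb_or (contra (@p'p z)) ?(contra (@q'q z)).
  - by rewrite !inE zA.
  by rewrite /r3 (negbTE zq) (negbTE zp) (negbTE zx) (negbTE zy1) !subn0 r1E.
move=> b; pose u := if b then c else d; pose v := if b then d else c.
(* To end in [c], which closes the left rail, the zigzag has to start on the right: hence [~~ b]. *)
exists (rcons (zigzag (~~ b) L) u), (rcons qy0 v); split.
- rewrite last_rcons; split=> //.
  have := @path_zigzag V e e_sym (~~ b) L x x c d.
  rewrite L1 L2 sizeL /= oddM /= if_same /u => /(_ pc.1 qd.1 rL).
  by rewrite addbT negbK.
- rewrite last_rcons rcons_path pqy /=; split=> //.
  by rewrite e_sym /v; case: (b); [exact: qd.2 | exact: pc.2].
- rewrite !size_rcons (size_zigzag _ sL) sizeL sqy /Lw; split=> //.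
move=> z /BE zB; rewrite !mem_rcons !inE mem_zigzag L1 L2 -/F.
case: zB => [->|zp|zq|->]; rewrite ?orbT //.
  move: zp; rewrite Ep mem_rcons inE => /orP[/eqP->|->]; last by rewrite ?orbT.
  by rewrite /u /v; case: (b); rewrite eqxx ?orbT.
move: zq; rewrite Eq mem_rcons inE => /orP[/eqP->|->]; last by rewrite ?orbT.
by rewrite /u /v; case: (b); rewrite eqxx ?orbT.
Qed.

(** One gadget per pair of [i] and [a i]; [J] is a union of pairs, so that the induction can remove
    one. [B] and [w'] are chosen before [t]: a layer is built once and serves every setting of its
    switches. *)
Lemma switch_layer (I : finType) (a : I -> I) (w : I -> V) (J : {set I}) A r :
  involutive a -> (forall i, a i != i) -> (forall i, i \in J -> a i \in J) ->
  {in J &, injective w} -> state A r -> (forall i, i \in J -> w i \in A /\ 1 < r (w i)) ->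
  #|A| + #|J| * Lw + room <= #|V| ->
  exists (B : {set V}) (w' : I -> V) r', [/\ state (A :|: B) r',
    (forall z, z \in B -> z \notin A) /\ #|B| = #|J| * Lw,
    {in J &, injective w'} /\ (forall i, i \in J -> w' i \in B /\ r' (w' i) = K),
    (forall z, z \in A -> z \notin w @: J -> r' z = r z) &
    forall t, switched a t -> exists q : I -> seq V,
      (forall i, i \in J -> [/\ path e (w i) (q i), last (w i) (q i) = w' (t i) & size (q i) = Lw]) /\
      (forall z, z \in B -> exists2 i, i \in J & z \in q i)].
Proof.
move=> ai an; have [n] := ubnP #|J|; elim: n J A r => // n IH J A r; rewrite ltnS => Jn aJ wJ S0 wA cV.
have [J0|[i iJ]] := set_0Vmem J.
  exists set0, w, r; rewrite J0 !cards0 mul0n setU0; split=> //.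
  - by split=> // z; rewrite inE.
  - by split; [move=> x y | move=> x]; rewrite inE.
  - by move=> t _; exists (fun=> [::]); split=> [x|z]; rewrite inE.
have aiJ := aJ i iJ; have aii := an i.
pose J' := J :\ i :\ a i.
have cJ : #|J| = #|J'|.+2.
  by rewrite /J' (cardsD1 i J) iJ (cardsD1 (a i) (J :\ i)) !inE aii aiJ.
have J'J x : x \in J' -> [/\ x \in J, x != i & x != a i].
  by rewrite !inE => /and3P[-> -> ->].
have JJ' x : x \in J -> [\/ x = i, x = a i | x \in J'].
  move=> xJ; case: (eqVneq x i) => [->|xi]; first by constructor 1.
  case: (eqVneq x (a i)) => [->|xai]; first by constructor 2.
  by constructor 3; rewrite !inE xi xai.
have [||||||B1 [w1 [r1 [S1 [BA1 cB1] [w1i w1B] r1E route1]]]] := IH J' A r.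
- by move: Jn; rewrite cJ; clear; lia.
- move=> x /J'J[xJ xi xai]; rewrite !inE aJ // andbT.
  rewrite (inj_eq (inv_inj ai)) xi /=; apply: contra xai => /eqP <-; by rewrite ai.
- by move=> x y /J'J[xJ _ _] /J'J[yJ _ _]; apply: wJ.
- exact: S0.
- by move=> x /J'J[xJ _ _]; apply: wA.
- by apply: leq_trans cV; rewrite cJ; clear; nia.
have wn x : x \in J -> x \notin J' -> w x \notin w @: J'.
  move=> xJ xJ'; apply/imsetP=> -[y yJ' E]; case/negP: xJ'.
  by have [yJ _ _] := J'J y yJ'; rewrite (wJ x y xJ yJ E).
have iJ' : i \notin J' by rewrite !inE eqxx andbF.
have aiJ' : a i \notin J' by rewrite !inE eqxx.
have wii : w i != w (a i) by apply: contra aii => /eqP/(wJ _ _ iJ aiJ) <-.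
have [||||||B2 [c [d [r2 [S2 [BA2 cB2] [cB dB cd] [r2c r2d] [r2E route2]]]]]] :=
    @switch_gadget _ _ (w i) (w (a i)) S1.
- by rewrite inE (wA i iJ).1.
- by rewrite inE (wA _ aiJ).1.
- exact: wii.
- rewrite r1E; [exact: (wA i iJ).2|exact: (wA i iJ).1|exact: wn].
- rewrite r1E; [exact/ltnW/(wA _ aiJ).2|exact: (wA _ aiJ).1|exact: wn].
- apply: leq_trans cV; rewrite cJ; have := (leq_card_setU A B1).1; rewrite cB1; clear; nia.
pose w2 x := if x == i then c else if x == a i then d else w1 x.
have w2J' x : x \in J' -> w2 x = w1 x.
  by case/J'J => _ /negbTE xi /negbTE xai; rewrite /w2 xi xai.
have w2i : w2 i = c by rewrite /w2 eqxx.
have w2ai : w2 (a i) = d by rewrite /w2 (negbTE aii) eqxx.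
have BB z : z \in B1 -> z \notin B2.
  by move=> zB1; apply/negP=> /BA2; rewrite inE zB1 orbT.
have w1c x : x \in J' -> (w1 x != c) /\ (w1 x != d).
  by move=> /w1B[/BB xB _]; split; apply: contraNneq xB => ->.
exists (B1 :|: B2), w2, r2; split.
- by rewrite setUA.
- split=> [z|].
    by rewrite inE => /orP[/BA1//|/BA2]; rewrite inE negb_or => /andP[].
  rewrite cardsU (_ : B1 :&: B2 = set0) ?cards0 ?subn0 ?cB1 ?cB2 ?cJ; first by clear; nia.
  by apply/setP=> z; rewrite !inE; apply/negP=> /andP[/BB/negP].
- split.
    move=> x y /JJ'[->|->|xJ'] /JJ'[->|->|yJ'] //; rewrite ?w2i ?w2ai ?w2J' // => E.
    + by rewrite E eqxx in cd.
    + by have := (w1c y yJ').1; rewrite -E eqxx.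
    + by rewrite E eqxx in cd.
    + by have := (w1c y yJ').2; rewrite -E eqxx.
    + by have := (w1c x xJ').1; rewrite E eqxx.
    + by have := (w1c x xJ').2; rewrite E eqxx.
    + exact: w1i.
  move=> x /JJ'[->|->|xJ']; rewrite ?w2i ?w2ai ?w2J' // inE.
  + by rewrite cB orbT.
  + by rewrite dB orbT.
  have [xB1 r1x] := w1B x xJ'; rewrite xB1; split=> //.
  rewrite r2E ?inE ?xB1 ?orbT //; apply: contraTneq xB1 => ->; apply/negP=> /BA1.
    by rewrite (wA i iJ).1.
  by rewrite (wA _ aiJ).1.
- move=> z zA zw; rewrite r2E ?r1E //.
  + by apply: contra zw => /imsetP[x /J'J[xJ _ _] ->]; apply: imset_f.
  + by rewrite inE zA.
  + by apply: contraNneq zw => ->; apply: imset_f.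
  + by apply: contraNneq zw => ->; apply: imset_f.
move=> t [ti ta]; have [q1 [q1P q1B]] := route1 t (conj ti ta).
have [qx [qy [[px lx] [py ly] [sx sy] cov]]] := route2 (t i == i).
have [tiE taiE] : w2 (t i) = (if t i == i then c else d) /\
    w2 (t (a i)) = (if t i == i then d else c).
  case: (ta i) (ta (a i)) => E1 [E2|E2]; rewrite E1 E2 ?ai ?eqxx ?(negbTE aii) ?w2i ?w2ai //.
    by case/eqP: aii; apply: ti; rewrite E1 E2 ai.
  by case/eqP: aii; apply: ti; rewrite E1 E2.
exists (fun x => if x == i then qx else if x == a i then qy else q1 x); split.
  move=> x /JJ'[->|->|xJ']; rewrite ?eqxx ?(negbTE aii) ?tiE ?taiE //.
  have [xJ /negbTE -> /negbTE ->] := J'J x xJ'; have [p1 p2 p3] := q1P x xJ'; split=> //.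
  rewrite p2 w2J' //; case: (ta x) => -> //; rewrite !inE aJ //.
  rewrite (inj_eq (inv_inj ai)); have [_ -> /= xai] := J'J x xJ'.
  by rewrite andbT; apply: contra xai => /eqP <-; rewrite ai.
move=> z; rewrite inE => /orP[/q1B[x xJ' zx]|/cov/orP[zx|zy]].
- by have [xJ /negbTE xi /negbTE xai] := J'J x xJ'; exists x => //; rewrite xi xai.
- by exists i => //; rewrite eqxx.
- by exists (a i) => //; rewrite (negbTE aii) eqxx.
Qed.

(** The [#|I|] paths have [size ls * Lw] vertices each after the start and cover a set [B] of
    exactly the product size. So every routing uses all of [B], and no vertex twice. *)
Lemma switch_network (I : finType) (ls : seq (I -> I)) (w : I -> V) A r :
  pairings ls -> injective w -> state A r -> (forall i, w i \in A /\ K <= r (w i)) ->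
  #|A| + size ls * (#|I| * Lw) + room <= #|V| ->
  exists (B : {set V}) (w' : I -> V) r', [/\ state (A :|: B) r',
    (forall z, z \in B -> z \notin A) /\ #|B| = size ls * (#|I| * Lw),
    injective w' /\ (forall i, w' i \in (w @: I) :|: B /\ K <= r' (w' i)),
    (forall z, z \in A -> z \notin w @: I -> r' z = r z) &
    forall s, routes ls s -> exists q : I -> seq V,
      (forall i, [/\ path e (w i) (q i), last (w i) (q i) = w' (s i) & size (q i) = size ls * Lw]) /\
      (forall z, z \in B -> exists i, z \in q i)].
Proof.
elim: ls w A r => [|a ls IH] w A r /= ls_inv wi S0 wA cV.
  exists set0, w, r; rewrite setU0 cards0 mul0n; split=> //.
  - by split=> // z; rewrite inE.
  - by split=> // i; rewrite setU0 imset_f ?(wA i).2.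
  by move=> s sE; exists (fun=> [::]); split=> [i|z]; [rewrite sE | rewrite inE].
case: ls_inv => ai an ls_inv.
have [||||B1 [w1 [r1 [S1 [BA1 cB1] [w1i w1B] r1E route1]]]] :=
    @switch_layer I a w setT A r ai an _ _ S0.
- by move=> i; rewrite !inE.
- by move=> i j _ _; apply: wi.
- by move=> i _; have [wiA wiK] := wA i; split=> //; apply: leq_trans wiK.
- by apply: leq_trans cV; rewrite cardsT mulSn leq_add2r leq_add2l leq_addr.
have {}w1i : injective w1 by move=> i j; apply: w1i; rewrite inE.
have {}w1B i : w1 i \in B1 /\ r1 (w1 i) = K by apply: w1B; rewrite inE.
rewrite cardsT in cB1.
have [||B2 [w2 [r2 [S2 [BA2 cB2] [w2i w2B] r2E route2]]]] := IH w1 _ _ ls_inv w1i S1.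
- by move=> i; have [iB ->] := w1B i; rewrite inE iB orbT.
- apply: leq_trans cV; rewrite mulSn addnA !leq_add2r -cB1.
  exact: (leq_card_setU A B1).1.
exists (B1 :|: B2), w2, r2; split.
- by rewrite setUA.
- split=> [z|].
    by rewrite inE => /orP[/BA1//|/BA2]; rewrite inE negb_or => /andP[].
  rewrite cardsU (_ : B1 :&: B2 = set0) ?cards0 ?subn0 ?cB1 ?cB2 //.
  by apply/setP=> z; rewrite !inE; apply/negP=> /andP[zB /BA2]; rewrite inE zB orbT.
- split=> // i; have [iB ?] := w2B i; split=> //.
  move: iB; rewrite !inE => /orP[/imsetP[j _ ->]|->]; last by rewrite !orbT.
  by have [-> _] := w1B j; rewrite orbT.
- move=> z zA zw; rewrite r2E ?r1E ?inE ?zA //.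
    by apply: contra zw => /imsetP[j _ ->]; apply: imset_f.
  by apply/imsetP=> -[j _ zj]; have [/BA1] := w1B j; rewrite -zj zA.
move=> s [t [s' [[ti ta] rs sE]]].
have [q1 [q1P q1B]] := route1 t (conj ti ta).
have [q2 [q2P q2B]] := route2 s' rs.
exists (fun i => q1 i ++ q2 (t i)); split.
  move=> i; have [p1 l1 s1] := q1P i (in_setT _); have [p2 l2 s2] := q2P (t i).
  by rewrite cat_path last_cat size_cat l1 p1 s1 s2 mulSn sE.
move=> z; rewrite inE => /orP[/q1B[i _ zi]|/q2B[j zj]].
  by exists i; rewrite mem_cat zi.
by exists (invF ti j); rewrite mem_cat f_invF zj orbT.
Qed.

End Network.

(** * Embedding a forest with prescribed images *)

Section Embedding.
Variables (V : finType) (e : rel V).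
Hypothesis e_sym : symmetric e.
Variables M K h : nat.
Hypothesis M_gt0 : 0 < M.
Hypothesis K_gt0 : 0 < K.
Hypothesis Kh : M <= K ^ h.
Hypothesis joined : forall X Y : {set V}, M <= #|X| -> M <= #|Y| ->
  exists x y, [/\ x \in X, y \in Y & e x y].

Variables (T I : finType) (par : T -> T) (dep : T -> nat) (S Rt : {set T}).
Variables (Delta : nat) (p : I -> T).
Notation rho1 := (link_len h).
Notation room := (room M K h).
Notation anc i j := (iter j par (p i)).
Notation kids v := [set c in S :\: Rt | par c == v].
Hypothesis Delta_K : Delta <= K.
Hypothesis RtS : Rt \subset S.
Hypothesis par_S : forall v, v \in S :\: Rt -> par v \in S.
Hypothesis par_dep : forall v, v \in S :\: Rt -> dep v = (dep (par v)).+1.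
Hypothesis kids_le : forall v, #|kids v| <= Delta.
Hypothesis anc_S : forall i j, j <= rho1 -> anc i j \in S :\: Rt.
Hypothesis anc_inj : forall i i' j j', j <= rho1 -> j' <= rho1 ->
  anc i j = anc i' j' -> i = i'.

Variables (A : {set V}) (r : V -> nat) (f0 : T -> V) (w : I -> V).
Hypothesis w_inj : injective w.
Hypothesis wA : forall i, w i \in A.
Hypothesis f0_inj : {in Rt &, injective f0}.
Hypothesis f0A : {in Rt, forall v, f0 v \in A}.
Hypothesis f0w : {in Rt, forall v i, f0 v != w i}.

Let targets := [set p i | i : I].

(** Invariant of a greedy embedding. A segment from [p i] up to [anc i rho1] is placed in one go,
    hence [emb_anc]. [emb_room] leaves the targets out because their images lie in [A] from the
    start; each step then trades tree vertices for used vertices one for one. [emb_wcap] reserves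
    [Delta] children and the link at a target not yet reached. *)
Record embedded (E : {set T}) (A' : {set V}) (r' : V -> nat) (f : T -> V) : Prop := Embedded {
  emb_sub : Rt \subset E /\ E \subset S;
  emb_par : {in E :\: Rt, forall v, par v \in E /\ e (f (par v)) (f v)};
  emb_anc : forall i j, j <= rho1 -> (anc i j \in E) = (p i \in E);
  emb_state : state e M K A' r';
  emb_A : A \subset A' /\ {in E, forall v, f v \in A'};
  emb_inj : {in E &, injective f};
  emb_root : {in Rt, f =1 f0};
  emb_target : forall i, p i \in E -> f (p i) = w i;
  emb_new : {in E, forall v, v \notin Rt -> v \notin targets -> f v \notin A};
  emb_room : #|A'| + #|S :\: (E :|: targets)| + room <= #|V|;
  emb_cap : {in E, forall v, #|kids v :\: E| <= r' (f v)};
  emb_wcap : forall i, p i \notin E -> Delta < r' (w i) }.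

Lemma dep_anc i j : j <= rho1 -> dep (p i) = dep (anc i j) + j.
Proof.
elim: j => [|j IH] jr; first by rewrite addn0.
by rewrite (IH (ltnW jr)) par_dep ?anc_S ?(ltnW jr) //= addSnnS.
Qed.

Lemma target_free E A' r' f i : embedded E A' r' f -> p i \notin E -> w i \notin f @: E.
Proof.
move=> emb piE; apply/imsetP=> -[v vE wv].
case: (boolP (v \in Rt)) => [vR|vR].
  by have := f0w vR i; rewrite -(emb_root emb vR) wv eqxx.
case: (boolP (v \in targets)) => [/imsetP[i' _ vi']|vt].
  move: wv; rewrite vi' (emb_target emb) -?vi' // => /w_inj ii'.
  by rewrite ii' -vi' vE in piE.
by have := emb_new emb vE vR vt; rewrite -wv wA.
Qed.

Lemma embed_leaf E A' r' f v : embedded E A' r' f -> v \in S :\: E -> par v \in E ->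
  (forall i j, j <= rho1 -> v != anc i j) ->
  exists A2 r2 f2, embedded (v |: E) A2 r2 f2.
Proof.
move=> emb; rewrite inE => /andP[vE vS] uE vanc.
have vR : v \notin Rt by apply: contra vE; apply: (subsetP (emb_sub emb).1).
have vSR : v \in S :\: Rt by rewrite inE vR.
have ru : 0 < r' (f (par v)).
  apply: leq_trans (emb_cap emb uE); apply/card_gt0P; exists v.
  by rewrite !inE vE vR vS eqxx.
have vt : v \notin targets by apply/imsetP=> -[i _ vi]; have := vanc i 0 isT; rewrite vi eqxx.
have [RE ES] := emb_sub emb; have [AA' fA'] := emb_A emb.
have [|y [yA euy Sy]] := state_leaf M_gt0 joined (emb_state emb) (fA' _ uE) ru.
  by apply: leq_trans (emb_room emb); rewrite /room; clear; lia.
pose f2 x := if x == v then y else f x.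
have f2E x : x \in E -> f2 x = f x.
  by move=> xE; rewrite /f2; case: eqP => // xv; rewrite -xv xE in vE.
have f2v : f2 v = y by rewrite /f2 eqxx.
have yf x : x \in E -> y != f x by move=> xE; apply: contraNneq yA => ->; apply: fA'.
exists (y |: A'), (fun x => r' x - (x == f (par v))), f2; split.
- by split; [apply: subset_trans RE (subsetUr _ _) | rewrite subUset sub1set vS].
- move=> x; rewrite !inE => /andP[xR /orP[/eqP->|xE]].
    by rewrite uE orbT f2v f2E.
  have xER : x \in E :\: Rt by rewrite inE xR.
  by have [pxE ex] := emb_par emb xER; rewrite pxE orbT !f2E.
- move=> i j jr; rewrite !inE (emb_anc emb) //.
  by rewrite ![_ == v]eq_sym (negbTE (vanc i j jr)) (negbTE (vanc i 0 isT)).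
- exact: Sy.
- split; first by apply: subset_trans AA' (subsetUr _ _).
  by move=> x; rewrite !inE => /orP[/eqP->|xE]; rewrite ?f2v ?eqxx // f2E ?fA' ?orbT.
- move=> x z; rewrite !inE => /orP[/eqP->|xE] /orP[/eqP->|zE] //; rewrite ?f2v ?f2E // => E'.
  + by have := yf z zE; rewrite E' eqxx.
  + by have := yf x xE; rewrite E' eqxx.
  + exact: (emb_inj emb).
- by move=> x xR; rewrite f2E ?(emb_root emb) // (subsetP RE).
- move=> i; rewrite !inE => /orP[/eqP pv|piE]; first by have := vanc i 0 isT; rewrite pv eqxx.
  by rewrite f2E ?(emb_target emb).
- move=> x; rewrite !inE => /orP[/eqP->|xE] xR xt; last by rewrite f2E ?(emb_new emb).
  by rewrite f2v; apply: contra yA; apply: (subsetP AA').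
- apply: leq_trans (emb_room emb); rewrite leq_add2r cardsU1 yA.
  rewrite (cardsD1 v (S :\: (E :|: targets))) !inE negb_or vE vt vS /= [X in _ <= X]addnCA -addnA !leq_add2l.
  by apply: subset_leq_card; apply/subsetP=> x; rewrite !inE !negb_or => /andP[/andP[/andP[-> ->] ->] ->].
- move=> x; rewrite !inE => /orP[/eqP->|xE].
    rewrite f2v (emb_state emb).2 // (negbTE (yf _ uE)) subn0.
    apply: leq_trans (_ : #|kids v| <= _); first by apply: subset_leq_card; apply: subsetDl.
    by apply: leq_trans (kids_le v) _; apply: leqW.
  rewrite f2E //; have := emb_cap emb xE.
  case: (eqVneq x (par v)) => [xu|xu].
    rewrite xu eqxx (cardsD1 v) !inE vE vR vS eqxx /= => H.
    rewrite leq_subRL //; apply: leq_trans H; rewrite leq_add2l; apply: subset_leq_card.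
    by apply/subsetP=> z; rewrite !inE negb_or => /andP[/andP[-> ->] ->].
  have -> : (f x == f (par v)) = false.
    by apply: contraNF xu => /eqP/(emb_inj emb xE uE)->.
  rewrite subn0; apply: leq_trans; apply: subset_leq_card.
  by apply/subsetP=> z; rewrite !inE negb_or => /andP[/andP[_ ->] ->].
- move=> i; rewrite !inE negb_or => /andP[_ piE].
  have -> : (w i == f (par v)) = false.
    by apply: contraNF (target_free emb piE) => /eqP->; apply: imset_f.
  by rewrite subn0 (emb_wcap emb).
Qed.

Lemma embed_path E A' r' f i : embedded E A' r' f -> p i \notin E -> anc i rho1.+1 \in E ->
  exists (E2 : {set T}) A2 r2 f2, E \proper E2 /\ embedded E2 A2 r2 f2.
Proof.
move=> emb piE uE; set u := anc i rho1.+1 in uE.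
have [RE ES] := emb_sub emb; have [AA' fA'] := emb_A emb.
have wiA' : w i \in A' by apply: (subsetP AA').
have ancE j : j <= rho1 -> anc i j \notin E by move=> jr; rewrite (emb_anc emb).
have topE := ancE _ (leqnn rho1).
have topS := anc_S i (leqnn rho1).
have ru : 0 < r' (f u).
  apply: leq_trans (emb_cap emb uE); apply/card_gt0P; exists (anc i rho1).
  by rewrite inE topE inE topS eqxx.
have wu : f u != w i.
  by apply: contraNneq (target_free emb piE) => <-; apply: imset_f.
have rw : 0 < r' (w i) by apply: leq_ltn_trans (emb_wcap emb piE).
have cA : #|A'| + 2 * h.+1 * M + step_room M K <= #|V|.
  apply: leq_trans (emb_room emb); rewrite /room /link_len; clear; lia.
have [q [sq pq uq qA S2]] :=
  connect_room e_sym M_gt0 K_gt0 Kh joined (emb_state emb) (fA' _ uE) wiA' wu ru rw cA.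
have {}sq : size q = rho1 := sq.
pose full := rcons q (w i).
have sfull : size full = rho1.+1 by rewrite size_rcons sq.
have ufull : uniq full by rewrite rcons_uniq uq andbT; apply/negP=> /qA; rewrite wiA'.
have fullP x : x \in full -> x = w i \/ x \notin A'.
  by rewrite mem_rcons inE => /orP[/eqP|/qA]; [left|right].
have fullf x : x \in full -> x \notin f @: E.
  case/fullP => [->|xA]; first exact: target_free emb piE.
  by apply: contra xA => /imsetP[z zE ->]; apply: fA'.
pose P := [set anc i j | j : 'I_rho1.+1].
have PP x : reflect (exists2 j, j <= rho1 & x = anc i j) (x \in P).
  apply: (iffP imsetP) => [[j _ ->]|[j jr ->]]; first by exists j; rewrite // -ltnS.
  by exists (Ordinal (jr : j < rho1.+1)).
(* The difference of depths is the [j] with [x = anc i j]. The link runs downwards, so [p i] gets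
   its last vertex [w i]. *)
pose f2 x := if x \in P then nth (w i) full (rho1 - (dep (p i) - dep x)) else f x.
have PE x : x \in E -> x \notin P.
  by move=> xE; apply/PP=> -[j jr xj]; have := ancE j jr; rewrite -xj xE.
have f2E x : x \in E -> f2 x = f x by move=> /PE; rewrite /f2 => /negbTE->.
have f2P j : j <= rho1 -> f2 (anc i j) = nth (w i) full (rho1 - j).
  move=> jr; rewrite /f2; case: PP => [_|[]]; last by exists j.
  by rewrite (dep_anc i jr) addKn.
have f2full x : x \in P -> f2 x \in full.
  by case/PP=> j jr ->; rewrite f2P // mem_nth // sfull ltnS leq_subr.
have f2pi : f2 (p i) = w i.
  by rewrite (f2P 0) // subn0 /full nth_rcons sq ltnn eqxx.
have Ppi : p i \in P by apply/PP; exists 0.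
have PS x : x \in P -> x \in S :\: Rt by case/PP=> j jr ->; apply: anc_S.
have Pt x : x \in P -> x \in targets -> x = p i.
  case/PP=> j jr -> /imsetP[i' _ E']; have := @anc_inj i i' j 0 jr isT E' => ii'.
  by rewrite E' ii'.
have P'i i' j : j <= rho1 -> i' != i -> anc i' j \notin P.
  by move=> jr; apply: contra => /PP[j' jr' /anc_inj->].
pose r2 x := if x \in q then K else r' x - (x == f u) - (x == w i).
exists (E :|: P), (A' :|: [set x in q]), r2, f2; split.
  by apply/properP; split; [exact: subsetUl | exists (p i); rewrite // inE Ppi orbT].
have r2old x : x \in A' -> x != f u -> x != w i -> r2 x = r' x.
  move=> xA xu xw; rewrite /r2 (negbTE xu) (negbTE xw) !subn0.
  by case: ifP => // /qA; rewrite xA.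
split=> //.
- split; first by apply: subset_trans RE (subsetUl _ _).
  by rewrite subUset ES; apply/subsetP=> x /PS; rewrite inE => /andP[].
- move=> x; rewrite !inE => /andP[xR /orP[xE|xP]].
    have xER : x \in E :\: Rt by rewrite inE xR.
    by have [pxE ex] := emb_par emb xER; rewrite pxE !f2E.
  case/PP: xP => j jr ->; rewrite -iterS.
  have edge k : k < rho1.+1 -> e (nth (w i) (f u :: full) k) (nth (w i) full k).
    by move=> kr; apply: (pathP (w i) pq); rewrite sfull.
  rewrite (f2P j jr); case: (eqVneq j rho1) => [->|jr1].
    by rewrite uE /= f2E // subnn; split=> //; apply: (edge 0).
  have jr' : j < rho1 by rewrite ltn_neqAle jr1.
  split; first by apply/orP; right; apply/PP; exists j.+1.
  rewrite f2P //; have := edge (rho1 - j); rewrite ltnS leq_subr => /(_ isT).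
  by rewrite -(subnSK jr').
- move=> i' j jr; rewrite !inE (emb_anc emb) //; case: (eqVneq i' i) => [->|i'i].
    by rewrite Ppi orbT; have -> : anc i j \in P by [apply/PP; exists j]; rewrite orbT.
  by rewrite (negbTE (P'i i' j jr i'i)) (negbTE (P'i i' 0 isT i'i)).
- split; first by apply: subset_trans AA' (subsetUl _ _).
  move=> x; rewrite !inE => /orP[xE|xP]; first by rewrite f2E ?fA'.
  have := f2full x xP; rewrite mem_rcons inE => /orP[/eqP->|->]; last by rewrite orbT.
  by rewrite wiA'.
- move=> x z; rewrite !inE => /orP[xE|xP] /orP[zE|zP].
  + by rewrite !f2E //; apply: (emb_inj emb).
  + by rewrite f2E // => E'; have := fullf _ (f2full z zP); rewrite -E' imset_f.
  + by rewrite (f2E z) // => E'; have := fullf _ (f2full x xP); rewrite E' imset_f.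
  case/PP: xP => j jr ->; case/PP: zP => k kr ->; rewrite !f2P // => /eqP.
  rewrite nth_uniq ?sfull ?ltnS ?leq_subr // => /eqP jk.
  by have -> : j = k by move: jr kr jk; clear; lia.
- by move=> x xR; rewrite f2E ?(emb_root emb) // (subsetP RE).
- move=> i'; rewrite !inE => /orP[pE|piP]; first by rewrite f2E ?(emb_target emb).
  case: (eqVneq i' i) => [->//|i'i]; by have := P'i i' 0 isT i'i; rewrite piP.
- move=> x; rewrite !inE => /orP[xE|xP] xR xt; first by rewrite f2E ?(emb_new emb).
  have : f2 x != w i.
    case/PP: xP xt => j jr -> xt; rewrite f2P //.
    have j0 : 0 < j by rewrite lt0n; apply: contraNneq xt => ->; apply: imset_f.
    rewrite /full nth_rcons sq; have lt : rho1 - j < rho1 by move: j0 jr; clear; lia.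
    by rewrite lt; apply: contraTneq wiA' => <-; apply: qA; rewrite mem_nth ?sq.
  case: (fullP _ (f2full x xP)) => [->|xA _]; first by rewrite eqxx.
  by apply: contra xA; apply: (subsetP AA').
(* The link uses [rho1] new vertices, as many as the segment has apart from the target [p i], which
   was not counted. *)
- apply: leq_trans (emb_room emb); rewrite leq_add2r card_setU_seq // sq -addnA leq_add2l.
  have cP : #|P| = rho1.+1.
    rewrite card_imset ?card_ord // => j k jk; apply/val_inj.
    have jr : j <= rho1 by rewrite -ltnS.
    have kr : k <= rho1 by rewrite -ltnS.
    by have := dep_anc i jr; rewrite (dep_anc i kr) jk => /addnI/esym.
  have cPi : #|P :\ p i| = rho1 by have := cardsD1 (p i) P; rewrite Ppi cP; clear; lia.
  rewrite -{1}cPi -(cardsUI (P :\ p i)) (_ : _ :&: _ = set0) ?cards0 ?addn0; last first.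
    apply/setP=> x; rewrite !inE !negb_or; apply/negP=> /andP[/andP[_ xP]].
    by rewrite xP andbF.
  apply: subset_leq_card; apply/subsetP=> x; rewrite !inE !negb_or.
  case/orP=> [/andP[xpi xP]|/andP[/andP[/andP[-> _] ->] ->]] //.
  have := PS x xP; rewrite inE => /andP[_ ->]; rewrite andbT.
  apply/andP; split; first by apply: contraTN xP; apply: PE.
  by apply: contra xpi => xt; rewrite (Pt x xP xt).
- move=> x; rewrite !inE => /orP[xE|xP].
    rewrite f2E //; have := emb_cap emb xE.
    case: (eqVneq x u) => [xu|xu].
      have -> : r2 (f x) = r' (f u) - 1.
        rewrite xu /r2 eqxx (negbTE wu) subn0.
        by case: ifP => // /qA; rewrite fA'.
      rewrite xu (cardsD1 (anc i rho1)) !inE topE -iterS eqxx.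
      move: topS; rewrite !inE => /andP[-> ->] /= H.
      rewrite leq_subRL //; apply: leq_trans H; rewrite leq_add2l; apply: subset_leq_card.
      apply/subsetP=> z; rewrite !inE negb_or => /andP[/andP[-> zP] ->]; rewrite !andbT.
      by apply: contraNneq zP => ->; apply/PP; exists rho1.
    rewrite r2old ?fA' //.
    + apply: leq_trans; apply: subset_leq_card.
      by apply/subsetP=> z; rewrite !inE negb_or => /andP[/andP[-> _] ->].
    + by apply: contraNneq xu => /(emb_inj emb xE uE)->.
    + by apply: contraNneq (target_free emb piE) => <-; apply: imset_f.
  apply: leq_trans (_ : Delta <= _).
    by apply: leq_trans (kids_le x); apply: subset_leq_card; apply: subsetDl.
  have := f2full x xP; rewrite mem_rcons inE => /orP[/eqP->|xq]; last by rewrite /r2 xq.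
  rewrite /r2; case: ifP => [/qA|_]; first by rewrite wiA'.
  rewrite eqxx eq_sym (negbTE wu) subn0 leq_subRL //.
  exact: (emb_wcap emb).
- move=> i'; rewrite !inE negb_or => /andP[pE piP].
  rewrite r2old ?(emb_wcap emb) // ?(subsetP AA') //.
    by apply: contraNneq (target_free emb pE) => ->; apply: imset_f.
  by apply: contraNneq piP => /w_inj->.
Qed.

Hypothesis state0 : state e M K A r.
Hypothesis root_cap : {in Rt, forall v, Delta <= r (f0 v)}.
Hypothesis target_cap : forall i, Delta < r (w i).
Hypothesis room0 : #|A| + #|S :\: (Rt :|: targets)| + room <= #|V|.

(** Take an unplaced vertex of least depth; its parent is placed. If it lies on a segment, it is the
    top vertex, for otherwise its parent would be a placed vertex of an unplaced segment, against
    [emb_anc]. The whole segment is then linked to its target. *)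
Lemma embed_forest : exists f : T -> V, [/\ {in S &, injective f}, {in Rt, f =1 f0},
  forall i, f (p i) = w i, {in S :\: Rt, forall v, e (f (par v)) (f v)}
  & {in S, forall v, v \notin Rt -> v \notin targets -> f v \notin A}].
Proof.
have piR i j : j <= rho1 -> (anc i j \in Rt) = false.
  by move=> jr; have := anc_S i jr; rewrite inE => /andP[/negbTE].
have emb0 : embedded Rt A r f0.
  split=> //; first by move=> v; rewrite setDv inE.
  - by move=> i j jr; rewrite !(piR i) ?(piR i 0).
  - by move=> i piRt; rewrite (piR i 0) in piRt.
  - by move=> v ->.
  - move=> v vR; apply: leq_trans (root_cap vR); apply: leq_trans (kids_le v).
    by apply: subset_leq_card; apply: subsetDl.
suff fin E A' r' f : embedded E A' r' f -> exists A2 r2 f2, embedded S A2 r2 f2.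
  have [A2 [r2 [f2 emb]]] := fin _ _ _ _ emb0; exists f2; split.
  - exact: (emb_inj emb).
  - exact: (emb_root emb).
  - by move=> i; apply: (emb_target emb); have := @anc_S i 0 isT; rewrite inE => /andP[].
  - by move=> v vS; have [] := emb_par emb vS.
  - exact: (emb_new emb).
have [n] := ubnP #|S :\: E|; elim: n E A' r' f => // n IH E A' r' f; rewrite ltnS => nE emb.
have [ES0|[v0 v0E]] := set_0Vmem (S :\: E).
  have <- : E = S; last by exists A', r', f.
  by apply/eqP; rewrite eqEsubset (emb_sub emb).2 -setD_eq0 ES0 eqxx.
suff [E2 [A2 [r2 [f2 [EE2 emb2]]]]] : exists (E2 : {set T}) A2 r2 f2, E \proper E2 /\ embedded E2 A2 r2 f2.
  apply: (IH E2 A2 r2 f2 _ emb2); apply: leq_trans nE.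
  have [_ [z zE2 zE]] := properP EE2; apply: proper_card; apply/properP; split; first exact/setDS/proper_sub.
  by exists z; rewrite !inE ?zE ?zE2 ?(subsetP (emb_sub emb2).2).
case: (arg_minnP dep v0E) => v vE vmin.
have {}vE : v \in S :\: E := vE.
have {}vmin x : x \in S :\: E -> dep v <= dep x := vmin x.
have vS : v \in S :\: Rt.
  move: vE; rewrite !inE => /andP[vE ->]; rewrite andbT.
  by apply: contra vE; apply: (subsetP (emb_sub emb).1).
have uE : par v \in E.
  apply: contraT => uE; have := vmin (par v); rewrite inE uE par_S // => /(_ isT).
  by rewrite (par_dep vS) ltnn.
case: (boolP [exists i, exists j : 'I_rho1.+1, v == anc i j]) => [|vanc].
  case/existsP=> i /existsP[j /eqP vj].
  have jr : j <= rho1 by rewrite -ltnS.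
  have piE : p i \notin E by rewrite -(emb_anc emb i jr) -vj; move: vE; rewrite inE => /andP[].
  have jr1 : j = rho1 :> nat.
    apply/eqP; rewrite eqn_leq jr leqNgt; apply/negP=> jr'.
    by case/negP: piE; rewrite -(emb_anc emb i jr') iterS -vj.
  by apply: (embed_path emb piE); rewrite iterS -jr1 -vj.
have [|A2 [r2 [f2 emb2]]] := embed_leaf emb vE uE.
  move=> i j jr; apply: contra vanc => /eqP vj.
  by apply/existsP; exists i; apply/existsP; exists (Ordinal (jr : j < rho1.+1)); rewrite vj.
exists (v |: E), A2, r2, f2; split=> //.
apply/properP; split; first exact: subsetUr.
by exists v; [exact: setU11 | move: vE; rewrite inE => /andP[]].
Qed.

End Embedding.

(** * Random colourings *)

Lemma leq_expl k m n : m <= n -> m ^ k <= n ^ k.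
Proof. by case: k => // k mn; rewrite leq_exp2r. Qed.

Lemma card_bigcup_le (T J : finType) (P : pred J) (F : J -> {set T}) :
  #|\bigcup_(j | P j) F j| <= \sum_(j | P j) #|F j|.
Proof.
elim/big_rec2: _ => [|j k B _ le]; first by rewrite cards0.
by apply: leq_trans (leq_card_setU _ _).1 _; rewrite leq_add2l.
Qed.

Lemma bin_le_exp n k : 'C(n, k) <= n ^ k.
Proof.
elim: k n => [|k IH] n; first by rewrite bin0.
case: n => [|n]; first by rewrite bin0n.
rewrite -(leq_pmul2l (ltn0Sn k)) -mul_bin_diag; apply: leq_trans (_ : n.+1 * n ^ k <= _).
  by rewrite leq_mul2l IH.
rewrite expnS -[X in X <= _]mul1n; apply: leq_mul => //.
by rewrite leq_mul2l leq_expl // orbT.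
Qed.

(** Bernoulli's inequality gives [(1 + 1/a)^(a+1) >= 2]. With [a = 2R - 1], the bound of
    [few_colorings] is halved for every [2R] vertices of [S]. *)
Lemma double_exp_le a g : 2 ^ g * a ^ (a.+1 * g) <= a.+1 ^ (a.+1 * g).
Proof.
have [->|a_gt0] := posnP a; first by case: g => // g; rewrite exp0n // muln0.
have bern k : (a + k) * a ^ k <= a * a.+1 ^ k.
  elim: k => [|k IH]; first by rewrite addn0 !expn0.
  rewrite !expnS; apply: leq_trans (_ : a.+1 * ((a + k) * a ^ k) <= _).
    by rewrite !mulnA leq_mul2r; apply/orP; right; clear; nia.
  by rewrite [X in _ <= X]mulnCA leq_mul2l IH orbT.
rewrite !expnM -expnMn; apply: leq_expl.
rewrite -(leq_pmul2l a_gt0); apply: leq_trans (bern a.+1).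
by rewrite mulnA leq_mul2r; apply/orP; right; clear; nia.
Qed.

(* Double counting with weight [2] for each vertex of [S] not coloured [i]. *)
Lemma few_colorings (V : finType) R (S : {set V}) (i : 'I_R) q :
  #|[set c : {ffun V -> 'I_R} | #|[set v in S | c v == i]| < q]| * 2 ^ #|S| <=
  2 ^ q * ((2 * R).-1 ^ #|S| * R ^ (#|V| - #|S|)).
Proof.
have R_gt0 : 0 < R by case: i => i; apply: leq_ltn_trans.
pose wt v (j : 'I_R) := if v \in S then (if j == i then 1 else 2) else 1.
have -> : (2 * R).-1 ^ #|S| * R ^ (#|V| - #|S|) =
    \sum_(c : {ffun V -> 'I_R}) \prod_v wt v (c v).
  rewrite -bigA_distr_bigA /= (bigID (mem S)) /=; congr (_ * _).
    rewrite -prod_nat_const; apply: eq_bigr => v vS.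
    rewrite (bigD1 i) //= /wt vS eqxx (eq_bigr (fun=> 2)); last by move=> j /negbTE->.
    rewrite sum_nat_const; have := cardC1 i; rewrite card_ord.
    have -> : #|[pred j | j != i]| = #|predC1 i| by apply: eq_card => j; rewrite !inE.
    by move=> ->; move: R_gt0; clear; lia.
  have -> : #|V| - #|S| = #|[pred v | v \notin S]|.
    have := cardC S; rewrite (eq_card (_ : [predC S] =i [pred v | v \notin S])) //; clear; lia.
  rewrite -prod_nat_const; apply: eq_bigr => v vS.
  by rewrite /wt (negbTE vS) sum1_card card_ord.
have wtE (c : {ffun V -> 'I_R}) : \prod_v wt v (c v) = 2 ^ #|[set v in S | c v != i]|.
  rewrite (bigID (mem [set v in S | c v != i])) /= (eq_bigr (fun=> 2)); last first.
    by move=> v; rewrite inE /wt => /andP[-> /negbTE->].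
  rewrite prod_nat_const big1 ?muln1 // => v; rewrite inE negb_and negbK /wt.
  by case: (v \in S) => //= ->.
rewrite big_distrr /= -sum_nat_const [X in _ <= X](bigID (mem [set c : {ffun V -> 'I_R} | #|[set v in S | c v == i]| < q])) /=.
apply: leq_trans (leq_addr _ _); apply: leq_sum => c; rewrite inE => cq.
rewrite wtE -expnD leq_exp2l //.
have <- : #|[set v in S | c v == i]| + #|[set v in S | c v != i]| = #|S|.
  rewrite -(cardsID [set v | c v == i] S); congr (_ + _).
    by apply: eq_card => v; rewrite !inE.
  by apply: eq_card => v; rewrite !inE andbC.
by rewrite leq_add2r ltnW.
Qed.

(** Union bound. For [X] of size [x] and one colour, [few_colorings] leaves at most
    [R ^ n / (n ^ x * (n * R + 1))] bad colourings. There are at most [n ^ x] such sets, [R] colours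
    and [n] sizes, and [n * R < n * R + 1]. *)
Lemma expanding_coloring (V : finType) (N : {set V} -> {set V}) R m t g :
  0 < R -> 0 < #|V| ->
  (forall X : {set V}, 0 < #|X| < m -> 2 * R * g * #|X| <= #|N X|) ->
  2 ^ t * (#|V| * (#|V| * R).+1) <= 2 ^ g ->
  exists c : {ffun V -> 'I_R}, forall (X : {set V}) i, 0 < #|X| < m ->
    t * #|X| <= #|[set v in N X | c v == i]|.
Proof.
set n := #|V|; move=> R_gt0 n_gt0 NX gt.
pose bad (X : {set V}) i := [set c : {ffun V -> 'I_R} | #|[set v in N X | c v == i]| < t * #|X|].
pose small (X : {set V}) := 0 < #|X| < m.
have badX X i : small X -> #|bad X i| * (n ^ #|X| * (n * R).+1) <= R ^ n.
  move=> sX; have := few_colorings (N X) i (t * #|X|); rewrite -/(bad X i) -/n.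
  have := NX X sX; set x := #|X|; set b := #|bad X i|; set s := #|N X| => xs H.
  have sn : s <= n by apply: max_card.
  have x_gt0 : 0 < x by case/andP: sX.
  have E1 : b * 2 ^ (g * x) <= 2 ^ (t * x) * R ^ n.
    have [k sE] : exists k, s = 2 * R * (g * x) + k.
      by exists (s - 2 * R * (g * x)); rewrite subnKC // mulnA.
    have D : 2 ^ (g * x) * (2 * R).-1 ^ s <= (2 * R) ^ s.
      rewrite sE !expnD mulnA leq_mul ?leq_expl ?leq_pred //.
      have := double_exp_le (2 * R).-1 (g * x).
      by rewrite prednK ?muln_gt0.
    rewrite -(leq_pmul2r (expn_gt0 2 s : 0 < 2 ^ s)) //.
    apply: leq_trans (_ : 2 ^ (t * x) * ((2 * R).-1 ^ s * R ^ (n - s)) * 2 ^ (g * x) <= _).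
      by rewrite mulnAC leq_mul2r H orbT.
    apply: leq_trans (_ : 2 ^ (t * x) * ((2 * R) ^ s * R ^ (n - s)) <= _).
      rewrite -!mulnA leq_mul2l; apply/orP; right.
      by rewrite mulnCA [X in _ <= X]mulnC leq_mul2l [_ * 2 ^ _]mulnC D orbT.
    by rewrite expnMn -mulnA -expnD subnKC // mulnCA mulnC.
  have E2 : 2 ^ (t * x) * (n * (n * R).+1) ^ x <= 2 ^ (g * x).
    by rewrite !expnM -expnMn leq_expl.
  rewrite -(leq_pmul2l (expn_gt0 2 (t * x) : 0 < 2 ^ (t * x))) //.
  apply: leq_trans E1; rewrite mulnCA leq_mul2l; apply/orP; right.
  apply: leq_trans E2; rewrite leq_mul2l expnMn; apply/orP; right.
  rewrite leq_mul2l -{1}[_.+1]expn1 leq_exp2l ?x_gt0 ?orbT // ltnS.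
  by rewrite muln_gt0 n_gt0.
case: (pickP [pred c : {ffun V -> 'I_R} | [forall X, forall i, small X ==> (c \notin bad X i)]]).
  move=> c /forallP cX; exists c => X i sX.
  by have := cX X => /forallP/(_ i)/implyP/(_ sX); rewrite inE -leqNgt.
move=> all_bad; exfalso.
have cov : R ^ n <= \sum_(X | small X) \sum_i #|bad X i|.
  have <- : #|{ffun V -> 'I_R}| = R ^ n by rewrite card_ffun card_ord.
  apply: leq_trans (_ : #|\bigcup_(X | small X) \bigcup_i bad X i| <= _).
    apply: subset_leq_card; apply/subsetP=> c _; have := all_bad c.
    move/negbT/forallPn=> [X /forallPn[i]]; rewrite negb_imply negbK => /andP[sX cX].
    by apply/bigcupP; exists X => //; apply/bigcupP; exists i.
  by apply: leq_trans (card_bigcup_le _ _) _; apply: leq_sum => X _; apply: card_bigcup_le.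
suff : (\sum_(X | small X) \sum_i #|bad X i|) * (n * R).+1 <= n * (R * R ^ n).
  have Rn : 0 < R ^ n by rewrite expn_gt0 R_gt0.
  move: cov Rn; set b := \sum_(X | _) _; clear; nia.
rewrite (partition_big (fun X : {set V} => inord #|X| : 'I_n.+1) predT) //= big_ord_recl.
rewrite [X in X + _]big1 ?add0n; last first.
  move=> X /andP[/andP[x_gt0 _] /eqP/(congr1 val)]; rewrite /= inordK ?ltnS ?max_card // => x0.
  by rewrite x0 in x_gt0.
have -> : n * (R * R ^ n) = \sum_(j < n) R * R ^ n by rewrite sum_nat_const card_ord.
rewrite big_distrl /=.
apply: leq_sum => j _; set J := lift ord0 j.
have Jn : 0 < n ^ J by rewrite expn_gt0 n_gt0.
rewrite -(leq_pmul2l Jn) mulnA big_distrr /= big_distrl /=.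
apply: leq_trans (_ : \sum_(X : {set V} | #|X| == J) R * R ^ n <= _).
  rewrite [X in _ <= X](bigID small) /=; apply: leq_trans (leq_addr _ _).
  rewrite [X in _ <= X](eq_bigl (fun X => small X && (inord #|X| == J :> 'I_n.+1))); last first.
    move=> X; rewrite andbC; congr (_ && _).
    by rewrite -val_eqE /= inordK // ltnS max_card.
  apply: leq_sum => X /andP[sX /eqP/(congr1 val)]; rewrite /= inordK ?ltnS ?max_card // => cX.
  have -> : R * R ^ n = \sum_(i < R) R ^ n by rewrite sum_nat_const card_ord.
  rewrite big_distrr /= big_distrl /=.
  have {}cX : #|X| = J := cX.
  by apply: leq_sum => i _; have := badX X i sX; rewrite cX mulnA [_ * n ^ J]mulnC.
rewrite sum_nat_const leq_mul2r; apply/orP; right.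
by apply: leq_trans (bin_le_exp n J); rewrite -card_draws cardsE.
Qed.

(** * Rooted trees *)

(** Greedy choice: a chosen segment has at most [k] points, each in at most [c] good segments, so it
    blocks at most [k * c] candidates. *)
Lemma disjoint_family (I A T : finType) (seg : A -> {set T}) (good : {set A}) k c :
  (forall a, a \in good -> #|seg a| <= k) ->
  (forall y, #|[set a in good | y \in seg a]| <= c) ->
  #|I| * (k * c) < #|good| ->
  exists f : I -> A, (forall i, f i \in good) /\
    forall i j y, y \in seg (f i) -> y \in seg (f j) -> i = j.
Proof.
move=> segk segc cI.
suff [s [sI sg sd]] : exists s : seq A, [/\ size s = #|I|, {subset s <= good} &
    forall a0 i j y, i < size s -> j < size s -> y \in seg (nth a0 s i) -> y \in seg (nth a0 s j) -> i = j].
  have /card_gt0P[a0 _] : 0 < #|good| by apply: leq_ltn_trans cI.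
  exists (fun i => nth a0 s (enum_rank i)); split=> [i|i j y yi yj].
    by apply/sg/mem_nth; rewrite sI ltn_ord.
  by apply/enum_rank_inj/val_inj; apply: (sd a0 _ _ y) => //; rewrite sI ltn_ord.
have : #|I| <= #|I| by []; elim: {-2}#|I| => [|n IH] nI; first by exists [::].
have [s [sn sg sd]] := IH (ltnW nI).
pose blocked := \bigcup_(a in s) \bigcup_(y in seg a) [set b in good | y \in seg b].
have cb : #|blocked| <= n * (k * c).
  apply: leq_trans (card_bigcup_le _ _) _.
  apply: leq_trans (_ : \sum_(a in s) k * c <= _).
    apply: leq_sum => a ain; apply: leq_trans (card_bigcup_le _ _) _.
    apply: leq_trans (_ : \sum_(y in seg a) c <= _); first by apply: leq_sum => y _; apply: segc.
    by rewrite sum_nat_const leq_mul2r segk ?orbT // sg.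
  by rewrite sum_nat_const leq_mul2r -sn card_size orbT.
have /subsetPn[b bg bb] : ~~ (good \subset blocked).
  apply/negP=> /subset_leq_card; rewrite leqNgt => /negP[]; apply: leq_ltn_trans cb _.
  by apply: leq_ltn_trans cI; rewrite leq_mul2r ltnW ?orbT.
have free i y a0 : i < n -> y \in seg (nth a0 s i) -> y \notin seg b.
  move=> ni yi; apply: contra bb => yb; apply/bigcupP; exists (nth a0 s i); first by rewrite mem_nth ?sn.
  by apply/bigcupP; exists y => //; rewrite inE bg.
exists (rcons s b); split.
- by rewrite size_rcons sn.
- by move=> a; rewrite mem_rcons inE => /orP[/eqP->//|/sg].
- move=> a0 i j y; rewrite size_rcons sn !nth_rcons sn !ltnS.
  case: (ltngtP i n) => // [ni|ni] _; case: (ltngtP j n) => // [nj|nj] _.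
  + by apply: sd; rewrite sn.
  + by move=> /(free _ _ _ ni)/negbTE->.
  + by move=> yb /(free _ _ _ nj); rewrite yb.
  + by rewrite ni nj.
Qed.

(** [dep] is the distance from [r], and [par] picks a neighbour one step closer. Parent edges
    already connect everything, so any other edge would close a cycle with a path of parent edges
    between its ends. *)
Lemma rooted_tree (T : finType) (e : rel T) (r : T) : symmetric e -> irreflexive e ->
  (forall x y, connect e x y) -> (forall c, ucycle e c -> size c < 3) ->
  exists (par : T -> T) (dep : T -> nat), [/\ dep r = 0,
    forall v, v != r -> e (par v) v /\ dep v = (dep (par v)).+1 &
    forall x y, e x y -> x != r /\ y = par x \/ y != r /\ x = par y].
Proof.
move=> e_sym e_irr conn acyc.
pose P v n := [exists p : n.-tuple T, path e r p && (last r p == v)].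
have exP v : exists n, P v n.
  have /connectP[p pp lp] := conn r v; exists (size p); apply/existsP; exists (in_tuple p).
  by rewrite pp lp eqxx.
pose dep v := ex_minn (exP v).
have depP v : exists p, [/\ path e r p, last r p = v & size p = dep v].
  rewrite /dep; case: ex_minnP => n /existsP[p /andP[pp /eqP lp]] _.
  by exists p; rewrite size_tuple.
have dep_le v p : path e r p -> last r p = v -> dep v <= size p.
  move=> pp lp; rewrite /dep; case: ex_minnP => n _; apply.
  by apply/existsP; exists (in_tuple p); rewrite pp lp eqxx.
have ex_par v : v != r -> exists u, e u v && (dep v == (dep u).+1).
  move=> vr; have [p [pp lp sp]] := depP v.
  case: (lastP p) pp lp sp => [_ /= E|q x]; first by rewrite E eqxx in vr.
  rewrite rcons_path last_rcons size_rcons => /andP[pq eq] xv sq; subst x.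
  exists (last r q); rewrite eq eqn_leq -{2}sq ltnS dep_le //= andbT.
  have [p2 [pp2 lp2 <-]] := depP (last r q).
  rewrite -(size_rcons p2 v); apply: dep_le; last by rewrite last_rcons.
  by rewrite rcons_path pp2 lp2.
pose par v := odflt v [pick u | e u v && (dep v == (dep u).+1)].
have parP v : v != r -> e (par v) v /\ dep v = (dep (par v)).+1.
  move=> /ex_par[u uP]; rewrite /par; case: pickP => [w /andP[-> /eqP]//|/(_ u)].
  by rewrite uP.
exists par, dep; split=> //.
  by apply/eqP; rewrite -leqn0; apply: (dep_le r [::]).
pose e' x y := (x != r) && (y == par x) || (y != r) && (x == par y).
have e'e x y : e' x y -> e x y.
  by case/orP=> /andP[/parP[+ _] /eqP->] //; rewrite e_sym.
have e'_sym : symmetric e' by move=> x y; rewrite /e' orbC.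
have conn_r v : connect e' v r.
  have [n] := ubnP (dep v); elim: n v => // n IH v; rewrite ltnS => vn.
  have [->|vr] := eqVneq v r; first exact: connect0.
  have [_ dv] := parP v vr; apply: connect_trans (connect1 _) (IH (par v) _).
    by rewrite /e' vr eqxx.
  by rewrite -dv.
move=> x y exy; suff : e' x y.
  by case/orP=> /andP[? /eqP]; [left|right].
apply: contraT => ne'.
have : connect e' x y.
  by apply: connect_trans (conn_r x) _; rewrite (sym_connect_sym e'_sym).
case/connectP=> p0 /shortenP[p pp up _] lp.
have /acyc : ucycle e (x :: p).
  by rewrite /ucycle up andbT /= rcons_path (sub_path e'e pp) /= -lp e_sym.
case: p pp up lp => [_ _ /= yx|z [|z' p]] //=; first by rewrite yx e_irr in exy.
by move=> /andP[e'xz _] _ yz _; case/negP: ne'; rewrite yz.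
Qed.

Section RootedTree.
Variables (T : finType) (r : T) (par : T -> T) (dep : T -> nat) (Delta : nat).
Hypothesis dep_r : dep r = 0.
Hypothesis dep_par : forall v, v != r -> dep v = (dep (par v)).+1.

(** [par r] is arbitrary, so the root is excluded by hand; likewise [card_descendants] bounds [j] by
    [dep v]. *)
Definition children v := [set c | (c != r) && (par c == v)].
Definition leaves := [set v | children v == set0].

Hypothesis children_le : forall v, #|children v| <= Delta.

Lemma dep_gt0 v : 0 < dep v -> v != r.
Proof. by apply: contraTneq => ->; rewrite dep_r. Qed.

Lemma dep_iter j v : j <= dep v -> dep (iter j par v) + j = dep v.
Proof.
elim: j => [|j IH] jv; first by rewrite addn0.
have E := IH (ltnW jv); rewrite -{}E in jv *.
by rewrite addnS -addSn /= -dep_par // dep_gt0 //; move: jv; clear; lia.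
Qed.

Lemma iter_dep v : iter (dep v) par v = r.
Proof.
apply/eqP; apply: contraT => /dep_par; have := dep_iter (leqnn (dep v)); clear; lia.
Qed.

Lemma card_descendants j y : #|[set v | (j <= dep v) && (iter j par v == y)]| <= Delta ^ j.
Proof.
elim: j => [|j IH].
  rewrite (_ : [set v | _] = [set y]) ?cards1 //.
  by apply/setP=> v; rewrite !inE.
apply: leq_trans (_ : #|\bigcup_(u in [set v | (j <= dep v) && (iter j par v == y)]) children u| <= _).
  apply: subset_leq_card; apply/subsetP=> v; rewrite inE iterSr => /andP[jv vy].
  have vr : v != r by apply: dep_gt0; apply: leq_trans jv.
  apply/bigcupP; exists (par v); rewrite inE ?vr ?eqxx //.
  by rewrite vy andbT -ltnS -dep_par.
apply: leq_trans (card_bigcup_le _ _) _.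
apply: leq_trans (_ : \sum_(u in [set v | (j <= dep v) && (iter j par v == y)]) Delta <= _).
  by apply: leq_sum.
by rewrite sum_nat_const expnS mulnC leq_mul2l IH orbT.
Qed.

Definition up_path l v := [set iter j par v | j : 'I_l.+1].

Lemma up_pathP l v y : reflect (exists2 j, j <= l & y = iter j par v) (y \in up_path l v).
Proof.
apply: (iffP imsetP) => [[j _ ->]|[j jl ->]]; first by exists j; rewrite // -ltnS.
by exists (Ordinal (jl : j < l.+1)).
Qed.

Lemma card_up_path l v : #|up_path l v| <= l.+1.
Proof. by apply: leq_trans (leq_imset_card _ _) _; rewrite card_ord. Qed.

Lemma card_above l (P : {set T}) (c : nat) y :
  (forall j, j <= l -> #|[set v in P | iter j par v == y]| <= c) ->
  #|[set v in P | y \in up_path l v]| <= l.+1 * c.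
Proof.
move=> Pc; apply: leq_trans (_ : \sum_(j < l.+1) #|[set v in P | iter j par v == y]| <= _).
  apply: leq_trans (_ : #|\bigcup_(j < l.+1) [set v in P | iter j par v == y]| <= _).
    apply: subset_leq_card; apply/subsetP=> v; rewrite inE => /andP[vP /up_pathP[j jl yj]].
    by apply/bigcupP; exists (Ordinal (jl : j < l.+1)) => //; rewrite inE vP yj eqxx.
  exact: card_bigcup_le.
apply: leq_trans (_ : \sum_(j < l.+1) c <= _); last by rewrite sum_nat_const card_ord.
by apply: leq_sum => j _; apply: Pc; rewrite -ltnS.
Qed.

Hypothesis Delta_gt0 : 0 < Delta.

(** A vertex has at most [Delta ^ j] descendants [j] levels down, so it lies on at most
    [l.+1 * Delta ^ l] segments of [l.+1] vertices. The [+ 1] pays for the vertices of depth at most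
    [l], counted as descendants of [r]. *)
Lemma separated_family (I : finType) (P : {set T}) l :
  (#|I| * l.+1 + 1) * (l.+1 * Delta ^ l) < #|P| ->
  exists f : I -> T, (forall i, f i \in P /\ l < dep (f i)) /\
    forall i j k k', k <= l -> k' <= l -> iter k par (f i) = iter k' par (f j) -> i = j.
Proof.
move=> cP; pose good := [set v in P | l < dep v].
have desc j y : j <= l -> #|[set v in P | (j <= dep v) && (iter j par v == y)]| <= Delta ^ l.
  move=> jl; apply: leq_trans (_ : Delta ^ j <= _); last by rewrite leq_pexp2l.
  apply: leq_trans (card_descendants j y); apply: subset_leq_card.
  by apply/subsetP=> v; rewrite !inE => /andP[].
have cgood : #|I| * (l.+1 * (l.+1 * Delta ^ l)) < #|good|.
  have cbad : #|[set v in P | dep v <= l]| <= l.+1 * Delta ^ l.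
    apply: leq_trans (_ : \sum_(j < l.+1) #|[set v in P | (j <= dep v) && (iter j par v == r)]| <= _).
      apply: leq_trans (_ : #|\bigcup_(j < l.+1) [set v in P | (j <= dep v) && (iter j par v == r)]| <= _).
        apply: subset_leq_card; apply/subsetP=> v; rewrite inE => /andP[vP vl].
        by apply/bigcupP; exists (Ordinal (vl : dep v < l.+1)) => //; rewrite inE vP leqnn iter_dep eqxx.
      exact: card_bigcup_le.
    apply: leq_trans (_ : \sum_(j < l.+1) Delta ^ l <= _); last by rewrite sum_nat_const card_ord.
    by apply: leq_sum => j _; apply: desc; rewrite -ltnS.
  have : #|good| + #|[set v in P | dep v <= l]| = #|P|.
    rewrite -(cardsID [set v | l < dep v] P); congr (_ + _).
      by apply: eq_card => v; rewrite !inE.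
    by apply: eq_card => v; rewrite !inE andbC -leqNgt.
  move: cP cbad; rewrite mulnDl mul1n -mulnA; clear; lia.
have [||f [fg fd]] := disjoint_family (seg := up_path l) (good := good) _ _ cgood.
- by move=> v _; apply: card_up_path.
- move=> y; apply: card_above => j jl; apply: leq_trans (desc j y jl).
  apply: subset_leq_card; apply/subsetP=> v; rewrite !inE => /andP[/andP[-> lv] ->].
  by rewrite andbT /= ltnW // (leq_ltn_trans jl).
exists f; split=> [i|i j k k' kl k'l E]; first by have := fg i; rewrite inE => /andP[].
apply: (fd i j (iter k par (f i))); first by apply/up_pathP; exists k.
by apply/up_pathP; exists k'.
Qed.

(** Only the [l] vertices above [v] must not branch. [v] itself may: it becomes the root of what
    hangs below the path. *)
Definition bare l v := (l < dep v) && [forall j : 'I_l, #|children (iter j.+1 par v)| <= 1].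

Lemma chain_inj j v v' :
  (forall k, k < j -> [/\ iter k par v != r, iter k par v' != r & #|children (iter k.+1 par v)| <= 1]) ->
  iter j par v = iter j par v' -> v = v'.
Proof.
elim: j => // j IH H E; apply: IH => [k kj|]; first exact/H/ltnW.
have [vr v'r /card_le1_eqP one] := H j (ltnSn j).
have E' : par (iter j par v) = par (iter j par v') := E.
by apply/one; rewrite inE /= ?vr ?v'r -?E' eqxx.
Qed.

Lemma sum_children : (\sum_v #|children v|).+1 = #|T|.
Proof.
rewrite (cardD1 r) inE /= add1n; congr _.+1.
apply/esym; rewrite -sum1_card (partition_big par predT) //=; apply: eq_bigr => v _.
by rewrite -sum1_card; apply: eq_bigl => c; rewrite !inE andbT.
Qed.

(** The number of children minus one sums to [-1] over the tree, so over the branching vertices it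
    sums to one less than the number of leaves. A branching vertex has at most twice as many
    children as this excess. *)
Lemma card_stops : #|[set c | (c == r) || (1 < #|children (par c)|)]| <= 2 * #|leaves|.
Proof.
pose B := [set v | 1 < #|children v|].
have cB : #|[set c | (c == r) || (1 < #|children (par c)|)]| <= (\sum_(v in B) #|children v|).+1.
  apply: leq_trans (_ : #|r |: \bigcup_(v in B) children v| <= _).
    apply: subset_leq_card; apply/subsetP=> c; rewrite !inE; case: eqP => //= cr pc.
    by apply/bigcupP; exists (par c); rewrite !inE ?eqxx ?andbT //; apply/eqP.
  apply: leq_trans (leq_card_setU _ _).1 _; rewrite cards1 add1n ltnS.
  exact: card_bigcup_le.
have cT : #|B| + \sum_(v | v \notin B) 1 = #|T|.
  by rewrite -sum1_card -[RHS]sum1_card [RHS](bigID (mem B)).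
have := sum_children; rewrite (bigID (mem B)) /= -cT.
have : 2 * #|B| <= \sum_(v in B) #|children v|.
  by rewrite mulnC -sum_nat_const; apply: leq_sum => v; rewrite inE.
have : \sum_(v | v \notin B) #|children v| + #|leaves| = \sum_(v | v \notin B) 1.
  rewrite [X in _ = X](bigID (mem leaves)) /= addnC -sum1_card; congr (_ + _).
    apply: eq_bigl => v; rewrite !inE.
    by case: (eqVneq (children v) set0) => [->|_]; rewrite ?cards0 ?andbF.
  rewrite (bigID (mem leaves)) /= big1 ?add0n => [|v].
    by apply: eq_bigr => v; rewrite !inE -cards_eq0; case: #|children v| => [|[|k]].
  by rewrite !inE => /andP[_ /eqP->]; rewrite cards0.
move: cB; clear; lia.
Qed.

(** Climbing from a vertex that is not bare meets a first stop, the root or a child of a branching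
    vertex, within [l] steps. Up to the first stop the climb is injective by [chain_inj], so each
    distance accounts for at most one vertex per stop. *)
Lemma card_bare l : #|T| <= #|[set v | bare l v]| + l.+1 * (2 * #|leaves|).
Proof.
rewrite -(cardsC [set v | bare l v]) leq_add2l.
pose stop c := (c == r) || (1 < #|children (par c)|).
have ex_stop v : v \notin [set v | bare l v] -> exists j, (j <= l) && stop (iter j par v).
  rewrite inE negb_and -leqNgt => /orP[vl|/forallPn[j]].
    by exists (dep v); rewrite vl iter_dep /stop eqxx.
  by rewrite -ltnNge => H; exists j; rewrite ltnW // /stop H orbT.
pose D j := [set v | stop (iter j par v) & [forall k : 'I_j, ~~ stop (iter k par v)]].
have DE j v : (v \in D j) = stop (iter j par v) && [forall k : 'I_j, ~~ stop (iter k par v)] by rewrite inE.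
have cD j : #|D j| <= 2 * #|leaves|.
  apply: leq_trans card_stops; rewrite -(card_in_imset (f := iter j par)).
    apply: subset_leq_card; apply/subsetP=> c /imsetP[v]; rewrite DE => /andP[sv _] ->.
    by rewrite inE.
  move=> v v'; rewrite !DE => /andP[_ /forallP nv] /andP[_ /forallP nv'].
  apply: chain_inj => k kj.
  have := nv (Ordinal kj); have := nv' (Ordinal kj); rewrite /stop /= !negb_or -!leqNgt.
  by case/andP=> v'r _ /andP[vr ->].
apply: leq_trans (_ : #|\bigcup_(j < l.+1) D j| <= _).
  apply: subset_leq_card; apply/subsetP=> v; rewrite in_setC => /ex_stop exj.
  case: (ex_minnP exj) => j /andP[jl sj] jmin.
  apply/bigcupP; exists (Ordinal (jl : j < l.+1)) => //; rewrite DE sj /=.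
  apply/forallP=> k; apply/negP=> sk; have := jmin k; rewrite sk andbT.
  by rewrite (leq_trans (ltnW (ltn_ord k)) jl) leqNgt ltn_ord => /(_ isT).
apply: leq_trans (card_bigcup_le _ _) _.
apply: leq_trans (_ : \sum_(j < l.+1) 2 * #|leaves| <= _); last by rewrite sum_nat_const card_ord.
by apply: leq_sum => j _; apply: cD.
Qed.

(** Climbing is injective on bare paths, so a vertex lies on at most one segment for each distance.
    No power of [Delta] is lost, unlike in [separated_family]; this matters because [l] will contain
    the length of the network, of order [s ^ 4]. *)
Lemma bare_family (I : finType) l :
  #|I| * (l.+1 * l.+1) + l.+1 * (2 * #|leaves|) < #|T| ->
  exists f : I -> T, (forall i, bare l (f i)) /\
    forall i j k k', k <= l -> k' <= l -> iter k par (f i) = iter k' par (f j) -> i = j.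
Proof.
move=> cT; have cgood : #|I| * (l.+1 * l.+1) < #|[set v | bare l v]|.
  by move: cT (card_bare l); clear; lia.
have [||f [fg fd]] := disjoint_family (seg := up_path l) _ _ cgood.
- by move=> v _; apply: card_up_path.
- move=> y; rewrite -[X in _ <= X]muln1; apply: card_above => j jl.
  apply/card_le1_eqP=> v v'; rewrite !inE => /andP[/andP[lv /forallP bv] /eqP vy] /andP[/andP[lv' _] /eqP v'y].
  apply/esym; apply: (@chain_inj j); last by rewrite vy.
  move=> k kj; have kl := leq_trans kj jl; split; last exact: bv (Ordinal kl).
    by apply: dep_gt0; have := dep_iter (leq_trans (ltnW kl) (ltnW lv)); move: lv kl; clear; lia.
  by apply: dep_gt0; have := dep_iter (leq_trans (ltnW kl) (ltnW lv')); move: lv' kl; clear; lia.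
exists f; split=> [i|i j k k' kl k'l E]; first by have := fg i; rewrite inE.
apply: (fd i j (iter k par (f i))); first by apply/up_pathP; exists k.
by apply/up_pathP; exists k'.
Qed.

End RootedTree.

(** * Trees with many leaves and trees with many bare paths *)

Lemma subset_of_card (T : finType) (A : {set T}) k : k <= #|A| ->
  exists B : {set T}, B \subset A /\ #|B| = k.
Proof.
move=> kA; exists [set x in take k (enum A)]; split.
  by apply/subsetP=> x; rewrite inE => /mem_take; rewrite mem_enum.
rewrite cardsE; have /card_uniqP-> : uniq (take k (enum A)) by rewrite take_uniq ?enum_uniq.
by rewrite size_take -cardE; case: ltngtP kA.
Qed.

Lemma set_between (T : finType) (A B : {set T}) k : A \subset B -> #|A| <= k <= #|B| ->
  exists W : {set T}, [/\ A \subset W, W \subset B & #|W| = k].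
Proof.
move=> AB /andP[Ak kB]; have [|C [CBA cC]] := @subset_of_card _ (B :\: A) (k - #|A|).
  by rewrite cardsD (setIidPr AB) leq_sub2r.
exists (A :|: C); split; first exact: subsetUl.
  by rewrite subUset AB (subset_trans CBA) ?subsetDl.
rewrite cardsU cC (_ : A :&: C = set0) ?cards0 ?subn0 ?subnKC //.
by apply/setP=> x; rewrite !inE; apply/negP=> /andP[xA /(subsetP CBA)]; rewrite inE xA.
Qed.

Lemma indexing (I T : finType) (W : {set T}) : #|I| = #|W| ->
  exists w : I -> T, injective w /\ w @: I = W.
Proof.
move=> IW; pose w i := enum_val (cast_ord IW (enum_rank i)).
have wi : injective w by move=> i j /enum_val_inj/cast_ord_inj/enum_rank_inj.
exists w; split=> //; apply/eqP; rewrite eqEcard card_imset // IW leqnn andbT.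
by apply/subsetP=> x /imsetP[i _ ->]; apply: enum_valP.
Qed.

(** * Matchings from expansion and edges between large sets *)

Section Joined.
Variables (V : finType) (e : rel V) (m : nat).
Hypothesis e_sym : symmetric e.
Hypothesis joined : forall X Y : {set V}, #|X| = m -> #|Y| = m -> [disjoint X & Y] ->
  exists x y, [/\ x \in X, y \in Y & e x y].

(** Removing [m] vertices of [X] from [Y] leaves enough of [Y]. Extendability is therefore run with
    [M = 2 * m]: its sets need not be disjoint. *)
Lemma joined_overlap (X Y : {set V}) : m <= #|X| -> 2 * m <= #|Y| ->
  exists x y, [/\ x \in X, y \in Y & e x y].
Proof.
move=> mX mY; have [X' [XX' cX']] := subset_of_card mX.
have [|Y' [YY' cY']] := @subset_of_card _ (Y :\: X') m.
  have := cardsID X' Y; have := subset_leq_card (subsetIr Y X'); rewrite cX'; move: mY; clear; lia.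
have [|x [y [xX yY exy]]] := joined cX' cY'.
  rewrite disjoint_sym; apply/pred0P=> z /=; apply/negP=> /andP[/(subsetP YY')].
  by rewrite inE => /andP[/negP].
exists x, y; split=> //; first exact: (subsetP XX').
by have := subsetP YY' y yY; rewrite inE => /andP[].
Qed.

(** Hall's condition in three cases. A small [X] expands. If the part [Y] of [U] missed by [X] is
    small, [Y] expands into [P :\: X], so it cannot be too large. If both have at least [m]
    vertices, an edge joins them. *)
Lemma perfect_matching (P U : {set V}) : [disjoint P & U] -> #|P| = #|U| ->
  (forall X : {set V}, #|X| < m -> X \subset P -> #|X| <= #|nb e X :&: U|) ->
  (forall Y : {set V}, #|Y| < m -> Y \subset U -> #|Y| <= #|nb e Y :&: P|) ->
  exists g : V -> V, {in P &, injective g} /\ {in P, forall x, g x \in U /\ e x (g x)}.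
Proof.
move=> PU cPU hP hU; have [P0|[x0 x0P]] := set_0Vmem P.
  by exists id; rewrite P0; split=> [x y|x]; rewrite inE.
have [X XP|g [gi gN]] := @hall _ _ x0 (fun x => [set y in U | e x y]) P.
  have -> : \bigcup_(a in X) [set y in U | e a y] = nb e X :&: U.
    apply/setP=> y; rewrite in_setI; apply/bigcupP/andP => [[x xX]|[/nbP[x xX exy] yU]].
      by rewrite inE => /andP[yU exy]; split=> //; apply/nbP; exists x.
    by exists x; rewrite // inE yU.
  have [Xm|mX] := ltnP #|X| m; first exact: hP.
  rewrite leqNgt; apply/negP=> lt; pose Y := U :\: nb e X.
  have cY : #|P| < #|Y| + #|X| by have := cardsID (nb e X) U; rewrite setIC -/Y cPU; move: lt; clear; lia.
  have noE x y : x \in X -> y \in Y -> ~~ e x y.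
    by move=> xX; rewrite inE => /andP[yn _]; apply: contra yn => exy; apply/nbP; exists x.
  have [Ym|mY] := ltnP #|Y| m.
    have := hU Y Ym (subsetDl _ _); have : #|nb e Y :&: P| <= #|P :\: X|.
      apply: subset_leq_card; apply/subsetP=> x; rewrite inE => /andP[/nbP[y yY eyx] xP].
      by rewrite inE xP andbT; apply/negP=> /noE/(_ yY); rewrite e_sym eyx.
    have := cardsID X P; rewrite (setIidPr XP); move: cY; clear; lia.
  have [X' [XX' cX']] := subset_of_card mX; have [Y' [YY' cY']] := subset_of_card mY.
  have [|x [y [xX yY exy]]] := joined cX' cY'.
    apply: disjointWl (subset_trans XX' XP) _; apply: disjointWr PU.
    exact: subset_trans YY' (subsetDl _ _).
  by have := noE x y (subsetP XX' _ xX) (subsetP YY' _ yY); rewrite exy.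
exists g; split=> // x xP; by have := gN x xP; rewrite inE => /andP[].
Qed.

End Joined.

(** * The embedding for many leaf parents and for many bare paths *)

Section Assembly.
Variables (V : finType) (e : rel V).
Hypothesis e_sym : symmetric e.
Variables m K h Delta : nat.
Notation M := (2 * m).
Hypothesis m_gt0 : 0 < m.
Hypothesis K_gt1 : 1 < K.
Hypothesis Delta_K : Delta <= K.
Hypothesis Kh : M <= K ^ h.
Hypothesis joined : forall X Y : {set V}, #|X| = m -> #|Y| = m -> [disjoint X & Y] ->
  exists x y, [/\ x \in X, y \in Y & e x y].
Notation rho1 := (link_len h).
Notation room := (room M K h).

Let M_gt0 : 0 < M.
Proof. by rewrite muln_gt0. Qed.

Let joinedM (X Y : {set V}) : M <= #|X| -> M <= #|Y| -> exists x y, [/\ x \in X, y \in Y & e x y].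
Proof. by move=> MX; apply: joined_overlap => //; apply: leq_trans MX; rewrite leq_pmull. Qed.

Definition expands_into (W : {set V}) :=
  forall X : {set V}, #|X| < m -> #|X| <= #|nb e X :&: W|.

Lemma expands_intoS (W U : {set V}) : W \subset U -> expands_into W -> expands_into U.
Proof.
move=> WU WX X Xm; apply: leq_trans (WX X Xm) _; apply: subset_leq_card.
exact: setIS.
Qed.

(* [W3] is kept free of the tree so that the leftover vertices expand. *)
Variables (W1 W2 W3 W4 : {set V}) (o : V) (N : nat).
Hypothesis cW1 : #|W1| = N.
Hypothesis cW2 : #|W2| = N.
Hypothesis W12 : [disjoint W1 & W2].
Hypothesis W13 : [disjoint W1 & W3].
Hypothesis W23 : [disjoint W2 & W3].
Hypothesis W1234 : [disjoint W1 :|: W2 :|: W3 & W4].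
Hypothesis oW : o \notin W1 :|: W2 :|: W3 :|: W4.
Hypothesis W1_exp : expands_into W1.
Hypothesis W2_exp : expands_into W2.
Hypothesis W3_exp : expands_into W3.
Hypothesis W4_exp : forall U : {set V}, #|U| <= 2 * M -> K.+2 * #|U| <= #|nb e U :&: W4|.
Hypothesis cW3 : #|W3| + room <= N.

Definition cap0 (A : {set V}) (v : V) := if v \in A then K.+2 else K.+1.

(** At the start nothing of [W4] is used, and [W4] alone meets the demand of every small set. *)
Lemma state0 (A : {set V}) : [disjoint A & W4] -> state e M K A (cap0 A).
Proof.
move=> AW; split; last by move=> v /negbTE vA; rewrite /cap0 vA.
split=> [v|U cU]; first by rewrite /cap0; case: ifP.
apply: leq_trans (_ : \sum_(v in U) K.+2 <= _).
  by apply: leq_sum => v _; rewrite /cap0; case: ifP.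
rewrite sum_nat_const mulnC; apply: leq_trans (W4_exp cU) _; apply: subset_leq_card.
apply/subsetP=> v; rewrite !in_setI in_setD => /andP[-> vW]; rewrite andbT.
by apply/negP=> vA; have /pred0P/(_ v) := AW; rewrite /= vA vW.
Qed.

Lemma disjE (A B : {set V}) x : [disjoint A & B] -> x \in A -> x \notin B.
Proof. by move=> /pred0P/(_ x) /= + xA; rewrite xA /= => ->. Qed.

Variables (T I : finType) (r : T) (par : T -> T) (dep : T -> nat).
Hypothesis cI : #|I| = N.
Hypothesis cT : #|T| = #|V|.
Hypothesis dep_r : dep r = 0.
Hypothesis dep_par : forall v, v != r -> dep v = (dep (par v)).+1.
Notation children := (children r par).
Notation leaves := (leaves r par).
Hypothesis children_le : forall v, #|children v| <= Delta.

Definition leaf_parents := [set v | [exists c, (c \in children v) && (c \in leaves)]].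

Lemma leaf_case (p : I -> T) :
  (forall i, p i \in leaf_parents /\ rho1 < dep (p i)) ->
  (forall i j k k', k <= rho1 -> k' <= rho1 -> iter k par (p i) = iter k' par (p j) -> i = j) ->
  exists f : T -> V, injective f /\ forall v, v != r -> e (f (par v)) (f v).
Proof.
move=> pP p_sep.
have p_inj : injective p by move=> i j E; apply: (p_sep i j 0 0).
have lfP i : exists c, [&& c != r, par c == p i & c \in leaves].
  by have [] := pP i; rewrite inE => /existsP[c]; rewrite inE -andbA => H _; exists c.
pose lf i := xchoose (lfP i).
have lfE i : [/\ lf i != r, par (lf i) = p i & lf i \in leaves].
  by have /and3P[-> /eqP-> ->] := xchooseP (lfP i).
have lf_inj : injective lf.
  by move=> i j E; apply: p_inj; have [_ <- _] := lfE i; have [_ <- _] := lfE j; rewrite E.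
pose L := lf @: I.
have cL : #|L| = N by rewrite card_imset.
have Lpar v : v != r -> par v \notin L.
  move=> vr; apply/imsetP=> -[i _ E]; have [_ _] := lfE i; rewrite inE -E => /eqP/setP/(_ v).
  by rewrite !inE vr eqxx.
pose S := ~: L; pose Rt := [set r].
have rS : r \in S by rewrite inE; apply/imsetP=> -[i _ E]; have [] := lfE i; rewrite -E eqxx.
have SE v : v \in S :\: Rt -> v != r by rewrite !inE => /andP[].
have [w [wi wW]] : exists w : I -> V, injective w /\ w @: I = W1 by apply: indexing; rewrite cI.
(* [W3] counts as used from the start, so no tree vertex is put there. *)
pose A := W1 :|: W3 :|: [set o].
have wW1 i : w i \in W1 by rewrite -wW imset_f.
have wA i : w i \in A by rewrite !inE wW1.
have oA : o \in A by rewrite !inE eqxx orbT.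
have [[[oW1 _] oW3] oW4] : ((o \notin W1 /\ o \notin W2) /\ o \notin W3) /\ o \notin W4.
  by move: oW; rewrite !inE !negb_or => /andP[/andP[/andP[]]].
have AW4 : [disjoint A & W4].
  apply/pred0P=> x /=; apply/negP=> /andP[]; rewrite !inE => /orP[xW|/eqP->]; last by apply/negP.
  apply/negP; apply: disjE W1234 _; rewrite !inE.
  by case/orP: xW => ->; rewrite ?orbT.
have dep_anc i j : j <= rho1 -> 0 < dep (iter j par (p i)).
  have [_ lt] := pP i => jr; have := dep_iter dep_r dep_par (leq_trans jr (ltnW lt)).
  by move: lt jr; clear; lia.
have anc_S i j : j <= rho1 -> iter j par (p i) \in S :\: Rt.
  move=> jr; rewrite !inE (dep_gt0 dep_r (dep_anc i j jr)) /=.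
  case: j jr => [_|j jr]; first by have [lr <- _] := lfE i; apply: Lpar.
  by apply/Lpar/(dep_gt0 dep_r)/dep_anc/ltnW.
have targS : #|S :\: (Rt :|: [set p i | i : I])| + N.*2 < #|T|.
  have := cardsC L; rewrite cL -/S; have := cardsID (Rt :|: [set p i | i : I]) S.
  have -> : S :&: (Rt :|: [set p i | i : I]) = Rt :|: [set p i | i : I].
    apply/setIidPr; rewrite subUset sub1set rS; apply/subsetP=> x /imsetP[i _ ->].
    by have := anc_S i 0 isT; rewrite inE => /andP[].
  rewrite cardsU1 card_imset // cI.
  have -> : r \notin [set p i | i : I].
    by apply/imsetP=> -[i _ E]; have := anc_S i 0 isT; rewrite /= -E !inE eqxx.
  by clear; lia.
have cA : #|A| <= N + #|W3| + 1.
  apply: leq_trans (leq_card_setU _ _).1 _; rewrite cards1 leq_add2r -cW1.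
  exact: (leq_card_setU _ _).1.
have capA v : v \in A -> cap0 A v = K.+2 by rewrite /cap0 => ->.
have [|||||||||||f [fi fr fp fe fA]] :=
    @embed_forest V e e_sym M K h M_gt0 (ltnW K_gt1) Kh joinedM T I par dep S Rt Delta p
      Delta_K _ _ _ _ anc_S p_sep A (cap0 A) (fun=> o) w wi wA.
- by rewrite sub1set.
- by move=> v /SE/Lpar; rewrite inE.
- by move=> v /SE/dep_par.
- move=> v; apply: leq_trans (children_le v); apply: subset_leq_card.
  by apply/subsetP=> c; rewrite !inE => /andP[/andP[-> _] ->].
- by move=> x y /set1P-> /set1P->.
- by [].
- by move=> v _ i; apply: contraNneq oW1 => ->.
- exact: state0.
- by move=> v _; rewrite capA // ltnW // ltnW.
- by move=> i; rewrite capA // ltnW // ltnS.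
(* The [N] vertices that stay free of the tree suffice for [W3] and the room of a link, by [cW3]. *)
- by move: targS cA cW3; rewrite cT; clear; lia.
have fW3 v : v \in S -> f v \notin W3.
  move=> vS; case: (eqVneq v r) => [->|vr]; first by rewrite fr ?set11.
  case: (boolP (v \in [set p i | i : I])) => [/imsetP[i _ ->]|vp].
    by rewrite fp; apply: disjE W13 (wW1 i).
  have := fA v vS; rewrite inE => /(_ vr vp); apply: contra => vW.
  by rewrite !inE vW orbT.
pose U := ~: (f @: S).
have cU : #|U| = N.
  have := cardsC (f @: S); rewrite card_in_imset // -/U -cT; have := cardsC L; rewrite cL -/S.
  by clear; lia.
have W3U : W3 \subset U.
  by apply/subsetP=> x xW; rewrite inE; apply/imsetP=> -[v vS E]; have := fW3 v vS; rewrite -E xW.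
have pS i : p i \in S by have := anc_S i 0 isT; rewrite inE => /andP[].
have [||||g [gi gU]] := @perfect_matching V e m e_sym joined W1 U.
- apply/pred0P=> x /=; apply/negP=> /andP[]; rewrite -wW => /imsetP[i _ ->].
  by rewrite inE -fp imset_f.
- by rewrite cW1 cU.
- by move=> X Xm _; apply: (expands_intoS W3U W3_exp).
- by move=> Y Ym _; apply: W1_exp.
pose F v := if v \in L then g (f (par v)) else f v.
exists F; split=> [v v'|v vr].
  have inL x : x \in L -> exists2 i, x = lf i & f (par x) = w i.
    by case/imsetP=> i _ ->; exists i => //; have [_ -> _] := lfE i.
  have gnS x y : x \in L -> y \notin L -> g (f (par x)) != f y.
    case/inL=> i _ -> yL; have [+ _] := gU (w i) (wW1 i); rewrite inE => gx.
    by apply: contraNneq gx => ->; apply: imset_f; rewrite inE.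
  rewrite /F; case: ifPn => vL; case: ifPn => v'L.
  - have [i -> ->] := inL v vL; have [j -> ->] := inL v' v'L.
    by move=> /(gi _ _ (wW1 i) (wW1 j))/wi->.
  - by move=> E; have := gnS v v' vL v'L; rewrite E eqxx.
  - by move=> E; have := gnS v' v v'L vL; rewrite E eqxx.
  - by apply: fi; rewrite inE.
rewrite /F (negbTE (Lpar v vr)); case: ifPn => vL.
  case/imsetP: vL => i _ ->; have [_ -> _] := lfE i; rewrite fp.
  by have [] := gU (w i) (wW1 i).
by apply: fe; rewrite !inE vr.
Qed.

(* Below [p i], whose image is in [W1], come the leftover vertex matched with it,
   a vertex of [W2], and the network path from there to the image of [v_ i].  The
   resulting map is onto, hence injective by counting. *)
Lemma path_case (ls : seq (I -> I)) (v_ : I -> T) :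
  let Lam := (size ls * Lw h).+2 in
  pairings ls -> (forall s : I -> I, injective s -> routes ls s) ->
  N * (size ls * Lw h + 4) <= #|T| ->
  (forall i, bare r par dep (Lam + rho1) (v_ i)) ->
  (forall i j k k', k <= Lam + rho1 -> k' <= Lam + rho1 ->
    iter k par (v_ i) = iter k' par (v_ j) -> i = j) ->
  exists f : T -> V, injective f /\ forall v, v != r -> e (f (par v)) (f v).
Proof.
move=> Lam ls_pair ls_route cN vbare v_sep.
pose a i j := iter j par (v_ i).
have v_dep i : Lam + rho1 < dep (v_ i) by have /andP[] := vbare i.
have dep_a i j : j <= Lam + rho1 -> dep (a i j) + j = dep (v_ i).
  by move=> jl; apply: (dep_iter dep_r dep_par); apply: leq_trans (ltnW (v_dep i)).
have a_r i j : j <= Lam + rho1 -> a i j != r.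
  move=> jl; apply: (dep_gt0 dep_r); have := v_dep i; rewrite -(dep_a i j jl).
  by move: jl; clear; lia.
have a_inj i i' j j' : j <= Lam + rho1 -> j' <= Lam + rho1 -> a i j = a i' j' -> i = i' /\ j = j'.
  move=> jl jl' E; have ii' := v_sep _ _ _ _ jl jl' E; split=> //.
  have := dep_a i j jl; rewrite E -ii' -(dep_a i j' jl') ii'; clear; lia.
have only_child i j c : j < Lam -> c != r -> par c = a i j.+1 -> c = a i j.
  move=> jl cr pc; have /andP[_ /forallP bi] := vbare i.
  have jl' : j < Lam + rho1 by apply: leq_trans jl (leq_addr _ _).
  have /card_le1_eqP one := bi (Ordinal jl').
  by apply/esym/one; rewrite inE /= ?cr ?pc ?eqxx // (a_r i j (ltnW jl')) /=.
(* Strictly between [p i] and [v_ i] lie [Lam.-1] vertices: for the matched vertex, a vertex of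
   [W2], and the network path without its end, which is the image of [v_ i]. *)
pose p i := a i Lam.
pose Int := [set x | [exists i, exists j : 'I_Lam, (0 < j) && (x == a i j)]].
have IntP x : reflect (exists i j, 0 < j < Lam /\ x = a i j) (x \in Int).
  rewrite inE; apply: (iffP existsP) => [[i /existsP[j /andP[j0 /eqP->]]]|[i [j [/andP[j0 jl] ->]]]].
    by exists i, j; rewrite j0 ltn_ord.
  by exists i; apply/existsP; exists (Ordinal jl); rewrite j0 eqxx.
have cInt : #|Int| = N * (size ls * Lw h).+1.
  have -> : Int = [set a x.1 (val x.2).+1 | x : I * 'I_(size ls * Lw h).+1].
    apply/setP=> x; apply/IntP/imsetP => [[i [j [/andP[j0 jl] ->]]]|[[i j] _ ->]].
      case: j j0 jl => // j _ jl.
      by exists (i, Ordinal (jl : j < (size ls * Lw h).+1)).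
    by exists i, j.+1; rewrite /= ltnS ltn_ord.
  rewrite card_imset ?card_prod ?card_ord ?cI // => -[i j] [i' j'] /= E.
  have jl (k : 'I_(size ls * Lw h).+1) : k.+1 <= Lam + rho1.
    by apply: leq_trans (leq_addr _ _); apply: leqW.
  by have [-> [/val_inj->]] := a_inj i i' _ _ (jl j) (jl j') E.
(* A forest with roots [r] and the [v_ i] remains. With [v_ i] pinned to a network output, what
   hangs below it is embedded before the matchings, hence the routing, are known. *)
pose S := ~: Int; pose Rt := r |: [set v_ i | i : I].
have rInt : r \notin Int.
  apply/IntP=> -[i [j [/andP[_ jl] E]]]; have := a_r i j; rewrite -E eqxx => H.
  by apply/notF/H/(leq_trans (ltnW jl))/leq_addr.
have aInt i j : j <= Lam + rho1 -> (a i j \in Int) = (0 < j < Lam).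
  move=> jl; apply/IntP/idP => [[i' [j' [jL' E]]]|jL]; last by exists i, j.
  have [|_ ->//] := a_inj i i' j j' jl _ E.
  by apply: leq_trans (leq_addr _ _); case/andP: jL' => _ /ltnW.
have v_r i : v_ i != r by apply: (a_r i 0).
have v_inj : injective v_ by move=> i j E; have [] := a_inj i j 0 0 isT isT E.
have v_Int i : v_ i \notin Int by rewrite (aInt i 0).
have pLam i j : iter j par (p i) = a i (j + Lam) by rewrite /p /a iterD.
have p_inj : injective p.
  by move=> i j E; have [] := a_inj i j Lam Lam (leq_addr _ _) (leq_addr _ _) E.
have anc_S i j : j <= rho1 -> iter j par (p i) \in S :\: Rt.
  move=> jr; have jl : j + Lam <= Lam + rho1 by rewrite addnC leq_add2l.
  rewrite pLam in_setD in_setU in_set1 in_setC negb_or (a_r _ _ jl) aInt //= [_ < Lam]ltnNge leq_addl andbF andbT.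
  by apply/imsetP=> -[i' _ E]; have [_] := a_inj i i' _ 0 jl isT E; rewrite addnS.
have p_sep i i' j j' : j <= rho1 -> j' <= rho1 -> iter j par (p i) = iter j' par (p i') -> i = i'.
  move=> jr jr'; rewrite !pLam => E.
  by have [] := a_inj i i' (j + Lam) (j' + Lam); rewrite ?[_ + Lam]addnC ?leq_add2l // ![Lam + _]addnC.
have SRtP v : v \in S :\: Rt -> [/\ v != r, v \notin Int & forall i, v != v_ i].
  rewrite in_setD in_setU in_set1 in_setC negb_or => /andP[/andP[-> vv] ->]; split=> // i.
  by apply: contraNneq vv => ->; apply: imset_f.
have par_S v : v \in S :\: Rt -> par v \in S.
  case/SRtP=> vr vInt vv; rewrite inE; apply/IntP=> -[i [j [/andP[j0 jl] E]]].
  case: j j0 jl E => // j _ jl E.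
  have E' := only_child i j v (ltnW jl) vr E; case: j jl E E' => [|j] jl E E'.
    by have := vv i; rewrite E' eqxx.
  by rewrite E' aInt ?(ltnW jl) // in vInt; apply: leq_trans (ltnW (ltnW jl)) (leq_addr _ _).
have [w1 [w1i w1W]] : exists w : I -> V, injective w /\ w @: I = W1 by apply: indexing; rewrite cI.
have [w2 [w2i w2W]] : exists w : I -> V, injective w /\ w @: I = W2 by apply: indexing; rewrite cI.
have w1W1 i : w1 i \in W1 by rewrite -w1W imset_f.
have w2W2 i : w2 i \in W2 by rewrite -w2W imset_f.
have [[[oW1 oW2] oW3] oW4] : ((o \notin W1 /\ o \notin W2) /\ o \notin W3) /\ o \notin W4.
  by move: oW; rewrite !inE !negb_or => /andP[/andP[/andP[]]].
pose A := W1 :|: W2 :|: W3 :|: [set o].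
have AW4 : [disjoint A & W4].
  apply/pred0P=> x /=; apply/negP=> /andP[]; rewrite in_setU => /orP[xW|/set1P->]; last by apply/negP.
  by apply/negP; apply: disjE W1234 xW.
have inA x : (x \in A) = [|| x \in W1, x \in W2, x \in W3 | x == o] by rewrite !inE !orbA.
have capA v : v \in A -> cap0 A v = K.+2 by rewrite /cap0 => ->.
have cA : #|A| <= N + N + #|W3| + 1.
  apply: leq_trans (leq_card_setU _ _).1 _; rewrite cards1 leq_add2r.
  apply: leq_trans (leq_card_setU _ _).1 _; rewrite leq_add2r -{1}cW1 -cW2.
  exact: (leq_card_setU _ _).1.
have N_gt0 : 0 < N by move: cW3; rewrite /room /step_room; move: m_gt0; clear; nia.
have [||B [w3 [r3 [S3 [BA cB] [w3i w3B] r3E route]]]] :=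
    @switch_network V e e_sym M K h M_gt0 K_gt1 Kh joinedM I ls w2 A (cap0 A)
      ls_pair w2i (state0 AW4).
- by move=> i; rewrite capA inA w2W2 orbT // ltnW // ltnS ltnW.
(* The [4] in [cN]: besides the network, [W1] and [W2] take [2 * N], [W3] with the room at most [N],
   and [o] one more vertex. *)
- move: cA cN cW3 N_gt0; rewrite cI cT; clear; nia.
rewrite cI in cB; rewrite w2W in w3B r3E.
pose f0 v := if [pick i | v == v_ i] is Some i then w3 i else o.
have f0r : f0 r = o by rewrite /f0; case: pickP => // i; rewrite eq_sym (negbTE (v_r i)).
have f0v i : f0 (v_ i) = w3 i.
  by rewrite /f0; case: pickP => [j /eqP/v_inj->//|/(_ i)]; rewrite eqxx.
have ow3 i : o != w3 i.
  have [w3in _] := w3B i; apply: contraTneq w3in => <-; rewrite inE negb_or oW2 /=.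
  by apply/negP=> /BA; rewrite inA eqxx !orbT.
have w13 i j : w3 i != w1 j.
  have [w3in _] := w3B i; apply: contraTneq w3in => ->; rewrite inE negb_or (disjE W12) //=.
  by apply/negP=> /BA; rewrite inA w1W1.
have RtP v : v \in Rt -> v = r \/ exists i, v = v_ i.
  by rewrite !inE => /orP[/eqP|/imsetP[i _]]; [left | right; exists i].
have RtS : Rt \subset S.
  by apply/subsetP=> v /RtP[->|[i ->]]; rewrite inE.
have cRt : #|Rt| = N.+1.
  rewrite cardsU1 card_imset // cI; have -> // : r \notin [set v_ i | i : I].
  by apply/imsetP=> -[i _ E]; have := v_r i; rewrite -E eqxx.
have cS : #|S| + N * (size ls * Lw h).+1 = #|T| by rewrite -cInt addnC cardsC.
have targS : #|S :\: (Rt :|: [set p i | i : I])| + N.*2 < #|S|.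
  have := cardsID (Rt :|: [set p i | i : I]) S.
  have -> : S :&: (Rt :|: [set p i | i : I]) = Rt :|: [set p i | i : I].
    apply/setIidPr; rewrite subUset RtS; apply/subsetP=> x /imsetP[i _ ->].
    by have := anc_S i 0 isT; rewrite inE => /andP[].
  rewrite cardsU cRt card_imset // cI.
  have -> : Rt :&: [set p i | i : I] = set0.
    apply/setP=> x; rewrite !inE; apply/negP=> /andP[xR /imsetP[i _ E]].
    by have := anc_S i 0 isT; rewrite /= -E !inE xR.
  by rewrite cards0; clear; lia.
have cAB : #|A :|: B| <= N + N + #|W3| + 1 + N * (size ls * Lw h).
  apply: leq_trans (leq_card_setU _ _).1 _; rewrite cB mulnCA; exact: leq_add.
have AAB x : x \in A -> x \in A :|: B by rewrite in_setU => ->.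
have [|||||||||f [fi fr fp fe fA]] :=
    @embed_forest V e e_sym M K h M_gt0 (ltnW K_gt1) Kh joinedM T I par dep S Rt Delta p
      Delta_K RtS par_S _ _ anc_S p_sep (A :|: B) r3 f0 w1 w1i _ _ _ _ S3.
- by move=> v /SRtP[/dep_par].
- move=> v; apply: leq_trans (children_le v); apply: subset_leq_card.
  by apply/subsetP=> c; rewrite !inE negb_or => /andP[/andP[/andP[-> _] _] ->].
- by move=> i; rewrite AAB // inA w1W1.
- move=> x y /RtP[->|[i ->]] /RtP[->|[j ->]]; rewrite ?f0r ?f0v //.
  + by move=> E; have := ow3 j; rewrite E eqxx.
  + by move=> E; have := ow3 i; rewrite E eqxx.
  + by move/w3i->.
- move=> x /RtP[->|[i ->]]; rewrite ?f0r ?f0v; first by rewrite AAB // inA eqxx !orbT.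
  by have [+ _] := w3B i; rewrite !inE => /orP[->|->]; rewrite ?orbT.
- move=> x /RtP[->|[j ->]] i; rewrite ?f0r ?f0v //.
  by apply: contraNneq oW1 => ->.
- move=> x /RtP[->|[i ->]]; rewrite ?f0r ?f0v; last by apply: leq_trans Delta_K _; have [] := w3B i.
  by rewrite r3E ?inA ?eqxx ?orbT // capA ?inA ?eqxx ?orbT // ltnW // ltnW.
- move=> i; rewrite r3E ?inA ?w1W1 ?(disjE W12) // capA ?inA ?w1W1 // ltnW //.
- by move: cAB targS cW3 cS; rewrite -cT mulnS; clear; lia.
have pS i : p i \in S by have := anc_S i 0 isT; rewrite in_setD => /andP[].
have vS i : v_ i \in S by rewrite in_setC.
have fv i : f (v_ i) = w3 i.
  by rewrite fr ?f0v // in_setU; apply/orP; right; apply: imset_f.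
have fcase v : v \in S ->
    [\/ f v = o, exists i, f v = w3 i, exists i, f v = w1 i | f v \notin A :|: B].
  move=> vS'; case: (boolP (v \in Rt)) => [vR|vR].
    have /RtP[vr|[i vi]] := vR; first by constructor 1; rewrite fr ?vr // -vr.
    by constructor 2; exists i; rewrite vi fv.
  case: (boolP (v \in [set p i | i : I])) => [/imsetP[i _ ->]|vp]; last by constructor 4; apply: fA.
  by constructor 3; exists i; apply: fp.
have oB : o \notin B by apply/negP=> /BA; rewrite inA eqxx !orbT.
have w1B i : w1 i \notin B by apply/negP=> /BA; rewrite inA w1W1.
have W2B : W2 :&: B = set0.
  by apply/setP=> x; rewrite !inE; apply/negP=> /andP[xW /BA]; rewrite inA xW orbT.
have fSW2B : f @: S :&: (W2 :|: B) = w3 @: I.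
  apply/setP=> x; rewrite in_setI; apply/andP/imsetP => [[/imsetP[v vS' ->]]|[i _ ->]].
    case: (fcase v vS') => [->|[i ->]|[i ->]|].
    - by rewrite in_setU (negbTE oW2) (negbTE oB).
    - by exists i.
    - by rewrite in_setU (negbTE (disjE W12 (w1W1 i))) (negbTE (w1B i)).
    - by rewrite !inE !negb_or => /andP[/andP[/andP[/andP[_ /negbTE->] _] _] /negbTE->].
  by split; [rewrite -fv imset_f | have [] := w3B i].
pose U := ~: (f @: S :|: (W2 :|: B)).
have cU : #|U| = N.
  have := cardsC (f @: S :|: (W2 :|: B)); rewrite -/U cardsU fSW2B (card_imset _ w3i) cI.
  rewrite (card_in_imset fi) cardsU W2B cards0 subn0 cW2 cB mulnCA.
  by move: cS; rewrite cT mulnS; clear; lia.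
have W3U : W3 \subset U.
  apply/subsetP=> x xW; rewrite in_setC !in_setU !negb_or; apply/and3P; split.
  - apply/imsetP=> -[v vS' E]; case: (fcase v vS') => [fo|[i fi']|[i fi']|].
    + by rewrite -fo -E xW in oW3.
    + have [] := w3B i; rewrite -fi' -E in_setU => /orP[xW2|/BA]; last by rewrite inA xW !orbT.
      by have := disjE W23 xW2; rewrite xW.
    + by have := disjE W13 (w1W1 i); rewrite -fi' -E xW.
    + by rewrite -E in_setU inA xW !orbT.
  - by apply/negP=> xW2; have := disjE W23 xW2; rewrite xW.
  - by apply/negP=> /BA; rewrite inA xW !orbT.
have W1U : [disjoint W1 & U].
  apply/pred0P=> x /=; apply/negP=> /andP[]; rewrite -w1W => /imsetP[i _ ->].
  by rewrite in_setC !in_setU -fp imset_f.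
have W2U : [disjoint W2 & U].
  by apply/pred0P=> x /=; apply/negP=> /andP[xW]; rewrite in_setC !in_setU xW orbT.
have [|||g1 [g1i g1U]] := perfect_matching e_sym joined W1U.
- by rewrite cW1 cU.
- by move=> X Xm _; apply: (expands_intoS W3U W3_exp).
- by move=> Y Ym _; apply: W1_exp.
have [|||g2 [g2i g2U]] := perfect_matching e_sym joined W2U.
- by rewrite cW2 cU.
- by move=> X Xm _; apply: (expands_intoS W3U W3_exp).
- by move=> Y Ym _; apply: W2_exp.
have u1i : injective (g1 \o w1) by move=> i j /(g1i _ _ (w1W1 i) (w1W1 j))/w1i.
have u2i : injective (g2 \o w2) by move=> i j /(g2i _ _ (w2W2 i) (w2W2 j))/w2i.
have u1U : (g1 \o w1) @: I = U.
  apply/eqP; rewrite eqEcard card_imset // cI cU leqnn andbT.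
  by apply/subsetP=> x /imsetP[i _ ->]; have [] := g1U _ (w1W1 i).
(* Both matchings fill [U], so [w2 j] shares its leftover vertex with exactly one [w1 (s j)]. Wire
   [j] must therefore come out at [w3 (s j)]. *)
have s_ex j : exists i, g1 (w1 i) == g2 (w2 j).
  have : g2 (w2 j) \in U by have [] := g2U _ (w2W2 j).
  by rewrite -u1U => /imsetP[i _ /= ->]; exists i.
pose s j := xchoose (s_ex j).
have sE j : g1 (w1 (s j)) = g2 (w2 j) by apply/eqP/(xchooseP (s_ex j)).
have s_inj : injective s by move=> i j E; apply: u2i; rewrite /= -!sE E.
have [q [qP qB]] := route s (ls_route s s_inj).
pose t := invF s_inj.
have st i : s (t i) = i by apply: f_invF.
pose full i := [:: g1 (w1 i), w2 (t i) & q (t i)].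
have full_size i : size (full i) = Lam by have [_ _ /= ->] := qP (t i).
have full_path i : path e (w1 i) (full i).
  have [pq _ _] := qP (t i); have [_ e1] := g1U _ (w1W1 i); have [_ e2] := g2U _ (w2W2 (t i)).
  by rewrite /= e1 pq andbT -{1}[i]st sE e_sym.
have full_last i : nth o (full i) Lam.-1 = w3 i.
  have [_ lq _] := qP (t i); rewrite -(full_size i) nth_last /= lq st.
  by [].
pose G v := if [pick x : I * 'I_Lam | v == a x.1 x.2] is Some x
  then nth o (full x.1) (Lam.-1 - x.2) else f v.
have G_a i j : j < Lam -> G (a i j) = nth o (full i) (Lam.-1 - j).
  move=> jl; rewrite /G; case: pickP => [[i' j'] /= /eqP E|/(_ (i, Ordinal jl))]; last by rewrite /= eqxx.
  have jl' (k : nat) : k < Lam -> k <= Lam + rho1.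
    by move=> kl; apply: leq_trans (ltnW kl) (leq_addr _ _).
  by have [-> ->] := a_inj i i' j j' (jl' _ jl) (jl' _ (ltn_ord j')) E.
have GS v : v \in S -> G v = f v.
  rewrite in_setC => vInt; rewrite /G; case: pickP => // -[i j] /= /eqP E.
  have j0 : j = 0 :> nat.
    apply/eqP; apply: contraNT vInt; rewrite -lt0n => j0.
    by apply/IntP; exists i, j; rewrite j0 ltn_ord.
  by rewrite E j0 subn0 full_last fv.
have G_full i k : k < Lam -> nth o (full i) k = G (a i (Lam.-1 - k)).
  by move=> kl; rewrite G_a ?subKn // ltnS leq_subr.
exists G; split.
  suff /imset_injP Gi : #|G @: [set: T]| == #|[set: T]| by move=> x y; apply: Gi; rewrite inE.
  rewrite cardsT cT eqn_leq -{1}cT -cardsT leq_imset_card /=.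
  apply: subset_leq_card; apply/subsetP=> y _.
  have from_full i : y \in full i -> y \in G @: [set: T].
    move=> yi; have := nth_index o yi; rewrite G_full; last by rewrite -(full_size i) index_mem.
    by move=> <-; apply: imset_f.
  case: (boolP (y \in U)) => [|yU].
    by rewrite -u1U => /imsetP[i _ yE]; apply: (from_full i); rewrite yE mem_head.
  move: yU; rewrite in_setC negbK !in_setU => /or3P[/imsetP[v vS' ->]|yW|/qB[j yq]].
  - by rewrite -GS // imset_f.
  - move: yW; rewrite -w2W => /imsetP[j _ yE].
    by apply: (from_full (s j)); rewrite !inE /t invF_f yE eqxx orbT.
  - by apply: (from_full (s j)); rewrite !inE /t invF_f yq !orbT.
move=> v vr; have edge i k : k < Lam -> e (nth o (w1 i :: full i) k) (nth o (full i) k).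
  by move=> kl; apply: (pathP o (full_path i)); rewrite full_size.
case: (boolP [exists i, exists j : 'I_Lam, v == a i j]) => [/existsP[i /existsP[j /eqP vE]]|vn].
  move: vE (ltn_ord j); move: (nat_of_ord j) => {}j vE jl; rewrite vE G_a //.
  have -> : par (a i j) = a i j.+1 by [].
  case: (ltnP j.+1 Lam) => jl1.
    have := edge i (Lam.-1 - j); rewrite ltnS leq_subr => /(_ isT).
    by rewrite G_a // subnS /=; case E : (Lam.-1 - j) => [|k] //=; move: E jl1; rewrite /Lam /=; clear; lia.
  have jE : Lam = j.+1 by apply/eqP; rewrite eqn_leq jl1.
  have -> : a i j.+1 = p i by rewrite /p -jE.
  have -> : Lam.-1 - j = 0 by rewrite jE /= subnn.
  by rewrite GS // fp; apply: (edge i 0).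
have vn' i j : j < Lam -> v != a i j.
  move=> jl; apply: contraNneq vn => ->; apply/existsP; exists i.
  by apply/existsP; exists (Ordinal jl).
have vSR : v \in S :\: Rt.
  rewrite in_setD in_setU in_set1 (negbTE vr) in_setC /=; apply/andP; split.
    by apply/imsetP=> -[i _ E]; have := vn' i 0 isT; rewrite E eqxx.
  by apply/IntP=> -[i [j [/andP[_ jl] E]]]; have := vn' i j jl; rewrite E eqxx.
rewrite !GS; [exact: fe | by move: vSR; rewrite in_setD => /andP[] | exact: par_S].
Qed.

End Assembly.

(** * Reservoirs *)

Section Expander.
Variables (V : finType) (e : rel V).
Hypothesis e_sym : symmetric e.
Variables m K h Delta R g : nat.
Notation n := #|V|.
Notation t := (12 * K.+2).
Hypothesis m_gt1 : 1 < m.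
Hypothesis joined : forall X Y : {set V}, #|X| = m -> #|Y| = m -> [disjoint X & Y] ->
  exists x y, [/\ x \in X, y \in Y & e x y].
Hypothesis expands : forall X : {set V}, 0 < #|X| < m ->
  2 * R * g * #|X| <= #|nb e X :\: X|.
Hypothesis R_ge : 64 <= R.
Hypothesis g_ge : 2 ^ t * (n * (n * R).+1) <= 2 ^ g.
Hypothesis link_len_le : link_len h <= K.

Let m_gt0 : 0 < m := ltnW m_gt1.

Hypothesis n_gt0 : 0 < n.

Lemma small_classes : exists (Vi : 'I_4 -> {set V}) (z : nat),
  [/\ forall i j x, x \in Vi i -> x \in Vi j -> i = j,
      forall i, #|Vi i| <= z, z * R <= 2 * n &
      forall i (X : {set V}), #|X| < m -> t * #|X| <= #|nb e X :&: Vi i|].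
Proof.
have R_gt0 : 0 < R by apply: leq_trans R_ge.
have [c cP] := @expanding_coloring V (fun X => nb e X :\: X) R m t g R_gt0 n_gt0 expands g_ge.
pose z := (2 * n) %/ R; pose small := [set i | #|[set v | c v == i]| <= z].
have /card_geqP[s [us s4 ssmall]] : 4 <= #|small|.
  have sum_classes : \sum_i #|[set v | c v == i]| = n.
    rewrite -[RHS]sum1_card (partition_big c predT) //=; apply: eq_bigr => i _.
    by rewrite -sum1_card; apply: eq_bigl => v; rewrite !inE.
  have : #|~: small| * z.+1 <= n.
    rewrite -sum_classes [X in _ <= X](bigID (mem (~: small))) /=.
    apply: leq_trans (leq_addr _ _); rewrite -sum_nat_const; apply: leq_sum => i.
    by rewrite !inE -ltnNge.
  have := cardsC small; rewrite card_ord; have : 2 * n < z.+1 * R by rewrite ltn_ceil.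
  rewrite leqNgt => H1 H2 H3; apply/negP=> H4.
  have : (R - 3) * z.+1 <= n by apply: leq_trans H3; rewrite leq_mul2r; move: H2 H4; clear; lia.
  by move: H1 R_ge; clear; nia.
have [i0 _] : exists i0 : 'I_R, true by exists (Ordinal R_gt0).
have s_lt (i : 'I_4) : i < size s by rewrite s4.
exists (fun i => [set v | c v == nth i0 s i]), z; split.
- move=> i j x; rewrite !inE => /eqP-> /eqP E; apply/val_inj/eqP.
  by rewrite -(nth_uniq i0 (s_lt i) (s_lt j) us) E.
- by move=> i; have := ssmall _ (mem_nth i0 (s_lt i)); rewrite inE.
- exact: leq_trunc_div.
move=> i X Xm; case: (posnP #|X|) => [->|X_gt0]; first by rewrite muln0.
have := cP X (nth i0 s i); rewrite X_gt0 Xm => /(_ isT) H; apply: leq_trans H _.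
by apply: subset_leq_card; apply/subsetP=> v; rewrite !inE => /andP[/andP[_ ->] ->].
Qed.

Lemma reservoirs : exists k (W1 W2 W3 W4 : {set V}) (o : V), let N := 2 ^ k in
  [/\ N * R <= 16 * n,
    [/\ #|W1| = N, #|W2| = N & #|W3| + room (2 * m) K h <= N],
    [/\ [disjoint W1 & W2], [disjoint W1 & W3], [disjoint W2 & W3],
      [disjoint W1 :|: W2 :|: W3 & W4] & o \notin W1 :|: W2 :|: W3 :|: W4],
    [/\ expands_into e m W1, expands_into e m W2 & expands_into e m W3] &
    forall U : {set V}, #|U| <= 2 * (2 * m) -> K.+2 * #|U| <= #|nb e U :&: W4|].
Proof.
have [Vi [z [Vd Vz zR Vexp]]] := small_classes.
have zn : 32 * z <= n by move: zR R_ge; clear; nia.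
have [X0 [_ cX0]] : exists X : {set V}, X \subset setT /\ #|X| = m.-1.
  case: (leqP m.-1 n) => [mn|nm]; first by apply: subset_of_card; rewrite cardsT.
  exfalso; have [X [_ cX]] : exists X : {set V}, X \subset setT /\ #|X| = n.
    by apply: subset_of_card; rewrite cardsT.
  have H0 : n < m by move: nm; clear; lia.
  have := Vexp ord0 X; rewrite cX => /(_ H0) H.
  have := leq_trans H (leq_trans (subset_leq_card (subsetIr _ _)) (Vz ord0)).
  by move: zn n_gt0; clear; nia.
have tz i : t * m.-1 <= #|Vi i|.
  have := Vexp i X0; rewrite cX0 => /(_ _)/leq_trans; apply; first by move: m_gt1; clear; lia.
  exact: subset_leq_card (subsetIr _ _).
have z_gt0 : 0 < z.
  by apply: leq_trans (Vz ord0); apply: leq_trans (tz ord0); rewrite muln_gt0 /= -subn1 subn_gt0.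
(* The Benes network needs a power of two. [N >= 4 * z] leaves [z] for [W3] and [3 * z] for the
   room; [N <= 8 * z] and [32 * z <= n] let all four sets and [o] fit. *)
pose k := up_log 2 (4 * z).
have /andP[kz1 kz2] : 2 ^ k.-1 < 4 * z <= 2 ^ k by apply: up_log_bounds => //; move: z_gt0; clear; lia.
have kz3 : 2 ^ k <= 8 * z.
  case: k kz1 {kz2} => [|k] /=; first by move: z_gt0; clear; lia.
  by rewrite expnS; clear; lia.
set N := 2 ^ k in kz1 kz2 kz3.
pose i1 : 'I_4 := @Ordinal 4 0 isT; pose i2 : 'I_4 := @Ordinal 4 1 isT.
pose i3 : 'I_4 := @Ordinal 4 2 isT; pose i4 : 'I_4 := @Ordinal 4 3 isT.
have Vdis i j x : i != j -> x \in Vi i -> x \notin Vi j.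
  by move=> ij xi; apply: contra ij => xj; rewrite (Vd i j x xi xj).
have cC (A B : {set V}) : #|~: (A :|: B)| + #|A| + #|B| >= n.
  have := cardsC (A :|: B); have := (leq_card_setU A B).1; clear; lia.
have cU (A B : {set V}) : #|A :|: B| <= #|A| + #|B| := (leq_card_setU A B).1.
have [||W1 [V1W W1V cW1]] := @set_between V (Vi i1) (~: (Vi i2 :|: (Vi i3 :|: Vi i4))) N.
- apply/subsetP=> x xi; rewrite !inE !negb_or.
  by rewrite (Vdis i1 i2) ?(Vdis i1 i3) ?(Vdis i1 i4).
- have := cC (Vi i2) (Vi i3 :|: Vi i4); have := cU (Vi i3) (Vi i4).
  move: (Vz i1) (Vz i2) (Vz i3) (Vz i4) z_gt0 kz2 kz3 zn; clear; lia.
have W1P x : x \in W1 -> [/\ x \notin Vi i2, x \notin Vi i3 & x \notin Vi i4].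
  by move/(subsetP W1V); rewrite !inE !negb_or => /and3P[].
have [||W2 [V2W W2V cW2]] := @set_between V (Vi i2) (~: (W1 :|: (Vi i3 :|: Vi i4))) N.
- apply/subsetP=> x xi; rewrite !inE !negb_or (Vdis i2 i3) ?(Vdis i2 i4) // !andbT.
  by apply/negP=> /W1P[]; rewrite xi.
- have := cC W1 (Vi i3 :|: Vi i4); have := cU (Vi i3) (Vi i4).
  move: (Vz i1) (Vz i2) (Vz i3) (Vz i4) z_gt0 kz2 kz3 zn; rewrite cW1; clear; lia.
have W2P x : x \in W2 -> [/\ x \notin W1, x \notin Vi i3 & x \notin Vi i4].
  by move/(subsetP W2V); rewrite !inE !negb_or => /and3P[].
have /card_gt0P[o oP] : 0 < #|~: (W1 :|: W2 :|: Vi i3 :|: Vi i4)|.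
  have := cardsC (W1 :|: W2 :|: Vi i3 :|: Vi i4).
  have := cU (W1 :|: W2 :|: Vi i3) (Vi i4); have := cU (W1 :|: W2) (Vi i3); have := cU W1 W2.
  move: (Vz i3) (Vz i4) z_gt0 kz3 zn; rewrite cW1 cW2; clear; lia.
have dis (A B : {set V}) : (forall x, x \in A -> x \notin B) -> [disjoint A & B].
  by move=> H; apply/pred0P=> x /=; apply/negP=> /andP[/H/negP].
have exp i : expands_into e m (Vi i).
  by move=> X Xm; apply: leq_trans (Vexp i X Xm); rewrite leq_pmull.
exists k, W1, W2, (Vi i3), (Vi i4), o; split.
- by rewrite -/N; move: kz3 zR; clear; nia.
- split=> //; rewrite -/N /room /step_room.
  move: (Vz i3) (tz i3) kz2 m_gt1 link_len_le; clear; nia.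
- split; [apply: dis | apply: dis | apply: dis | apply: dis | by rewrite -in_setC].
  + by move=> x xW; apply/negP=> /W2P[]; rewrite xW.
  + by move=> x /W1P[].
  + by move=> x /W2P[].
  + by move=> x; rewrite !inE => /orP[/orP[/W1P[]|/W2P[]]|/Vdis] //; apply.
- split; [exact: expands_intoS V1W (exp i1) | exact: expands_intoS V2W (exp i2) | exact: exp].
move=> U cU4; case: (ltnP #|U| m) => Um.
  by apply: leq_trans (Vexp i4 U Um); rewrite leq_mul2r; apply/orP; right; clear; lia.
(* Origin of the [12] in [t]: by [tz] the class has at least [12 * K.+2 * m.-1 >= 6 * K.+2 * m]
   vertices. After the loss of [2 * m], at least [K.+2 * (4 * m)] remain, enough for the largest
   [U]. *)
have cY : #|Vi i4 :\: nb e U| < 2 * m.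
  rewrite ltnNge; apply/negP=> /(joined_overlap joined Um)[x [y [xU]]].
  by rewrite inE => /andP[/negP yn _] exy; apply: yn; apply/nbP; exists x.
have := cardsID (nb e U) (Vi i4); rewrite setIC.
move: (tz i4) cY cU4 m_gt1; clear; nia.
Qed.

Hypothesis K_gt1 : 1 < K.
Hypothesis Delta_gt0 : 0 < Delta.
Hypothesis Delta_K : Delta <= K.
Hypothesis Kh : 2 * m <= K ^ h.
Hypothesis numbers : forall k, 2 ^ k * R <= 16 * n ->
  let l := (2 * k * Lw h).+2 + link_len h in
  let c := (2 ^ k * (link_len h).+1 + 1) * ((link_len h).+1 * Delta ^ link_len h) in
  2 ^ k * (2 * k * Lw h + 4) <= n /\
  2 ^ k * (l.+1 * l.+1) + l.+1 * (2 * (1 + Delta * c)) < n.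

(** The threshold [c] is what [separated_family] asks for. With at most [c] leaf parents, each leaf
    is the root or one of at most [Delta] children of such a parent, and few leaves leave room for
    [bare_family]. *)
Lemma embed_tree (T : finType) (r : T) (par : T -> T) (dep : T -> nat) :
  #|T| = n -> dep r = 0 -> (forall v, v != r -> dep v = (dep (par v)).+1) ->
  (forall v, #|children r par v| <= Delta) ->
  exists f : T -> V, injective f /\ forall v, v != r -> e (f (par v)) (f v).
Proof.
move=> cT dep_r dep_par ch_le.
have [k [W1 [W2 [W3 [W4 [o [NR [c1 c2 c3] [d12 d13 d23 d4 oW] [e1 e2 e3] e4]]]]]]] := reservoirs.
have [I [ls [cI sls pls rls]]] := benes k.
have [num1 num2] := numbers NR.
set c := (_ + 1) * _ in num2.
have [many|few] := ltnP c #|leaf_parents r par|.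
  rewrite /c -cI in many.
  have [p [pP p_sep]] := separated_family dep_r dep_par ch_le Delta_gt0 many.
  exact: (leaf_case e_sym m_gt0 K_gt1 Delta_K Kh joined c1 d13 d4 oW e1 e3 e4 c3 cI cT dep_r dep_par ch_le pP p_sep).
have cleaves : #|leaves r par| <= 1 + Delta * c.
  apply: leq_trans (_ : #|r |: \bigcup_(v in leaf_parents r par) children r par v| <= _).
    apply: subset_leq_card; apply/subsetP=> x xl; rewrite in_setU1; case: (eqVneq x r) => //= xr.
    have xc : x \in children r par (par x) by rewrite inE xr eqxx.
    by apply/bigcupP; exists (par x); rewrite // inE; apply/existsP; exists x; rewrite xc.
  apply: leq_trans (leq_card_setU _ _).1 _; rewrite cards1 leq_add2l.
  apply: leq_trans (card_bigcup_le _ _) _.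
  apply: leq_trans (_ : \sum_(v in leaf_parents r par) Delta <= _); first exact: leq_sum.
  by rewrite sum_nat_const mulnC leq_mul2l few orbT.
set l := _ + link_len h in num2.
have [|v_ [vb v_sep]] := @bare_family T r par dep dep_r dep_par I l.
  rewrite cI cT; apply: leq_ltn_trans num2; rewrite leq_add2l leq_mul2l.
  by rewrite leq_mul2l cleaves !orbT.
have lE : l = (size ls * Lw h).+2 + link_len h by rewrite sls.
rewrite lE in vb v_sep.
apply: (path_case e_sym m_gt0 K_gt1 Delta_K Kh joined c1 c2 d12 d13 d23 d4 oW e1 e2 e3 e4 c3 cI cT dep_r dep_par ch_le pls rls _ vb v_sep).
by rewrite sls cT.
Qed.

End Expander.

(** * Numerical choices *)

(** From [s <= 12 * q.+1 <= 2 ^ (q + 4)] the left side is at most [2 ^ (6 * q + 51)], and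
    [6 * q + 51 <= 12 * q <= s] when [q >= 9], which [s >= 108] ensures. *)
Lemma sextic_le_exp s : 108 <= s -> 2 ^ 27 * s ^ 6 <= 2 ^ s.
Proof.
move=> s_ge; pose q := s %/ 12.
have sq : s < q.+1 * 12 by rewrite ltn_ceil.
have qs : q * 12 <= s by apply: leq_trunc_div.
have s_le : s <= 2 ^ (q + 4).
  apply: leq_trans (ltnW sq) _; rewrite expnD.
  by apply: leq_mul => //; apply: ltn_expl.
apply: leq_trans (_ : 2 ^ 27 * 2 ^ ((q + 4) * 6) <= _).
  by rewrite leq_mul2l; apply/orP; right; rewrite expnM leq_expl.
rewrite -expnD leq_exp2l //; move: s_ge sq qs; clear; lia.
Qed.

Section Numbers.
Variables s Delta : nat.
Hypothesis s_ge : 108 <= s.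
Hypothesis Delta_gt1 : 1 < Delta.

Let D_gt0 : 0 < Delta := ltnW Delta_gt1.

Lemma exp2_le a b : a <= b -> 2 ^ a <= Delta ^ b.
Proof. by move=> ab; apply: leq_trans (leq_expl a Delta_gt1) _; apply: leq_pexp2l. Qed.

(* Linking paths then have length about [2 s], so that a vertex has at most
   [Delta ^ (2 s + O(1))] descendants within a link; the number of colours exceeds
   this, and [num_colors * arity] stays below [Delta ^ (5 s)]. *)
Definition arity := Delta ^ (2 * s).
Definition num_colors := Delta ^ (3 * s - 6).

(** [2 * s + 5] is [link_len s.+1] plus one: the descendants along a link, and a factor [Delta] for
    the leaves below one parent. The remaining exponent [s - 11] absorbs the polynomial and the
    constant. *)
Lemma num_colors_ge : 2 ^ 16 * s ^ 6 * Delta ^ (2 * s + 5) <= num_colors.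
Proof.
have -> : num_colors = Delta ^ (s - 11) * Delta ^ (2 * s + 5).
  by rewrite -expnD; congr (_ ^ _); move: s_ge; clear; lia.
rewrite leq_mul2r; apply/orP; right; apply: leq_trans (exp2_le (leqnn (s - 11))).
rewrite -(leq_pmul2l (expn_gt0 2 11 : 0 < 2 ^ 11)) mulnA -!expnD.
have -> : 11 + (s - 11) = s by move: s_ge; clear; lia.
exact: sextic_le_exp.
Qed.

(** Origin of the sixth power: [k] and [Lw h] are of order [s ^ 2], so [l] is of order [s ^ 4]. The
    term [l * Delta * c] has order [s ^ 6 * N * Q], and [N * l ^ 2], of order [s ^ 8 * N], is no
    larger because [s ^ 2 <= Q]. *)
Lemma numbers_ok n k : n <= 2 ^ (2 * s ^ 2) -> 2 ^ k * num_colors <= 16 * n ->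
  let h := s.+1 in
  let l := (2 * k * Lw h).+2 + link_len h in
  let c := (2 ^ k * (link_len h).+1 + 1) * ((link_len h).+1 * Delta ^ link_len h) in
  2 ^ k * (2 * k * Lw h + 4) <= n /\
  2 ^ k * (l.+1 * l.+1) + l.+1 * (2 * (1 + Delta * c)) < n.
Proof.
move=> n_le kR h l c; set N := 2 ^ k in kR c *; set Q := Delta ^ (2 * s + 5).
have N_gt0 : 0 < N by rewrite expn_gt0.
have Q_gt0 : 0 < Q by rewrite expn_gt0 D_gt0.
have sQ : s ^ 2 <= Q.
  apply: leq_trans (_ : (2 ^ s) ^ 2 <= _); first by rewrite leq_expl // ltnW // ltn_expl.
  by rewrite -expnM; apply: exp2_le; clear; lia.
have nN : 2 ^ 12 * (s ^ 6 * (N * Q)) <= n.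
  rewrite -(leq_pmul2l (expn_gt0 2 4 : 0 < 2 ^ 4)); apply: leq_trans kR.
  apply: leq_trans (_ : N * (2 ^ (4 + 12) * s ^ 6 * Q) <= _); last by rewrite leq_mul2l num_colors_ge orbT.
  apply: eq_leq; rewrite expnD; move: (2 ^ 4) (2 ^ 12) (s ^ 6) => x y z.
  by clearbody N Q; clear; nia.
have nN' : 1000 * (s ^ 6 * (N * Q)) < n.
  apply: leq_trans nN; rewrite ltn_mul2r; apply/andP; split; last by [].
  have s_gt0 : 0 < s by move: s_ge; clear; lia.
  have s6_gt0 : 0 < s ^ 6 by rewrite expn_gt0 s_gt0.
  by rewrite muln_gt0 s6_gt0 muln_gt0 N_gt0 Q_gt0.
pose u := s ^ 2.
have su : 108 * s <= u by rewrite /u expnS expn1 leq_mul2r s_ge orbT.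
have u_gt0 : 0 < u by move: su s_ge; clear; lia.
have s6 : s ^ 6 = u * (u * u) by rewrite /u -!expnD.
have kn : k <= 2 * u.
  rewrite -(leq_exp2l (m := 2)) //; apply: leq_trans n_le; rewrite -/N.
  have : 2 ^ 4 <= num_colors by apply: exp2_le; move: s_ge; clear; lia.
  by move: kR; clear; nia.
have LwE : Lw h <= 5 * u.
  by rewrite /Lw /link_len /h /u expnS expn1; move: s_ge; clear; nia.
have rE : link_len h = 2 * s + 4 by rewrite /link_len /h; clear; lia.
have aE : 2 * k * Lw h <= 20 * (u * u) by move: kn LwE; clear; nia.
have lE : l.+1 <= 21 * (u * u).
  rewrite /l rE; move: aE su s_ge u_gt0; clear; nia.
have r3 : (link_len h).+1 <= 3 * s by rewrite rE; move: s_ge; clear; lia.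
have cE : Delta * c <= 12 * (u * (N * Q)).
  have -> : Delta * c = (N * (link_len h).+1 + 1) * ((link_len h).+1 * Q).
    rewrite /c /Q mulnCA; congr (_ * _); rewrite mulnCA; congr (_ * _).
    by rewrite -expnS rE; congr (_ ^ _); clear; lia.
  apply: leq_trans (_ : (4 * (s * N)) * (3 * s * Q) <= _).
    apply: leq_mul; last by rewrite leq_mul2r r3 orbT.
    by move: r3 N_gt0 s_ge; clear; nia.
  by apply: eq_leq; rewrite /u expnS expn1; clear; nia.
have {}sQ : u <= Q := sQ.
clearbody u N Q; split.
  apply: leq_trans (_ : N * (24 * (u * u)) <= _).
    by rewrite leq_mul2l; apply/orP; right; move: aE u_gt0; clear; nia.
  apply: leq_trans (ltnW nN'); rewrite s6.
  have : (u * u) * N <= u * (u * u) * (N * Q).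
    by apply: leq_mul; [rewrite leq_pmull | rewrite leq_pmulr].
  by clear; nia.
apply: leq_ltn_trans nN'.
have t1 : N * (l.+1 * l.+1) <= 441 * (u * (u * u) * (N * Q)).
  apply: leq_trans (_ : N * ((21 * (u * u)) * (21 * (u * u))) <= _).
    by rewrite leq_mul2l leq_mul ?orbT.
  apply: leq_trans (_ : 441 * (u * (u * u) * (N * u)) <= _); first by clear; nia.
  by rewrite leq_mul2l leq_mul2l leq_mul2l sQ !orbT.
have t2 : l.+1 * (2 * (1 + Delta * c)) <= 546 * (u * (u * u) * (N * Q)).
  apply: leq_trans (_ : (21 * (u * u)) * (2 * (13 * (u * (N * Q)))) <= _).
    apply: leq_mul => //; rewrite leq_mul2l /=.
    have : 0 < u * (N * Q) by rewrite !muln_gt0 u_gt0 N_gt0 Q_gt0.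
    by move: cE; clear; lia.
  by apply: eq_leq; clear; nia.
by rewrite s6; move: t1 t2; clear; lia.
Qed.

Lemma expansion_ok n : n <= 2 ^ (2 * s ^ 2) -> num_colors <= n ->
  exists g, 2 * num_colors * g <= Delta ^ (5 * s) /\
    2 ^ (12 * arity.+2) * (n * (n * num_colors).+1) <= 2 ^ g.
Proof.
(* The second summand bounds the binary logarithm of [2 * n ^ 3], which exceeds the polynomial
   factor. *)
move=> n_le Rn; exists (12 * arity.+2 + (6 * s ^ 2 + 1)); split.
  have gE : 12 * arity.+2 + (6 * s ^ 2 + 1) <= 13 * arity.
    have : 25 + 6 * s ^ 2 <= arity; last by clear; lia.
    apply: leq_trans (exp2_le (_ : s <= 2 * s)); last by rewrite leq_pmull.
    apply: leq_trans (sextic_le_exp s_ge).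
    have -> : s ^ 6 = s ^ 2 * s ^ 4 by rewrite -expnD.
    have s_gt0 : 0 < s by move: s_ge; clear; lia.
    apply: leq_trans (_ : 2 ^ 5 * (s ^ 2 * 1) <= _).
      have : 0 < s ^ 2 by rewrite expn_gt0 s_gt0.
      by rewrite -[2 ^ 5]/32 muln1; clear; lia.
    apply: leq_mul; first by rewrite leq_exp2l.
    by rewrite leq_mul2l expn_gt0 s_gt0 orbT.
  apply: leq_trans (_ : 2 * num_colors * (13 * arity) <= _); first by rewrite leq_mul2l gE orbT.
  have -> : Delta ^ (5 * s) = Delta ^ 6 * (num_colors * arity).
    by rewrite -!expnD; congr (_ ^ _); move: s_ge; clear; lia.
  (* The [6] subtracted in the exponent of [num_colors] pays for the constant [2 * 13]. *)
  have : 26 <= Delta ^ 6 by apply: leq_trans (exp2_le (leqnn 6)).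
  by move: num_colors arity; clear; nia.
rewrite expnD leq_mul2l; apply/orP; right.
have n_gt0 : 0 < n by apply: leq_trans Rn; rewrite expn_gt0 D_gt0.
apply: leq_trans (_ : 2 * (n * n * n) <= _).
  apply: leq_trans (_ : n * (n * n).+1 <= _); first by rewrite leq_mul2l ltnS leq_mul2l Rn !orbT.
  by move: n_gt0; clear; nia.
have -> : 6 * s ^ 2 + 1 = 1 + (2 * s ^ 2 + 2 * s ^ 2 + 2 * s ^ 2) by clear; lia.
move: (2 * s ^ 2) n_le => a n_le; rewrite !expnD expn1 leq_mul2l; apply/orP; right.
by apply: leq_mul => //; apply: leq_mul.
Qed.

Lemma universal_core (V : finType) (e : rel V) m : symmetric e -> 1 < m <= #|V| ->
  #|V| <= 2 ^ (2 * s ^ 2) ->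
  (forall X Y : {set V}, #|X| = m -> #|Y| = m -> [disjoint X & Y] ->
    exists x y, [/\ x \in X, y \in Y & e x y]) ->
  (forall X : {set V}, 0 < #|X| < m -> Delta ^ (5 * s) * #|X| <= #|nb e X :\: X|) ->
  forall (T : finType) (r : T) (par : T -> T) (dep : T -> nat),
  #|T| = #|V| -> dep r = 0 -> (forall v, v != r -> dep v = (dep (par v)).+1) ->
  (forall v, #|children r par v| <= Delta) ->
  exists f : T -> V, injective f /\ forall v, v != r -> e (f (par v)) (f v).
Proof.
move=> e_sym /andP[m_gt1 mV] V_le joined expands.
have K_ge : 2 ^ (2 * s) <= arity by apply: exp2_le.
have R_le : num_colors <= #|V|.
  have [X [_ cX]] : exists X : {set V}, X \subset setT /\ #|X| = 1.
    by apply: subset_of_card; rewrite cardsT; apply: leq_trans mV; apply: ltnW.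
  apply: leq_trans (_ : Delta ^ (5 * s) <= _); first by apply: leq_pexp2l => //; clear; lia.
  have := expands X; rewrite cX m_gt1 muln1 => /(_ isT)/leq_trans; apply; exact: max_card.
have [g [g1 g2]] := expansion_ok V_le R_le.
apply: (@embed_tree V e e_sym m arity s.+1 Delta num_colors g) => //.
- by move=> X Xm; apply: leq_trans (expands X Xm); rewrite leq_mul2r g1 orbT.
- apply: leq_trans (_ : 2 ^ 6 <= _); first by [].
  by apply: exp2_le; move: s_ge; clear; lia.
- apply: leq_trans K_ge; rewrite mulnC expnM; have := ltn_expl s (isT : 1 < 2).
  by rewrite /link_len expnS expn1; move: s_ge; clear; nia.
- exact: leq_trans (ltnW m_gt1) mV.
- by apply: leq_trans K_ge; rewrite -(expn0 2) ltn_exp2l // muln_gt0 /=; move: s_ge; clear; lia.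
- by rewrite -[Delta]expn1; apply: leq_pexp2l => //; move: s_ge; clear; lia.
(* Depth [s.+1] suffices because [2 * s ^ 2 + 1 <= 2 * s * s.+1]. *)
- apply: leq_trans (_ : 2 * 2 ^ (2 * s ^ 2) <= _).
    by rewrite leq_mul2l (leq_trans mV V_le) orbT.
  rewrite -expnS -expnM; apply: exp2_le.
  by rewrite expnS expn1; move: s_ge; clear; nia.
- by move=> k; apply: numbers_ok.
Qed.

End Numbers.

(** * The theorem *)

Lemma nbrsE (G : sgraph) (X : {set G}) : nbrs X = nb (@edge G) X :\: X.
Proof.
apply/setP=> w; rewrite !in_setD; congr (_ && _).
apply/bigcupP/nbP => [[v vX]|[v vX evw]]; first by rewrite inE; exists v.
by exists v; rewrite // inE.
Qed.

Lemma complete_contains (G T : sgraph) :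
  (forall x y : G, x != y -> edge x y) -> #|T| = #|G| -> contains_subgraph G T.
Proof.
move=> complG cT; have [f [f_inj _]] : exists f : T -> G, injective f /\ f @: T = [set: G].
  by apply: indexing; rewrite cardsT.
exists f; split=> // x y exy; apply: complG; apply: contraTneq exy => /f_inj->.
by rewrite edge_irrefl.
Qed.

Lemma tree_embeds (G T : sgraph) s Delta m : 108 <= s -> 1 < Delta ->
  1 < m <= #|G| -> #|G| <= 2 ^ (2 * s ^ 2) ->
  (forall X Y : {set G}, #|X| = m -> #|Y| = m -> [disjoint X & Y] -> 0 < edges_between X Y) ->
  (forall X : {set G}, 0 < #|X| < m -> Delta ^ (5 * s) * #|X| <= #|nbrs X|) ->
  is_tree T -> #|T| = #|G| -> max_degree T <= Delta -> contains_subgraph G T.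
Proof.
move=> s_ge D_gt1 mG G_le joined expands [[/card_gt0P[r _] T_conn] T_acyc] cT T_deg.
have [par [dep [dep_r parP edgeP]]] :=
  rooted_tree r (@edge_sym T) (@edge_irrefl T) T_conn T_acyc.
have [||||f [f_inj f_edge]] := @universal_core s Delta s_ge D_gt1 G (@edge G) m (@edge_sym G) mG G_le _ _
    T r par dep cT dep_r.
- move=> X Y cX cY /(joined X Y cX cY)/card_gt0P[[x y]]; rewrite inE /= => /and3P[xX yY exy].
  by exists x, y.
- by move=> X /expands; rewrite nbrsE.
- by move=> v /parP[].
- move=> v; apply: leq_trans T_deg; apply: leq_trans (leq_bigmax v).
  apply: subset_leq_card; apply/subsetP=> c; rewrite !inE => /andP[cr /eqP <-].
  by have [] := parP c cr.
exists f; split=> // x y /edgeP[[xr ->]|[yr ->]]; last exact: f_edge.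
by rewrite edge_sym; apply: f_edge.
Qed.

From mathcomp Require Import all_classical all_reals all_analysis.
Import Order.TTheory GRing.Theory Num.Theory.
Local Open Scope ring_scope.

(** From [exp (-1/4) >= 3/4] one gets [exp (1/4) <= 4/3], and the twelfth power of [4/3] is just
    below [32]. *)
Lemma expR3_le (R : realType) : expR (3 : R) <= 2 ^+ 5.
Proof.
have e4 : expR (4^-1 : R) <= 4 / 3.
  have := expR_ge1Dx (- 4^-1 : R); rewrite expRN => H.
  have e_gt0 := expR_gt0 (4^-1 : R).
  have : (3 / 4) * expR (4^-1 : R) <= 1.
    by rewrite -[leRHS](mulVf (lt0r_neq0 e_gt0)) ler_pM2r //; lra.
  lra.
have -> : (3 : R) = 4^-1 * 12%:R by lra.
rewrite expRM_natr; apply: le_trans (_ : (4 / 3) ^+ 12 <= _); last by lra.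
by rewrite lerXn2r // nnegrE ?expR_ge0 //; lra.
Qed.

(** Cubes are compared, since [e ^ 3 <= 2 ^ 5] has integer exponents: [n ^ 3] is at most [2] to the
    power [5 (s+1)^2], which is at most [6 s^2]. *)
Lemma le_exp2_of_ln (R : realType) n s : (0 < n)%N -> (108 <= s)%N ->
  ln (n%:R : R) <= s.+1%:R ^+ 2 -> (n <= 2 ^ (2 * s ^ 2))%N.
Proof.
move=> n_gt0 s_ge ln_le; rewrite -(leq_exp2r _ _ (isT : 0 < 3)%N) -expnM.
apply: (@leq_trans (2 ^ (5 * s.+1 ^ 2))); last first.
  by rewrite leq_exp2l // !expnS !expn0; move: s_ge; clear; nia.
rewrite -(ler_nat R) natrX -(@lnK _ (n%:R : R)) ?posrE ?ltr0n // -expRM_natl.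
apply: (@le_trans _ _ (expR (3 * (s.+1 ^ 2)%N%:R))).
  by rewrite ler_expR ler_pM2l // natrX.
rewrite expRM_natr natrX exprM lerXn2r // ?nnegrE ?expR_ge0 ?exprn_ge0 //.
exact: expR3_le.
Qed.

Theorem theorem1p11 (R : realType) :
  exists n0 : nat, forall n Delta : nat, (n0 <= n)%N -> (2 <= Delta)%N ->
    forall (d : R) (G : sgraph),
      expander n d G ->
      Delta%:R `^ (5 * Num.sqrt (ln n%:R)) <= d ->
      universal (tree_family n Delta) G.
Proof.
(* This choice of [n0] makes [sqrt (ln n)], and hence its floor [s], at least [108]. *)
exists (Num.truncn (expR (108 ^+ 2 : R))).+1 => n Delta n_ge D_ge d G [d_gt0 cG expG joinG] d_ge T [T_tree cT T_deg].
have n_gt0 : (0 < n)%N by apply: leq_trans n_ge.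
have ln_ge : 108 ^+ 2 <= ln (n%:R : R).
  rewrite -ler_expR lnK ?posrE ?ltr0n //; apply/ltW/(lt_le_trans (truncnS_gt _)).
  by rewrite ler_nat.
have ln_ge0 : 0 <= ln (n%:R : R) by apply: le_trans ln_ge; rewrite exprn_ge0.
pose x : R := Num.sqrt (ln n%:R); pose s := Num.truncn x.
have x_ge0 : 0 <= x by apply: sqrtr_ge0.
have /andP[sx xs] := truncn_itv x_ge0; rewrite -/s in sx xs.
have s_ge : (108 <= s)%N.
  rewrite /s truncn_ge_nat // -(ler_pXn2r (isT : 0 < 2)%N) ?nnegrE //.
  by rewrite sqr_sqrtr.
have n_le : (n <= 2 ^ (2 * s ^ 2))%N.
  apply: (@le_exp2_of_ln R) => //; rewrite -(sqr_sqrtr ln_ge0) -/x.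
  by rewrite lerXn2r ?nnegrE // ltW.
have D_le : (Delta ^ (5 * s))%:R <= d.
  apply: le_trans d_ge; rewrite natrX -powR_mulrn // natrM.
  by apply: ler_powR; [rewrite ler1n ltnW | rewrite ler_pM2l].
have d_ge1 : 1 <= d by apply: le_trans D_le; rewrite ler1n expn_gt0 ltnW.
(* [m] will be the ceiling of [n / (2 * d)]: smaller sets expand, and disjoint sets of size [m] are
   joined. *)
have ex_m : exists k : nat, n%:R / (2 * d) <= k%:R.
  exists (Num.truncn (n%:R / (2 * d))).+1; exact/ltW/truncnS_gt.
have d2_gt0 : 0 < 2 * d by rewrite mulr_gt0.
case: (ex_minnP ex_m) => m m_ge m_min.
have m_lt k : (k < m)%N -> k%:R < n%:R / (2 * d).
  by move=> km; rewrite ltNge; apply/negP=> /m_min; rewrite leqNgt km.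
have mn : (m <= n)%N.
  apply: m_min; rewrite ler_pdivrMr // ler_peMr //; apply: le_trans d_ge1 _.
  by rewrite ler_peMl ?ler1n // ltW.
(* If [m <= 1], the second expander condition already covers singletons and [G] is complete. *)
have [m_le1|m_gt1] := leqP m 1.
  apply: complete_contains; last by rewrite cT cG.
  move=> u v uv; have := joinG [set u] [set v]; rewrite !cards1 => /(_ _ erefl).
  have -> : n%:R / (2 * d) <= 1%:R by apply: le_trans m_ge _; rewrite ler_nat.
  have -> : [disjoint [set u] & [set v]].
    by apply/pred0P=> w /=; rewrite !finset.inE; case: eqP => //= ->; apply/negbTE.
  move=> /(_ isT isT)/card_gt0P[[u' v']]; rewrite finset.inE /= => /and3P[].
  by move=> /set1P-> /set1P->.
apply: (@tree_embeds G T s Delta m) => //.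
- by rewrite m_gt1 cG.
- by rewrite cG.
- by move=> X Y cX cY XY; apply: joinG => //; rewrite cX ?cY.
- move=> X /andP[X_gt0 Xm]; have := expG X X_gt0 (m_lt _ Xm) => H.
  rewrite -(ler_nat R) natrM; apply: le_trans H.
  by rewrite ler_wpM2r.
- by rewrite cT cG.
Qed.
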